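(* The following statements are equivalent: (i) $W(L^\infty,Y)=W(L^\infty,Y,Q)$ is independent of the choice of the neighbourhood $Q$ of $e$ (with equivalent quasi-norms for different choices). (ii) For all relatively separated sets $X$ the space $Y_d=Y_d(X,Q)$ is independent of the choice of the neighbourhood $Q$ of $e$ (with equivalent quasi-norms for different choices). (iii) $W(L^\infty,Y)=W(L^\infty,Y,Q)$ is right translation invariant (for all choices of $Q$). If one (and hence all) of these conditions are satisfied, then for each $B\in\{L^\infty(G),L^1(G),M(G)\}$ also $W(B,Y)=W(B,Y,Q)$ is independent of the choice of $Q$. Moreover, the expression $$\|F|W(B,Y_d)\|:=\big\|(\|F\psi_i|B\|)_{i\in I}\,\big|\,Y_d(X)\big\|$$ defines an equivalent quasi-norm on $W(B,Y)$, where $(\psi_i)_{i\in I}$ is a BUPU corresponding to the well-spread set $X=(x_i)_{i\in I}$.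
   Context: $G$ is a locally compact group with identity $e$ and left Haar measure. $L_xF(y)=F(x^{-1}y)$, $R_xF(y)=F(yx)$. $\chi_S$ is the characteristic function of $S$. $Y$ is a quasi-Banach space of measurable functions on $G$ (functions equal a.e. identified): a linear space, complete with respect to a quasi-norm $\|\cdot|Y\|$ which satisfies $\|f+g|Y\|^p\le\|f|Y\|^p+\|g|Y\|^p$ for some fixed $0<p\le1$. $Y$ contains the characteristic function of every compact subset of $G$ and is solid: if $F\in Y$, $H$ is measurable and $|H|\le|F|$ a.e., then $H\in Y$ and $\|H|Y\|\le\|F|Y\|$. Let $B$ be one of $L^\infty(G)$, $L^1(G)$, or $M(G)$ (complex Radon measures with total variation norm), and let $B_{loc}$ be the set of $F$ with $\chi_KF\in B$ for all compact $K$. ''Neighbourhood $Q$ of $e$'' always means a relatively compact (measurable) neighbourhood. For $F\in B_{loc}$ put $K(F,Q,B)(x)=\|(L_x\chi_Q)F|B\|$ and $W(B,Y)=W(B,Y,Q)=\{F\in B_{loc}:K(F,Q,B)\in Y\}$ with quasi-norm $\|F|W(B,Y,Q)\|=\|K(F,Q,B)|Y\|$. $W(L^\infty,Y)$ is right translation invariant if for every such $Q$ and every $x\in G$ the operator $R_x$ maps $W(L^\infty,Y,Q)$ boundedly into itself. A discrete family $X=(x_i)_{i\in I}$ in $G$ is $V$-dense if $G=\bigcup_{i}x_iV$ ($V$ a relatively compact neighbourhood of $e$); relatively separated if for every compact $K\subset G$ there is a constant $C_K$ with $\sup_{j\in I}\#\{i\in I:x_iK\cap x_jK\ne\emptyset\}\le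 C_K$; well-spread if it is relatively separated and $V$-dense for some $V$. The sequence space is $Y_d=Y_d(X)=Y_d(X,Q)=\{(\lambda_i)_{i\in I}:\sum_{i}|\lambda_i|\chi_{x_iQ}\in Y\}$ with quasi-norm $\|(\lambda_i)_{i\in I}|Y_d\|=\|\sum_i|\lambda_i|\chi_{x_iQ}|Y\|$. A bounded uniform partition of unity (BUPU) of size $U$ ($U$ a relatively compact neighbourhood of $e$) corresponding to a well-spread family $X=(x_i)_{i\in I}$ is a family $\psi_i\in C_0(G)$, $i\in I$, with $0\le\psi_i\le1$, $\sum_i\psi_i\equiv1$, and $\operatorname{supp}\psi_i\subset x_iU$. *)

(* Defs.v *)
From HB Require Import structures.
From mathcomp Require Import all_boot all_order all_algebra.
From mathcomp Require Import all_classical all_reals all_analysis.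
From mathcomp Require Import complex.

Set Implicit Arguments.
Unset Strict Implicit.
Unset Printing Implicit Defensive.

Import Order.TTheory GRing.Theory Num.Theory.
Import numFieldNormedType.Exports.

Local Open Scope classical_set_scope.
Local Open Scope ring_scope.
Local Open Scope complex_scope.

HB.mixin Record PointedTopological_isTopGroup G
    of PointedTopological G & monoid.Group G := {
  mulg_continuous_subproof : continuous (fun xy : G * G => (xy.1 * xy.2)%g);
  invg_continuous_subproof : continuous (fun x : G => (x^-1)%g)
}.

(* The distinguished point is only there because the library's generated
   sigma-algebras require a pointed type; it need not be the identity. *)
#[short(type="topGroupType")]
HB.structure Definition TopGroup :=
  { G of PointedTopological G & monoid.Group G
       & PointedTopological_isTopGroup G }.

Definition borel (G : topGroupType) := g_sigma_algebraType (@open G).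

Definition borel_set (G : topGroupType) (A : set G) : Prop :=
  measurable (A : set (borel G)).

Definition ltrans (G : topGroupType) (x : G) (A : set G) : set G :=
  [set (x * y)%g | y in A].

Definition right_translate (G : topGroupType) (T : Type) (x : G) (F : G -> T) :
  G -> T := fun y => F (y * x)%g.

Record left_haar_measure (R : realType) (G : topGroupType)
    (mu : {measure set (borel G) -> \bar R}) : Prop := {
  haar_invariant : forall (x : G) (A : set G), borel_set A ->
    mu (ltrans x A) = mu A;
  haar_neq0 : mu [set: G] <> 0%E;
  haar_compact : forall K : set G, compact K -> (mu K < +oo)%E;
  haar_outer_regular : forall A : set G, borel_set A ->
    mu A = ereal_inf [set mu U | U in [set U : set G | open U /\ A `<=` U]];
  haar_inner_regular : forall U : set G, open U ->
    mu U = ereal_sup [set mu K | K in [set K : set G | compact K /\ K `<=` U]]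
}.

Definition unit_nbhd (G : topGroupType) (Q : set G) : Prop :=
  [/\ nbhs (1%g : G) Q, precompact Q & borel_set Q].

(* Real part, imaginary part and modulus with values in R: on R[i] itself the
   library's norm is complex-valued. *)
Definition reC (R : realType) (z : R[i]) : R := complex.Re z.
Definition imC (R : realType) (z : R[i]) : R := complex.Im z.
Definition absC (R : realType) (z : R[i]) : R := Normc.normc z.

Definition measurable_cfun (R : realType) (G : topGroupType) (F : G -> R[i]) :
    Prop :=
  measurable_fun [set: borel G] (fun x : borel G => reC (F x)) /\
  measurable_fun [set: borel G] (fun x : borel G => imC (F x)).

(* A space of complex functions on D with a functional on it; [qnorm] is
   meaningful on [qdom] only. *)
Record qspace (R : realType) (D : Type) := QSpace {
  qdom : (D -> R[i]) -> Prop;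
  qnorm : (D -> R[i]) -> R
}.

(* [null F] says that F is identified with 0. *)
Record is_quasinormed (R : realType) (D : Type) (null : (D -> R[i]) -> Prop)
    (S : qspace R D) : Prop := {
  qn_dom0 : qdom S (fun=> 0);
  qn_domD : forall F H, qdom S F -> qdom S H -> qdom S (fun t => F t + H t);
  qn_domZ : forall c F, qdom S F -> qdom S (fun t => c * F t);
  qn_ge0 : forall F, qdom S F -> 0 <= qnorm S F;
  qn_eq0 : forall F, qdom S F -> (qnorm S F = 0 <-> null F);
  qn_homo : forall c F, qdom S F ->
    qnorm S (fun t => c * F t) = absC c * qnorm S F;
  qn_triangle : exists C : R, forall F H, qdom S F -> qdom S H ->
    qnorm S (fun t => F t + H t) <= C * (qnorm S F + qnorm S H)
}.

Definition equiv_spaces (R : realType) (D : Type) (S1 S2 : qspace R D) :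
    Prop :=
  (forall F, qdom S1 F <-> qdom S2 F) /\
  exists c C : R, [/\ 0 < c, 0 < C & forall F, qdom S1 F ->
    c * qnorm S1 F <= qnorm S2 F <= C * qnorm S1 F].

Definition q_complete (R : realType) (D : Type) (S : qspace R D) : Prop :=
  forall u : nat -> D -> R[i], (forall n, qdom S (u n)) ->
    (forall e : R, 0 < e -> exists N : nat, forall m n : nat,
       (N <= m)%N -> (N <= n)%N -> qnorm S (fun t => u m t - u n t) < e) ->
    exists2 F, qdom S F & forall e : R, 0 < e -> exists N : nat,
       forall n : nat, (N <= n)%N -> qnorm S (fun t => u n t - F t) < e.

Record quasi_banach_function_space (R : realType) (G : topGroupType)
    (mu : {measure set (borel G) -> \bar R}) (Y : qspace R G) : Prop := {
  qbfs_measurable : forall F, qdom Y F -> measurable_cfun F;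
  qbfs_quasinormed :
    is_quasinormed (fun F => {ae mu, forall x : borel G, F x = 0}) Y;
  qbfs_p_triangle : exists p : R, [/\ 0 < p, p <= 1 &
    forall F H, qdom Y F -> qdom Y H ->
      qnorm Y (fun x => F x + H x) `^ p <= qnorm Y F `^ p + qnorm Y H `^ p];
  qbfs_complete : q_complete Y;
  qbfs_compact : forall K : set G, compact K -> qdom Y (\1_K : G -> R[i]);
  qbfs_solid : forall F H, qdom Y F -> measurable_cfun H ->
    {ae mu, forall x : borel G, absC (H x) <= absC (F x)} ->
    qdom Y H /\ qnorm Y H <= qnorm Y F
}.

(* Complex measures are set functions [set G -> R[i]], of which only the values
   on Borel sets matter. *)
Definition measure_variation (R : realType) (G : topGroupType)
    (nu : set G -> R[i]) (S : set G) : \bar R :=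
  ereal_sup [set (\sum_(n <oo) (absC (nu (A n)))%:E)%E | A in
    [set A : nat -> set G | [/\ forall n, borel_set (A n), trivIset setT A
                              & \bigcup_n A n = S]]].

Definition is_real_measure (R : realType) (G : topGroupType)
    (nu : set G -> R) : Prop :=
  exists c : {charge set (borel G) -> \bar R},
    forall A : set G, borel_set A -> c A = (nu A)%:E.

Record complex_radon_measure (R : realType) (G : topGroupType)
    (nu : set G -> R[i]) : Prop := {
  crm_re : is_real_measure (fun A => reC (nu A));
  crm_im : is_real_measure (fun A => imC (nu A));
  crm_regular : forall A : set G, borel_set A ->
    measure_variation nu A =
    ereal_sup [set measure_variation nu K
                | K in [set K : set G | compact K /\ K `<=` A]]
}.

(* The positive variation (Jordan decomposition) of a real set function. The
   supremum is over relatively compact sets because a member of M(G)_loc is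
   only a measure inside each compact set. *)
Definition positive_variation (R : realType) (G : topGroupType)
    (nu : set G -> R) (A : set G) : \bar R :=
  ereal_sup [set (nu B)%:E | B in
    [set B : set G | [/\ borel_set B, precompact B & B `<=` A]]].

Definition integral_real_measure (R : realType) (G : topGroupType)
    (nu : set G -> R) (A : set G) (g : G -> R) : R :=
  let pos : set (borel G) -> \bar R := positive_variation nu in
  let neg : set (borel G) -> \bar R :=
    positive_variation (fun B => - nu B) in
  fine (\int[pos]_(x in A) (g x)%:E)%E - fine (\int[neg]_(x in A) (g x)%:E)%E.

Definition density_measure (R : realType) (G : topGroupType)
    (g : G -> R) (nu : set G -> R[i]) : set G -> R[i] :=
  fun A => integral_real_measure (fun B => reC (nu B)) A g
        +i* integral_real_measure (fun B => imC (nu B)) A g.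

Inductive local_component := Linfty | L1 | Meas.

(* Members of B_loc are functions on G for B = L^oo, L^1. For B = M(G) they are
   set functions whose restriction to every compact set is a complex Radon
   measure; only their values on relatively compact Borel sets matter. *)
Definition B_arg (G : topGroupType) (B : local_component) : Type :=
  if B is Meas then set G else G.

Definition B_norm (R : realType) (G : topGroupType)
    (mu : {measure set (borel G) -> \bar R}) (B : local_component) :
    (B_arg G B -> R[i]) -> \bar R :=
  match B return (B_arg G B -> R[i]) -> \bar R with
  | Linfty => fun F => Lnorm mu +oo%E (fun x : borel G => (absC (F x))%:E)
  | L1 => fun F => Lnorm mu 1%:E (fun x : borel G => (absC (F x))%:E)
  | Meas => fun F => measure_variation F setT
  end.

Definition B_mem (R : realType) (G : topGroupType)
    (mu : {measure set (borel G) -> \bar R}) (B : local_component) :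
    (B_arg G B -> R[i]) -> Prop :=
  match B return (B_arg G B -> R[i]) -> Prop with
  | Meas => fun F => complex_radon_measure F
  | B' => fun F => measurable_cfun (F : B_arg G B' -> R[i])
                   /\ (B_norm mu F < +oo)%E
  end.

Definition B_restrict (R : realType) (G : topGroupType) (B : local_component)
    (S : set G) : (B_arg G B -> R[i]) -> B_arg G B -> R[i] :=
  match B return (B_arg G B -> R[i]) -> B_arg G B -> R[i] with
  | Meas => fun F A => F (A `&` S)
  | _ => fun F x => \1_S x * F x
  end.

Definition B_mul (R : realType) (G : topGroupType) (B : local_component)
    (g : G -> R) : (B_arg G B -> R[i]) -> B_arg G B -> R[i] :=
  match B return (B_arg G B -> R[i]) -> B_arg G B -> R[i] with
  | Meas => fun F => density_measure g F
  | _ => fun F x => (g x)%:C * F x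
  end.

Definition B_loc (R : realType) (G : topGroupType)
    (mu : {measure set (borel G) -> \bar R}) (B : local_component)
    (F : B_arg G B -> R[i]) : Prop :=
  forall K : set G, compact K -> B_mem mu (B_restrict K F).

Definition B_loc_null (R : realType) (G : topGroupType)
    (mu : {measure set (borel G) -> \bar R}) (B : local_component) :
    (B_arg G B -> R[i]) -> Prop :=
  match B return (B_arg G B -> R[i]) -> Prop with
  | Meas => fun F => forall A : set G, borel_set A -> precompact A -> F A = 0
  | _ => fun F => forall K : set G, compact K ->
           {ae mu, forall x : borel G, K x -> F x = 0}
  end.

(* The control function K(F, Q, B), as a complex function; note that
   L_x chi_Q = chi_(xQ). The norm is finite for F in B_loc and Q relatively
   compact. *)
Definition control (R : realType) (G : topGroupType)
    (mu : {measure set (borel G) -> \bar R}) (B : local_component)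
    (Q : set G) (F : B_arg G B -> R[i]) : G -> R[i] :=
  fun x => (fine (B_norm mu (B_restrict (ltrans x Q) F)))%:C.

Definition amalgam (R : realType) (G : topGroupType)
    (mu : {measure set (borel G) -> \bar R}) (B : local_component)
    (Y : qspace R G) (Q : set G) : qspace R (B_arg G B) :=
  QSpace (fun F => B_loc mu F /\ qdom Y (control mu Q F))
         (fun F => qnorm Y (control mu Q F)).

(* The choiceType structure on I is no restriction; it serves [\esum] below.
   Such a family is automatically discrete: every compact set contains x_i for
   finitely many i only. *)
Definition relatively_separated (G : topGroupType) (I : choiceType)
    (X : I -> G) : Prop :=
  forall K : set G, compact K -> exists C : nat, forall j : I,
    ([set i | ltrans (X i) K `&` ltrans (X j) K !=set0] #<= `I_C)%card.

Definition dense_family (G : topGroupType) (I : choiceType) (X : I -> G)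
    (V : set G) : Prop :=
  \bigcup_i ltrans (X i) V = [set: G].

Definition well_spread (G : topGroupType) (I : choiceType) (X : I -> G) :
    Prop :=
  relatively_separated X /\ exists2 V, unit_nbhd V & dense_family X V.

(* The function sum_i |lambda_i| chi_(x_i Q); for X relatively separated and Q
   relatively compact each of these sums has finitely many nonzero terms. *)
Definition synthesis (R : realType) (G : topGroupType) (I : choiceType)
    (X : I -> G) (Q : set G) (lambda : I -> R[i]) : G -> R[i] :=
  fun x => (fine (\esum_(i in [set: I])
    (absC (lambda i) * \1_(ltrans (X i) Q) x)%:E)%E)%:C.

Definition seq_space (R : realType) (G : topGroupType) (Y : qspace R G)
    (I : choiceType) (X : I -> G) (Q : set G) : qspace R I :=
  QSpace (fun lambda => qdom Y (synthesis X Q lambda))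
         (fun lambda => qnorm Y (synthesis X Q lambda)).

Definition vanishes_at_infinity (R : realType) (G : topGroupType)
    (f : G -> R) : Prop :=
  forall e : R, 0 < e -> exists2 K : set G, compact K &
    forall x, ~ K x -> `|f x| < e.

Record bupu (R : realType) (G : topGroupType) (I : choiceType) (X : I -> G)
    (U : set G) (psi : I -> G -> R) : Prop := {
  bupu_continuous : forall i, continuous (psi i);
  bupu_vanishes : forall i, vanishes_at_infinity (psi i);
  bupu_range : forall i x, 0 <= psi i x <= 1;
  bupu_sum : forall x, (\esum_(i in [set: I]) (psi i x)%:E = 1)%E;
  bupu_support : forall i,
    closure [set x | psi i x != 0] `<=` ltrans (X i) U
}.

Definition discrete_amalgam (R : realType) (G : topGroupType)
    (mu : {measure set (borel G) -> \bar R}) (B : local_component)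
    (Y : qspace R G) (I : choiceType) (X : I -> G) (Q : set G)
    (psi : I -> G -> R) : qspace R (B_arg G B) :=
  let coeff F i := (fine (B_norm mu (B_mul (psi i) F)))%:C in
  QSpace (fun F => B_loc mu F /\ qdom (seq_space Y X Q) (coeff F))
         (fun F => qnorm (seq_space Y X Q) (coeff F)).

Definition amalgam_independent (R : realType) (G : topGroupType)
    (mu : {measure set (borel G) -> \bar R}) (B : local_component)
    (Y : qspace R G) : Prop :=
  forall Q Q' : set G, unit_nbhd Q -> unit_nbhd Q' ->
    equiv_spaces (amalgam mu B Y Q) (amalgam mu B Y Q').

Definition seq_space_independent (R : realType) (G : topGroupType)
    (Y : qspace R G) : Prop :=
  forall (I : choiceType) (X : I -> G), relatively_separated X ->
  forall Q Q' : set G, unit_nbhd Q -> unit_nbhd Q' ->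
    equiv_spaces (seq_space Y X Q) (seq_space Y X Q').

Definition right_invariant (R : realType) (G : topGroupType)
    (S : qspace R G) : Prop :=
  forall x : G, exists C : R, forall F, qdom S F ->
    qdom S (right_translate x F) /\
    qnorm S (right_translate x F) <= C * qnorm S F.

Definition amalgam_right_invariant (R : realType) (G : topGroupType)
    (mu : {measure set (borel G) -> \bar R}) (Y : qspace R G) : Prop :=
  forall Q : set G, unit_nbhd Q ->
    right_invariant (amalgam mu Linfty Y Q).

(* Main.v *)
Require Import Defs.
From HB Require Import structures.
From mathcomp Require Import all_boot all_order all_algebra finmap.
From mathcomp Require Import all_classical all_reals all_analysis.
From mathcomp Require Import measurable_realfun ess_sup_inf complex ring lra.

Set Implicit Arguments.
Unset Strict Implicit.
Unset Printing Implicit Defensive.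

Import Order.TTheory GRing.Theory Num.Theory.
Import numFieldNormedType.Exports.

Local Open Scope classical_set_scope.
Local Open Scope ring_scope.
Local Open Scope complex_scope.

(* For F in B_loc put m(A) = ||chi_A F|B||, a monotone and finitely subadditive
   function of relatively compact Borel sets with x |-> m(xQ) measurable.  Only
   these properties of B enter the amalgam norm ||m(xQ)|Y||.

   If the spaces Y_d do not depend on the neighbourhood, choose a well-spread
   family (x_i) and a small V: the function sum_i m(x_i V) chi_(x_i V) is
   bounded by a multiple of m(xQ), while m(xQ') is bounded by the same sum with
   V enlarged.  Solidity of Y gives W(B,Y,Q) = W(B,Y,Q').  The BUPU norm is
   treated in the same way, with m(x_i V) replaced by ||F psi_i|B||.
   Conversely, Y_d is recovered from W(L^oo,Y) through the step functions
   sum_i |lambda_i| chi_(x_i V).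

   Right translation moves the window: m for R_z F at xQ is m for F at xQz.
   Hence independence of Q gives right invariance, and covering Q' by finitely
   many Qz gives the converse. *)

(** * Topological groups *)

Section topological_group.
Context {G : topGroupType}.
Implicit Types (A B K U V : set G) (x y z : G).

(** Solidity compares measurable functions only, so each function of [x] in the argument must be
    shown measurable. [G] may fail to be second countable or sigma-compact and index sets may be
    uncountable, so Fubini on [G * G] and termwise summation are not at hand. Measurability comes
    from lower semicontinuity instead: a compact subset of an open set stays inside under small
    translations. For [L^1] and [M] the norm of a restriction is a finite measure inside each
    compact set, and regularity starts a Dynkin argument. For [L^oo] it is no measure; there
    [t < m (x Q)] says that [x Q] meets a superlevel set in positive measure, an open condition on
    [x]. Right invariance moves functions to the right while [mu] is left invariant. An essential
    supremum depends on null sets only, so it suffices that right translates of relatively compact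
    null sets are null; this rests on a discrete substitute for Fubini. Members of [M_loc] are
    measures inside compact sets only, and positive variations are not additive in the measure, so
    linearity of densities in [F] has to be proved through other decompositions. *)

Definition invset A : set G := [set y | A (y^-1)%g].
Definition rtrans z A : set G := [set y | A (y * z^-1)%g].
Definition mulset A B : set G := [set (a * b)%g | a in A & b in B].

Lemma ltransP x A y : ltrans x A y <-> A (x^-1 * y)%g.
Proof.
split=> [[z Az <-]|Axy]; first by rewrite mulKg.
by exists (x^-1 * y)%g; rewrite // mulVKg.
Qed.

Lemma ltrans_preimage x A : ltrans x A = (fun y => x^-1 * y)%g @^-1` A.
Proof. by apply/seteqP; split=> y /ltransP. Qed.

Lemma ltransS x A B : A `<=` B -> ltrans x A `<=` ltrans x B.
Proof. by move=> AB y /ltransP /AB ?; apply/ltransP. Qed.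

Lemma mulg_continuous_at x y (W : set G) : nbhs (x * y)%g W ->
  exists A B, [/\ nbhs x A, nbhs y B & forall a b, A a -> B b -> W (a * b)%g].
Proof.
move=> /(@mulg_continuous_subproof G (x, y))[[A B] /= [nA nB] AB].
by exists A, B; split => // a b Aa Bb; exact: (AB (a, b)).
Qed.

Lemma continuous_mulgl x : continuous (fun y : G => (x * y)%g).
Proof.
move=> y W /mulg_continuous_at[A [B [nA nB AB]]].
by apply: filterS nB => b; apply: AB; exact: nbhs_singleton.
Qed.

Lemma continuous_mulgr z : continuous (fun y : G => (y * z)%g).
Proof.
move=> y W /mulg_continuous_at[A [B [nA nB AB]]].
by apply: filterS nA => a Aa; apply: AB => //; exact: nbhs_singleton.
Qed.

Lemma continuous_invg : continuous (fun y : G => (y^-1)%g).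
Proof. exact: invg_continuous_subproof. Qed.

Lemma open_preimage (f : G -> G) U : continuous f -> open U -> open (f @^-1` U).
Proof. by move=> /continuousP; exact. Qed.

Lemma borel_preimage (f : G -> G) A : continuous f -> borel_set A ->
  borel_set (f @^-1` A).
Proof.
move=> cf mA; have mf : measurable_fun [set: borel G] (f : borel G -> borel G).
  apply: (@measurability _ _ (borel G) (borel G) setT f (@open G)) => //.
  move=> _ [U oU <-]; rewrite setTI; apply: sub_sigma_algebra.
  exact: open_preimage.
by rewrite -[_ @^-1` _]setTI; apply: mf.
Qed.

Lemma borel_open U : open U -> borel_set U.
Proof. by move=> oU; exact: sub_sigma_algebra. Qed.

Lemma borel_closed U : closed U -> borel_set U.
Proof.
move=> cU; rewrite -[U]setCK; apply: (@measurableC _ (borel G)).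
by apply: borel_open; rewrite openC.
Qed.

Lemma open_ltrans x U : open U -> open (ltrans x U).
Proof. by rewrite ltrans_preimage; apply: open_preimage; exact: continuous_mulgl. Qed.

Lemma borel_ltrans x A : borel_set A -> borel_set (ltrans x A).
Proof. by rewrite ltrans_preimage; apply: borel_preimage; exact: continuous_mulgl. Qed.

Lemma compact_image (f : G -> G) K : continuous f -> compact K -> compact (f @` K).
Proof. by move=> cf; apply: continuous_compact; exact: continuous_subspaceT. Qed.

Lemma compact_ltrans x K : compact K -> compact (ltrans x K).
Proof. by apply: compact_image; exact: continuous_mulgl. Qed.

Lemma invset_image A : invset A = (fun y => y^-1)%g @` A.
Proof.
apply/seteqP; split=> [y Ay|y [z Az <-]]; last by rewrite /invset/= invgK.
by exists (y^-1)%g => //; rewrite invgK.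
Qed.

Lemma compact_invset K : compact K -> compact (invset K).
Proof. by rewrite invset_image; apply: compact_image; exact: continuous_invg. Qed.

Lemma open_invset U : open U -> open (invset U).
Proof. by apply: open_preimage; exact: continuous_invg. Qed.

Lemma borel_invset A : borel_set A -> borel_set (invset A).
Proof. by apply: borel_preimage; exact: continuous_invg. Qed.

Lemma invsetK A : invset (invset A) = A.
Proof. by apply/seteqP; split=> y; rewrite /invset/= invgK. Qed.

Lemma rtrans_image z A : rtrans z A = (fun y => y * z)%g @` A.
Proof.
apply/seteqP; split=> [y Ay|y [w Aw <-]]; last by rewrite /rtrans/= mulgK.
by exists (y * z^-1)%g => //; rewrite mulgVK.
Qed.

Lemma compact_rtrans z K : compact K -> compact (rtrans z K).
Proof. by rewrite rtrans_image; apply: compact_image; exact: continuous_mulgr. Qed.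

Lemma open_rtrans z U : open U -> open (rtrans z U).
Proof. by apply: open_preimage; exact: continuous_mulgr. Qed.

Lemma borel_rtrans z A : borel_set A -> borel_set (rtrans z A).
Proof. by apply: borel_preimage; exact: continuous_mulgr. Qed.

Lemma compact_mulset A B : compact A -> compact B -> compact (mulset A B).
Proof.
move=> cA cB; rewrite (_ : mulset A B = (fun xy => xy.1 * xy.2)%g @` (A `*` B)).
  apply: (@continuous_compact (G * G)%type).
    by apply: continuous_subspaceT => x; exact: mulg_continuous_subproof.
  exact: compact_setX.
apply/seteqP; split=> [y [a Aa [b Bb <-]]|y [[a b] [Aa Bb] <-]].
  by exists (a, b).
by exists a => //; exists b.
Qed.

Lemma open_mulset A U : open U -> open (mulset A U).
Proof.
move=> oU; rewrite (_ : mulset A U = \bigcup_(a in A) ltrans a U).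
  by apply: bigcup_open => a _; exact: open_ltrans.
apply/seteqP; split=> [y [a Aa [b Bb <-]]|y [a Aa] [b Ub <-]].
  by exists a => //; exists b.
by exists a => //; exists b.
Qed.

(** Tube lemma for multiplication: each point of [K] has its own neighbourhood of the identity, and
    the near-covering form of compactness yields one that serves all of [K]. *)
Lemma open_mulset_subl K U : compact K -> open U -> K `<=` U ->
  exists V, [/\ open V, V 1%g & mulset V K `<=` U].
Proof.
move=> cK oU KU.
have cvK := (compact_near_coveringP K).1 cK.
have nV : nbhs (1%g : G) [set v | K `<=` (fun k => U (v * k)%g)].
  apply: cvK.
  move=> k Kk; have /mulg_continuous_at[A [B [nA nB AB]]] : nbhs (1 * k)%g U.
    by rewrite mul1g; apply: open_nbhs_nbhs; split => //; exact: KU.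
  by exists (B, A) => //= -[b a] /= [Bb Aa]; exact: AB.
have := nV; rewrite nbhsE => -[V' [oV' V'1] V'V].
by exists V'; split => // _ [v V'v [k Kk <-]]; exact: (V'V _ V'v).
Qed.

Lemma open_mulset_subr K U : compact K -> open U -> K `<=` U ->
  exists V, [/\ open V, V 1%g & mulset K V `<=` U].
Proof.
move=> cK oU KU.
have [|||V [oV V1 VK]] := @open_mulset_subl (invset K) (invset U).
- exact: compact_invset.
- exact: open_invset.
- by move=> y /KU.
exists (invset V); split.
- exact: open_invset.
- by rewrite /invset/= invg1.
move=> _ [k Kk [v Vv <-]].
suff : invset U (k * v)^-1%g by rewrite /invset/= invgK.
by apply: VK; rewrite invgM; exists (v^-1)%g => //; exists (k^-1)%g => //;
  rewrite /invset/= invgK.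
Qed.

Lemma split_nbhs_unit W : nbhs (1%g : G) W -> exists V,
  [/\ open V, V 1%g, invset V = V & mulset V V `<=` W].
Proof.
rewrite -[in nbhs _ W](mulg1 (1%g : G)) => /mulg_continuous_at[A [B []]].
rewrite !nbhsE => -[A' [oA' A'1] A'A] [B' [oB' B'1] B'B] AB.
pose V := (A' `&` B') `&` invset (A' `&` B').
exists V; split.
- by apply: openI; [|apply: open_invset]; exact: openI.
- by rewrite /V/invset/= invg1.
- by rewrite /V; apply/seteqP; split=> y; rewrite /invset/= ?invgK;
    move=> [[? ?] [? ?]]; do !split.
move=> _ [a [[A'a _] _] [b [[_ B'b] _] <-]].
by apply: AB; [exact: A'A | exact: B'B].
Qed.

Hypothesis hausG : hausdorff_space G.

Lemma borel_compact K : compact K -> borel_set K.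
Proof. by move=> cK; apply: borel_closed; exact: compact_closed. Qed.

Lemma precompactP A : precompact A <-> exists2 K, compact K & A `<=` K.
Proof.
split=> [[K AK [cK _]]|[K cK AK]]; first by exists K.
by exists K => //; split => //; exact: compact_closed.
Qed.

Lemma precompact_ltrans x A : precompact A -> precompact (ltrans x A).
Proof.
move=> /precompactP[K cK AK]; apply/precompactP; exists (ltrans x K).
  exact: compact_ltrans.
exact: ltransS.
Qed.

Lemma precompactU A B : precompact A -> precompact B -> precompact (A `|` B).
Proof.
move=> /precompactP[K cK AK] /precompactP[L cL BL]; apply/precompactP.
exists (K `|` L); first exact: compactU.
by move=> x [/AK|/BL]; [left|right].
Qed.

(** Source of the enlarged windows: [A] is the set to be absorbed and [Q] makes [C] a neighbourhood
    of the identity. *)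
Lemma precompact_unit_nbhd A (Q : set G) : unit_nbhd Q -> precompact A ->
  exists C, [/\ unit_nbhd C, compact C, A `<=` C & Q `<=` C].
Proof.
move=> [nQ pQ _] pA; have /precompactP[K cK AK] := precompactU pA pQ.
exists K; split => //.
- split => //; last exact: borel_compact.
    by apply: filterS nQ => y Qy; apply: AK; right.
  by apply/precompactP; exists K.
- by move=> y Ay; apply: AK; left.
- by move=> y Ay; apply: AK; right.
Qed.

Hypothesis lcG : locally_compact [set: G].

Lemma small_unit_nbhd W : nbhs (1%g : G) W -> exists V,
  [/\ unit_nbhd V, open V, invset V = V & mulset V V `<=` W].
Proof.
move=> nW; have [U wU [cU clU]] := lcG (I : [set: G] 1%g).
have nU : nbhs (1%g : G) U by move: wU; rewrite withinET.
have [V [oV V1 iV VV]] := split_nbhs_unit (filterI nW nU).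
exists V; split => //; last by move=> y /VV[].
split; first exact: open_nbhs_nbhs.
  apply/precompactP; exists U => // v Vv.
  by have [] // : (W `&` U) v; apply: VV; exists v => //; exists 1%g => //; rewrite mulg1.
exact: borel_open.
Qed.

Lemma unit_nbhd_exists : exists V, [/\ unit_nbhd V, open V & invset V = V].
Proof. by have [V [? ? ? _]] := small_unit_nbhd (@filterT _ (nbhs (1%g : G)) _); exists V. Qed.

(** Dynkin arguments begin with open sets, so a relatively compact window is first placed in an open
    one. *)
Lemma open_precompact_superset A : precompact A -> exists W,
  [/\ open W, precompact W & A `<=` W].
Proof.
move=> /precompactP[K cK AK].
have [V [[nV /precompactP[L cL VL] mV] oV iV]] := unit_nbhd_exists.
exists (mulset A V); split; first exact: open_mulset.
  apply/precompactP; exists (mulset K L); first exact: compact_mulset.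
  by move=> _ [q /AK Kq [v /VL Lv <-]]; exists q => //; exists v.
by move=> q Qq; exists q => //; exists 1%g; [exact: nbhs_singleton|exact: mulg1].
Qed.

End topological_group.

Section compact_covers.
Context {G : topGroupType}.

Lemma compact_cover_ltrans (K V : set G) : compact K -> open V -> V 1%g ->
  exists s : seq G, (forall x, x \in s -> K x) /\
    forall y, K y -> exists2 x, x \in s & ltrans x V y.
Proof.
rewrite compact_cover => cK oV V1.
have [|y Ky|D DK KD] := cK _ K (fun x => ltrans x V).
- by move=> x _; exact: open_ltrans.
- by exists y => //; apply/ltransP; rewrite mulVg.
exists (enum_fset D); split=> [x xD|y /KD[x /= xD xVy]]; last by exists x.
  exact: set_mem (DK x xD).
Qed.

Lemma compact_cover_rtrans (K V : set G) : compact K -> open V -> V 1%g ->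
  exists s : seq G, forall y, K y -> exists2 x, x \in s & rtrans x V y.
Proof.
move=> cK oV V1.
have [|||s [_ sP]] := @compact_cover_ltrans (invset K) (invset V).
- exact: compact_invset.
- exact: open_invset.
- by rewrite /invset/= invg1.
exists (map (@monoid.inv G) s) => y Ky.
have [|x xs /ltransP] := sP y^-1%g; first by rewrite /invset/= invgK.
rewrite /invset/= invgM !invgK => Vyx.
by exists x^-1%g; [exact: map_f|rewrite /rtrans/= invgK].
Qed.

End compact_covers.

(** * Haar measure *)

Section haar_measure.
Context {R : realType} {G : topGroupType} (mu : {measure set (borel G) -> \bar R}).
Hypotheses (hausG : hausdorff_space G) (lcG : locally_compact [set: G]).
Hypothesis haar : left_haar_measure mu.
Implicit Types (A B E K Q U : set G).
Local Open Scope ereal_scope.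

Lemma le_borel_measure (m : {measure set (borel G) -> \bar R}) A B :
  borel_set A -> borel_set B -> A `<=` B -> m A <= m B.
Proof. by move=> mA mB AB; apply: le_measure => //; rewrite inE. Qed.

Lemma haar_precompact A : borel_set A -> precompact A -> mu A < +oo.
Proof.
move=> mA /(precompactP hausG)[K cK AK].
apply: le_lt_trans (haar_compact haar cK); apply: le_borel_measure => //.
exact: borel_compact.
Qed.

Lemma haar_ball_cover K U : compact K -> open U -> U 1%g -> mu U = 0 -> mu K = 0.
Proof.
move=> cK oU U1 U0; have [s [_ sP]] := compact_cover_ltrans cK oU U1.
have mF n : borel_set (ltrans (nth 1%g s n) U).
  by apply: borel_ltrans; exact: borel_open.
apply/eqP; rewrite -measure_le0.
have mK : borel_set K by exact: borel_compact.
apply: (@le_trans _ _ (\sum_(i < size s) mu (ltrans (nth 1%g s i) U))).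
  have mb : borel_set (\big[setU/set0]_(i < size s) ltrans (nth 1%g s i) U).
    by apply: (@bigsetU_measurable _ (borel G)) => i _; exact: mF.
  apply: le_trans (@le_mu_bigsetU _ _ _ mu (fun n => ltrans (nth 1%g s n) U) _
    (fun i _ => mF i)).
  apply: le_borel_measure => // y /sP[x xs xy].
  rewrite -(bigcup_mkord _ (fun n => ltrans (nth 1%g s n) U)).
  by exists (index x s); rewrite /= ?index_mem// nth_index.
rewrite big1// => i _; rewrite (haar_invariant haar)//; exact: borel_open.
Qed.

(** If [U] were null, every compact set, being covered by finitely many translates of [U], would be
    null, and inner regularity on the open set [G] would give [mu G = 0]. *)
Lemma haar_open_gt0 U : open U -> U !=set0 -> 0 < mu U.
Proof.
move=> oU [x Ux]; rewrite measure_gt0; apply/eqP => U0.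
apply: (haar_neq0 haar); rewrite (haar_inner_regular haar); last exact: openT.
apply/eqP; rewrite eq_le; apply/andP; split.
  apply: ge_ereal_sup => _ [K [cK _] <-].
  rewrite (@haar_ball_cover K (ltrans x^-1%g U))//.
  - exact: open_ltrans.
  - by apply/ltransP; rewrite invgK mulg1.
  - by rewrite (haar_invariant haar)//; exact: borel_open.
by apply: ereal_sup_ubound; exists set0; [split => //; exact: compact0|rewrite measure0].
Qed.

Lemma haar_unit_nbhd_gt0 Q : unit_nbhd Q -> 0 < mu Q.
Proof.
move=> [nQ _ mQ]; have := nQ; rewrite nbhsE => -[U [oU U1] UQ].
apply: lt_le_trans (haar_open_gt0 oU _) _; first by exists 1%g.
by apply: le_borel_measure => //; exact: borel_open.
Qed.

(** Inner regularity is assumed on open sets only. Inside a compact [C] containing [A], outer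
    regularity of [C] minus [A] gives an open [W] with [mu W < mu C]; then [C] minus [W] is a
    compact part of [A] of positive measure. *)
Lemma haar_inner_compact A : borel_set A -> precompact A -> 0 < mu A ->
  exists K, [/\ compact K, K `<=` A & 0 < mu K].
Proof.
move=> mA pA A0; have [C cC AC] := (precompactP hausG A).1 pA.
have mC := borel_compact hausG cC.
have mCA : borel_set (C `\` A) by exact: (@measurableD _ (borel G)).
have Cfin := haar_compact haar cC.
have CE : mu C = mu A + mu (C `\` A).
  rewrite -measureU//; first by congr (mu _); rewrite setDUK.
  by apply/seteqP; split=> // y [Ay [_]].
have : mu (C `\` A) < mu C.
  rewrite CE lteDr//; apply/fin_numPlt; apply/andP; split.
    exact: lt_le_trans (ltNyr 0) _.
  by apply: le_lt_trans Cfin; exact: le_borel_measure.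
rewrite (haar_outer_regular haar mCA) => /ereal_inf_lt [_ [W [oW CAO] <-] OC].
have cK : compact (C `\` W).
  by rewrite setDE; apply: compact_closedI => //; rewrite closedC.
exists (C `\` W); split => //.
  by move=> y [Cy nOy]; apply: contrapT => nAy; apply: nOy; apply: CAO.
rewrite measure_gt0; apply: contraTneq OC => K0; rewrite -leNgt.
have mW := borel_open oW.
rewrite (_ : mu W = mu (C `\` W) + mu W); last by rewrite [X in X + _]K0 add0e.
apply: le_trans (measureU2 _ _ _) => //; last exact: (@measurableD _ (borel G)).
apply: le_borel_measure => //.
  by apply: (@measurableU _ (borel G)) => //; exact: (@measurableD _ (borel G)).
by move=> y Cy; have [Oy|nOy] := pselect (W y); [right|left].
Qed.

(** A Steinhaus argument. A compact [K] of positive measure inside [x0 Q] and [E] has an open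
    neighbourhood [W] with [mu W < 2 mu K]. For [v] close to the identity both [v K] and [K] lie in
    [W], so they cannot be almost disjoint; with [v = x x0^-1] their intersection lies in [x Q] and
    in [E]. *)
Lemma haar_gt0_open_ltrans Q E x0 : borel_set Q -> borel_set E -> precompact E ->
  0 < mu (ltrans x0 Q `&` E) -> nbhs x0 [set x | 0 < mu (ltrans x Q `&` E)].
Proof.
move=> mQ mE pE QE0.
have mI x : borel_set (ltrans x Q `&` E).
  by apply: (@measurableI _ (borel G)) => //; exact: borel_ltrans.
have [|K [cK KQE K0]] := haar_inner_compact (mI x0) _ QE0.
  by apply: precompact_subset pE => y [].
have mK := borel_compact hausG cK.
have Kfin := haar_compact haar cK.
have [W [oW KW OK]] : exists W, [/\ open W, K `<=` W & mu W < mu K + mu K].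
  have : mu K < mu K + mu K.
    by rewrite lteDl// ge0_fin_numE.
  rewrite {1}(haar_outer_regular haar mK) => /ereal_inf_lt [_ [W [oW KW] <-] OC].
  by exists W.
have [V [oV V1 VKW]] := open_mulset_subl cK oW KW.
have : nbhs x0 (rtrans x0 V).
  apply: open_nbhs_nbhs; split; first exact: open_rtrans.
  by rewrite /rtrans/= mulgV.
apply: filterS => x; rewrite /rtrans/= => Vx.
set v := (x * x0^-1)%g in Vx.
have mvK := borel_ltrans v mK.
apply: (@lt_le_trans _ _ (mu (ltrans v K `&` K))).
  rewrite measure_gt0; apply: contraTneq OK => K00; rewrite -leNgt.
  have mKD : borel_set (K `\` ltrans v K) by exact: (@measurableD _ (borel G)).
  rewrite (_ : mu K + mu K = mu (K `\` ltrans v K) + mu (ltrans v K)).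
    rewrite -measureU//; last by apply/seteqP; split=> // y [[_ ?]].
    apply: le_borel_measure; [exact: (@measurableU _ (borel G))|exact: borel_open|].
    move=> y [[/KW//]|[k Kk <-]]; apply: VKW.
    by exists v => //; exists k.
  rewrite [X in _ = _ + X](haar_invariant haar)//; congr (_ + _).
  rewrite -[in LHS](setDUK (_ : K `&` ltrans v K `<=` K)); last by move=> y [].
  rewrite measureU//; last by apply/seteqP; split=> // y [[? ?] [_]]; apply.
  + by rewrite setIC [X in X + _]K00 add0e; congr (mu _); apply/seteqP;
       split=> y [Ky]; rewrite /setI/= => nvy; split => //; tauto.
  + by apply: (@measurableI _ (borel G)).
  + by apply: (@measurableD _ (borel G)) => //; apply: (@measurableI _ (borel G)).
apply: le_borel_measure => //; first exact: (@measurableI _ (borel G)).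
move=> y [/ltransP vy Ky]; split; last by have [] := KQE _ Ky.
have [/ltransP + _] := KQE _ vy => Qy; apply/ltransP.
by move: Qy; rewrite /v invgM invgK !mulgA mulVg mul1g.
Qed.

End haar_measure.

(** * Null sets under inversion and right translation *)

Section haar_null_sets.
Context {R : realType} {G : topGroupType} (mu : {measure set (borel G) -> \bar R}).
Hypotheses (hausG : hausdorff_space G) (lcG : locally_compact [set: G]).
Hypothesis haar : left_haar_measure mu.
Implicit Types (A B E K Q U W : set G).
Local Open Scope ereal_scope.

(* Fubini for the function chi_W(y^-1 x) on A x B, in which integration over B
   is replaced by a finite sum over small pieces of B. It serves to bound the
   measure of the inverse of a null set. *)
Lemma haar_invset_bound A B E W : compact A -> compact B -> compact E ->
    mulset B (invset E) `<=` A -> open W -> E `<=` W ->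
  mu B * mu (invset E) <= mu A * mu W.
Proof.
move=> cA cB cE BEA oW EW.
have [V1 [oV1 V11 EV1]] := open_mulset_subr cE oW EW.
have [V [oV V_1 iV VV]] := split_nbhs_unit (open_nbhs_nbhs (conj oV1 V11)).
have [s [sB sP]] := compact_cover_ltrans cB oV V_1.
pose xs n := nth 1%g s n.
pose D := seqDU (fun n => B `&` ltrans (xs n) V).
have mB := borel_compact hausG cB; have mA := borel_compact hausG cA.
have mD n : borel_set (D n).
  apply: (@seqDU_measurable _ (borel G)) => k.
  apply: (@measurableI _ (borel G)) => //.
  by apply: borel_ltrans; exact: borel_open.
have tD : trivIset setT D by exact: trivIset_seqDU.
have BD : B = \big[setU/set0]_(k < size s) D k.
  rewrite -bigsetU_seqDU -(bigcup_mkord _ (fun n => B `&` ltrans (xs n) V)).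
  apply/seteqP; split=> [y By|y [k _ []]//].
  have [x xins xy] := sP _ By.
  by exists (index x s); rewrite /= ?index_mem// /xs nth_index.
pose S := mulset E V.
have oS : open S by exact: open_mulset.
pose T n := ltrans (xs n) (invset S).
have mT n : borel_set (T n).
  by apply: borel_ltrans; apply: borel_invset; exact: borel_open.
have sumD (P : pred 'I_(size s)) : \sum_(k < size s | P k) mu (D k) =
    mu (\big[setU/set0]_(k < size s | P k) D k).
  apply/esym/(@measure_bigsetU_ord _ _ (borel G) mu _ P (fun k => D k)) => [i|].
    exact: mD.
  by move=> i j _ _ ij; apply: val_inj; exact: tD.
have mDU (P : pred 'I_(size s)) : borel_set (\big[setU/set0]_(k < size s | P k) D k).
  by apply: (@bigsetU_measurable _ (borel G)) => i _; exact: mD.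
(* [x_k E^-1] lies in [A] by [BEA] and in [T k] because [V] contains the identity, so left
   invariance bounds every slice from below by the same number. *)
have invE k : (k < size s)%N -> mu (invset E) <= mu (A `&` T k).
  move=> ks; rewrite -(haar_invariant haar (xs k)); last first.
    by apply: borel_invset; exact: borel_compact.
  apply: le_borel_measure.
  - by apply: borel_ltrans; apply: borel_invset; exact: borel_compact.
  - exact: (@measurableI _ (borel G) _ _ mA (mT k)).
  move=> _ [e Ee <-]; split.
    by apply: BEA; exists (xs k); [apply: sB; exact: mem_nth|exists e].
  exists e => //; exists (e^-1)%g => //; exists 1%g => //; exact: mulg1.
pose f (k : 'I_(size s)) (y : borel G) : \bar R := mu (D k) * (\1_(T k) y)%:E.
have mf k : measurable_fun (A : set (borel G)) (f k).
  apply: emeasurable_funM => //; apply/measurable_EFinP.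
  by apply: measurable_funTS; apply: measurable_indic; exact: mT.
apply: (@le_trans _ _ (\int[mu]_(y in A) \sum_(k < size s) f k y)).
  rewrite ge0_integral_sum//; last first.
    by move=> k y _; rewrite mule_ge0// lee_fin.
  rewrite [X in mu X * _]BD -sumD ge0_sume_distrl//; apply: lee_sum => k _.
  rewrite ge0_integralZl//; last first.
    apply/measurable_EFinP; apply: measurable_funTS.
    by apply: measurable_indic; exact: mT.
  by rewrite integral_indic; [rewrite setIC lee_wpmul2l//; exact: invE|exact: mA|exact: mT].
have mW := borel_open oW.
rewrite muleC -integral_cst//; apply: ge0_le_integral => //.
- by move=> y _; apply: sume_ge0 => k _; rewrite mule_ge0// lee_fin.
- exact: emeasurable_sum.
move=> y _ /=.
rewrite (_ : \sum_(k < _) _ = \sum_(k < size s | `[< T k y >]) mu (D k)); last first.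
  rewrite [RHS]big_mkcond; apply: eq_bigr => k _; rewrite /f indicE.
  rewrite (_ : (y \in T k) = `[< T k y >]); last first.
    by apply/idP/asboolP => [/set_mem|/mem_set].
  by case: asboolP => _; rewrite ?mule1 ?mule0.
(* For fixed [y] the pieces that are counted are disjoint and lie in [y W]: from [y] in
   [x_k (E V)^-1] follows [x_k] in [y E V], hence [x_k V] is inside [y E V V], and [V V] is inside
   [V1]. *)
rewrite sumD -(haar_invariant haar y mW).
apply: le_borel_measure => //; first exact: borel_ltrans.
elim/big_rec: _ => [//|k Z /asboolP/ltransP [e Ee [v Vv ev]] ZW].
move=> z DZ; case: DZ => [Dz|/ZW//].
have [_ [w Vw <-]] := subset_seqDU Dz.
apply/ltransP; apply: EV1; exists e => //; exists (v * w)%g.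
  by apply: VV; exists v => //; exists w.
by rewrite !mulgA ev invgM invgK.
Qed.

(** Otherwise [E^-1] contains a compact [K] of positive measure. The bound above, applied to [K^-1],
    gives [mu B * mu K <= mu A * mu W] for every open [W] containing [E], while outer regularity
    makes [mu W] as small as desired. *)
Lemma haar_null_invset E : borel_set E -> precompact E -> mu E = 0 ->
  mu (invset E) = 0.
Proof.
move=> mE pE E0; apply/eqP; rewrite -measure_le0 leNgt; apply/negP => iE0.
have miE := borel_invset mE.
have [|K [cK KE K0]] := haar_inner_compact hausG haar miE _ iE0.
  have [C cC EC] := (precompactP hausG E).1 pE.
  apply/(precompactP hausG); exists (invset C); first exact: compact_invset.
  by move=> y /EC.
have [V [nV _ _]] := unit_nbhd_exists hausG lcG.
have [B [nB cB _ _]] := precompact_unit_nbhd hausG nV (let: And3 _ p _ := nV in p).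
have B0 := haar_unit_nbhd_gt0 hausG haar nB.
pose A := mulset B K; have cA : compact A by exact: compact_mulset.
have Afin := haar_compact haar cA; have Bfin := haar_compact haar cB.
have Kfin := haar_compact haar cK.
have bound W : open W -> E `<=` W -> mu B * mu K <= mu A * mu W.
  move=> oW EW; rewrite -(invsetK K); apply: haar_invset_bound => //.
  - exact: compact_invset.
  - by rewrite invsetK.
  - by move=> y /KE; rewrite /invset/= invgK => /EW.
have BK0 : 0 < mu B * mu K by exact: mule_gt0.
have Afn : mu A \is a fin_num by rewrite ge0_fin_numE.
have BKfin : mu B * mu K \is a fin_num by rewrite fin_numM// ge0_fin_numE.
(* The [+ 1] keeps the denominator positive without any lower bound on [mu A]. *)
have eps0 : 0 < (fine (mu B * mu K) / (fine (mu A) + 1))%:E.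
  by rewrite lte_fin divr_gt0// ?fine_gt0 ?BK0 ?ltey_eq ?BKfin// ltr_wpDl// fine_ge0.
have : mu E < (fine (mu B * mu K) / (fine (mu A) + 1))%:E by rewrite E0.
rewrite (haar_outer_regular haar mE) => /ereal_inf_lt[_ [W [oW EW] <-] Weps].
have := bound _ oW EW; apply/negP; rewrite -ltNge.
have Wfin : mu W \is a fin_num by rewrite ge0_fin_numE// (lt_trans Weps)// ltry.
rewrite -(fineK Afn) -(fineK Wfin) -(fineK BKfin) -EFinM lte_fin.
rewrite -(fineK Wfin) lte_fin ltr_pdivlMr in Weps; last by rewrite ltr_wpDl// fine_ge0.
apply: le_lt_trans Weps; rewrite mulrC ler_wpM2l ?fine_ge0//.
by rewrite lerDl.
Qed.

(** [E z] is the inverse of the left translate [z^-1 E^-1], so left invariance and two inversions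
    are enough, and no modular function enters. *)
Lemma haar_null_rtrans z E : borel_set E -> precompact E -> mu E = 0 ->
  mu (rtrans z E) = 0.
Proof.
move=> mE pE E0.
have -> : rtrans z E = invset (ltrans z^-1%g (invset E)).
  apply/seteqP; split=> y; rewrite ?ltrans_preimage /rtrans/invset/=.
    by rewrite invgK invgM invgK.
  by rewrite invgK invgM invgK.
have miE := borel_invset mE.
have piE : precompact (invset E).
  have [C cC EC] := (precompactP hausG E).1 pE.
  apply/(precompactP hausG); exists (invset C); first exact: compact_invset.
  by move=> y /EC.
apply: haar_null_invset.
- exact: borel_ltrans.
- exact: precompact_ltrans.
- by rewrite (haar_invariant haar)//; exact: haar_null_invset.
Qed.

End haar_null_sets.

(** * Measurability of translates *)

Section translates_measurable.
Context {R : realType} {G : topGroupType}.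
Hypotheses (hausG : hausdorff_space G) (lcG : locally_compact [set: G]).
Implicit Types (A B E K Q U W : set G) (N : set G -> \bar R).
Local Open Scope ereal_scope.

Lemma measure_exists (f : set (borel G) -> \bar R) :
  f set0 = 0 -> (forall A, 0 <= f A) -> semi_sigma_additive f ->
  exists m : {measure set (borel G) -> \bar R}, forall A, m A = f A.
Proof.
move=> f0 fge0 fs.
pose m : {measure set (borel G) -> \bar R} :=
  HB.pack f (isMeasure.Build _ _ _ f f0 fge0 fs).
by exists m.
Qed.

Lemma lsc_measurable (f : borel G -> \bar R) :
  (forall t : R, open [set x : G | t%:E < f x]) -> measurable_fun setT f.
Proof.
move=> of_; apply: (measurability _ (ErealGenOInfty.measurableE R)) => //.
move=> _ [_ [t ->] <-]; rewrite setTI; apply: sub_sigma_algebra.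
rewrite (_ : _ @^-1` _ = [set x : G | t%:E < f x]); first exact: of_.
by apply/seteqP; split=> y /=; rewrite in_itv/= andbT.
Qed.

(** Open sets are stable under intersection and generate the Borel sets; finiteness of [m x setT]
    turns complements into differences. *)
Lemma borel_kernel_measurable (m : G -> {measure set (borel G) -> \bar R}) :
  (forall x, m x setT < +oo) ->
  (forall U, open U -> measurable_fun setT (fun x : borel G => m x U)) ->
  forall A, borel_set A -> measurable_fun setT (fun x : borel G => m x A).
Proof.
move=> mfin om A mA.
apply: (@dynkin_induction _ (borel G) (@open G)
  (fun A => measurable_fun setT (fun x : borel G => m x A))) mA => //.
- by move=> U V; exact: openI.
- by apply: om; exact: openT.
- move=> S mS mSf.
  rewrite (_ : (fun x => _) = (fun x : borel G => m x setT - m x S)).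
    by apply: emeasurable_funB => //; apply: om; exact: openT.
  apply/funext => x; rewrite -setTD measureD//; last exact: mfin.
  by rewrite setTI.
- move=> F mF tF mFf.
  rewrite (_ : (fun x => _) = (fun x : borel G => \sum_(0 <= k <oo) m x (F k))).
    by apply: ge0_emeasurable_sum.
  apply/funext => x; rewrite measure_semi_bigcup//.
  exact: bigcup_measurable.
Qed.

(** [N A] stands for the [L^1] norm or the variation norm of [F] restricted to [A]. For [F] in
    [B_loc] this is a finite measure inside each compact set, and possibly nothing of the kind
    globally. *)
Definition local_measure N := forall K, compact K ->
  exists2 m : {measure set (borel G) -> \bar R}, m setT < +oo &
    forall A, borel_set A -> m A = N (A `&` K).

Lemma local_measure_le N A B : local_measure N -> borel_set A -> borel_set B ->
  precompact B -> A `<=` B -> N A <= N B.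
Proof.
move=> locN mA mB /(precompactP hausG)[K cK BK] AB.
have [m _ mE] := locN _ cK.
have -> : N A = m A by rewrite mE// setIidl// => y /AB/BK.
have -> : N B = m B by rewrite mE// setIidl.
exact: le_borel_measure.
Qed.

Lemma local_measureU N A B : local_measure N -> borel_set A -> borel_set B ->
  precompact A -> precompact B -> N (A `|` B) <= N A + N B.
Proof.
move=> locN mA mB pA pB.
have [K cK ABK] := (precompactP hausG _).1 (precompactU hausG pA pB).
have [m _ mE] := locN _ cK.
have mN C : borel_set C -> C `<=` A `|` B -> N C = m C.
  by move=> mC CAB; rewrite mE// setIidl// => y /CAB/ABK.
have mAB : borel_set (A `|` B) by exact: (@measurableU _ (borel G)).
rewrite (mN _ mAB (@subset_refl _ _)) (mN _ mA (@subsetUl _ _ _)).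
by rewrite (mN _ mB (@subsetUr _ _ _)); exact: measureU2.
Qed.

Lemma local_measure_fin N A : local_measure N -> borel_set A -> precompact A ->
  N A \is a fin_num.
Proof.
move=> locN mA /(precompactP hausG)[K cK AK].
have [m mfin mE] := locN _ cK.
have -> : N A = m A by rewrite mE// setIidl.
rewrite ge0_fin_numE//; apply: le_lt_trans mfin; apply: le_borel_measure => //.
exact: (@measurableT _ (borel G)).
Qed.

Lemma local_measure_ge0 N A : local_measure N -> borel_set A -> precompact A ->
  0 <= N A.
Proof.
move=> locN mA /(precompactP hausG)[K cK AK].
have [m mfin mE] := locN _ cK.
by have -> : N A = m A by rewrite mE// setIidl.
Qed.

Lemma local_measure0 N : local_measure N -> N set0 = 0.
Proof.
move=> locN; have [m mfin mE] := locN _ (@compact0 G).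
by rewrite -(set0I set0) -mE ?measure0//; exact: (@measurable0 _ (borel G)).
Qed.

Definition locally_regular N := forall U (t : R), open U -> precompact U ->
  t%:E < N U -> exists K, [/\ compact K, K `<=` U & t%:E < N K].

(** Regularity puts a compact [K] with [t < N K] into [x U], and [K] remains inside [y U] for all
    [y] close to [x]. *)
Lemma local_measure_translate_lsc N U : local_measure N -> locally_regular N ->
  open U -> precompact U -> forall t : R, open [set x : G | t%:E < N (ltrans x U)].
Proof.
move=> locN regN oU pU t; rewrite openE => x /= tU.
have [K [cK KU tK]] := regN _ _ (open_ltrans x oU) (precompact_ltrans hausG x pU) tU.
have KxU : (fun k => x^-1 * k)%g @` K `<=` U by move=> _ [k /KU/ltransP ? <-].
have cxK : compact ((fun k => x^-1 * k)%g @` K).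
  by apply: compact_image => //; exact: continuous_mulgl.
have [V [oV V1 VKU]] := open_mulset_subl cxK oU KxU.
have nV : nbhs x [set y | V (y^-1 * x)%g].
  have c : continuous (fun y : G => y^-1 * x)%g.
    move=> y; apply: (@continuous_comp _ _ _ (fun y => y^-1)%g (fun y => y * x)%g).
      exact: continuous_invg.
    exact: continuous_mulgr.
  by apply: c; rewrite mulVg; apply: open_nbhs_nbhs.
apply: filterS nV => y /= Vy; apply: lt_le_trans tK _.
apply: local_measure_le => //.
- exact: borel_compact.
- by apply: borel_ltrans; exact: borel_open.
- exact: precompact_ltrans.
move=> k Kk; apply/ltransP; apply: VKU; exists (y^-1 * x)%g => //.
exists (x^-1 * k)%g; first by exists k.
by rewrite -mulgA mulVKg.
Qed.

(* For open Q the function is lower semicontinuous; a Dynkin-class argument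
   extends measurability to Borel sets. *)
Lemma local_measure_translate_measurable N Q : local_measure N ->
  locally_regular N -> borel_set Q -> precompact Q ->
  measurable_fun setT (fun x : borel G => N (ltrans x Q)).
Proof.
move=> locN regN mQ pQ.
have [W [oW pW QW]] := open_precompact_superset hausG lcG pQ.
have mW := borel_open oW.
(* For fixed [x], cutting by [W] keeps all translates inside one compact set, so [N] of the
   translate is a finite measure of the set that is moved. *)
have ex x : exists2 m : {measure set (borel G) -> \bar R}, m setT < +oo &
    forall A, borel_set A -> m A = N (ltrans x (A `&` W)).
  have [K cK WK] := (precompactP hausG _).1 (precompact_ltrans hausG x pW).
  have [m mfin mE] := locN _ cK.
  have mxA A : borel_set A -> borel_set (ltrans x (A `&` W)).
    by move=> mA; apply: borel_ltrans; exact: (@measurableI _ (borel G)).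
  have [||F mF tF _|m' m'E] := @measure_exists (fun A => m (ltrans x (A `&` W))).
  - by rewrite set0I /ltrans image_set0 measure0.
  - by move=> A; exact: measure_ge0.
  - rewrite (_ : ltrans x _ = \bigcup_n ltrans x (F n `&` W)); last first.
      by rewrite setI_bigcupl /ltrans image_bigcup.
    apply: (@measure_semi_sigma_additive _ _ _ m (fun n => ltrans x (F n `&` W))).
    + by move=> n; apply: mxA; exact: mF.
    + apply/trivIsetP => i j _ _ ij; rewrite !ltrans_preimage -preimage_setI setIACA.
      by move/trivIsetP : tF => /(_ _ _ I I ij) ->; rewrite set0I preimage_set0.
    + by apply: bigcup_measurable => n _; apply: mxA; exact: mF.
  exists m'.
    rewrite m'E; apply: le_lt_trans mfin; apply: le_borel_measure => //.
      by apply: mxA; exact: (@measurableT _ (borel G)).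
    exact: (@measurableT _ (borel G)).
  move=> A mA; rewrite m'E mE; last exact: mxA.
  by rewrite setIidl// => y /ltransP[_ Wy]; apply: WK; exact/ltransP.
pose m x := sval (cid2 (ex x)).
have mfin x : m x setT < +oo by rewrite /m; case: cid2.
have mE x A : borel_set A -> m x A = N (ltrans x (A `&` W)).
  by rewrite /m; case: cid2 => m' /= _; exact.
rewrite (_ : (fun x => _) = (fun x : borel G => m x Q)); last first.
  by apply/funext => x; rewrite mE// setIidl.
apply: (borel_kernel_measurable mfin) => // U oU.
rewrite (_ : (fun x => _) = (fun x : borel G => N (ltrans x (U `&` W)))); last first.
  by apply/funext => x; rewrite mE//; exact: borel_open.
apply: lsc_measurable; apply: local_measure_translate_lsc => //.
- exact: openI.
- by apply: precompact_subset pW; exact: subIsetr.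
Qed.

End translates_measurable.

Lemma card_le_seq (T : choiceType) (A : set T) (C : nat) : (A #<= `I_C)%card ->
  exists s : seq T, [/\ uniq s, (size s <= C)%N & forall i, i \in s <-> A i].
Proof.
move=> hA; have finA : finite_set A by apply: card_le_finite hA _; exact: finite_II.
exists (enum_fset (fset_set A)); split; first exact: fset_uniq.
  exact: geq_card_fset_set.
by move=> i; split => [|Ai]; [rewrite in_fset_set// inE|rewrite in_fset_set// inE].
Qed.

Lemma seq_card_le (T : choiceType) (A : set T) (C : nat) :
  (forall s : seq T, uniq s -> (forall i, i \in s -> A i) -> (size s <= C)%N) ->
  (A #<= `I_C)%card.
Proof.
move=> hA; have finA : finite_set A.
  apply: contrapT => /(@infinite_set_fset _ _ C.+1) [B BA].
  by rewrite ltnNge => /negP; apply; apply: hA; [exact: fset_uniq|move=> i /BA].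
have cA : (A #= `I_(#|` fset_set A|))%card.
  by rewrite -[X in (X #= _)%card]fset_setK//; exact/card_eq_fsetP.
rewrite (card_le_eql cA) card_le_II; apply: hA; first exact: fset_uniq.
by move=> i; rewrite in_fset_set// inE.
Qed.

Lemma esum_seq (R : realType) (T : choiceType) (f : T -> \bar R) (s : seq T) :
  (forall i, 0 <= f i)%E -> uniq s -> (forall i, i \notin s -> f i = 0%E) ->
  (\esum_(i in [set: T]) f i = \sum_(i <- s) f i)%E.
Proof.
move=> f0 us fs.
rewrite fsbig_seq// -esum_fset; [|by apply/finite_seqP; exists s|by move=> *; exact: f0].
rewrite [RHS]esum_mkcond; apply: eq_esum => i _.
by case: ifPn => //; rewrite notin_setE /= => /negP/fs.
Qed.

(** * Discrete families *)

Section relatively_separated_families.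
Context {R : realType} {G : topGroupType}.
Hypotheses (hausG : hausdorff_space G) (lcG : locally_compact [set: G]).
Implicit Types (A B E K Q U W : set G).

(** The separation constant counts the translates meeting one fixed [x_j K]. All translates through
    [x] meet each other at [x], so any one of them can serve as the fixed one, and the same [C]
    works at every point. *)
Lemma relatively_separated_seq (I : choiceType) (X : I -> G) A :
  relatively_separated X -> precompact A -> exists C : nat, forall x : G,
  exists s : seq I, [/\ uniq s, (size s <= C)%N &
    forall i, i \in s <-> ltrans (X i) A x].
Proof.
move=> sepX /(precompactP hausG)[K cK AK]; have [C XC] := sepX K cK.
exists C => x; apply: card_le_seq; have [[j Ajx]|nA] := pselect (exists j, ltrans (X j) A x).
  apply: card_le_trans (XC j); apply: subset_card_le => i Aix.
  by exists x; split; [apply: ltransS Aix|apply: ltransS Ajx].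
have -> : (fun i => ltrans (X i) A x) = set0.
  by apply/seteqP; split=> // i Aix; apply: nA; exists i.
exact: card_ge0.
Qed.

Definition translate_sum (I : choiceType) (X : I -> G) (a : I -> R) A (x : G) : \bar R :=
  (\esum_(i in [set: I]) (a i * \1_(ltrans (X i) A) x)%:E)%E.

Lemma translate_sum_seq (I : choiceType) (X : I -> G) (a : I -> R) A x (s : seq I) :
  (forall i, 0 <= a i) -> uniq s -> (forall i, i \in s <-> ltrans (X i) A x) ->
  translate_sum X a A x = (\sum_(i <- s) a i)%:E.
Proof.
move=> a0 us sP; rewrite /translate_sum (esum_seq _ us).
- rewrite -sumEFin [LHS]big_seq_cond [RHS]big_seq_cond; apply: eq_bigr => i.
  by rewrite andbT => /sP iA; rewrite indicE mem_set// mulr1.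
- by move=> i; rewrite lee_fin mulr_ge0.
- by move=> i; rewrite indicE => is_; rewrite memNset ?mulr0// => /sP; apply/negP.
Qed.

Lemma dirac_sum_measure (I : choiceType) (a : I -> R) (p : I -> borel G) (s : seq I) :
  (forall i, 0 <= a i) -> exists m : {measure set (borel G) -> \bar R},
    forall A, m A = (\sum_(i <- s) (a i)%:E * \d_(p i) A)%E.
Proof.
move=> a0; elim: s => [|i s [m mE]].
  by exists mzero => A; rewrite big_nil.
exists (measure_add (mscale (NngNum (a0 i)) \d_(p i)) m) => A.
by rewrite big_cons -mE; exact: measure_addE.
Qed.

Context (I : choiceType) (X : I -> G).
Hypothesis sepX : relatively_separated X.
Implicit Types (a : I -> R).

Lemma translate_sum_ge0 a A x : (forall i, 0 <= a i) -> (0 <= translate_sum X a A x)%E.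
Proof. by move=> a0; apply: esum_ge0 => i _; rewrite lee_fin mulr_ge0. Qed.

Lemma translate_sum_fin a A x : (forall i, 0 <= a i) -> precompact A ->
  translate_sum X a A x \is a fin_num.
Proof.
move=> a0 pA; have [C CP] := relatively_separated_seq sepX pA.
by have [s [us _ sP]] := CP x; rewrite (translate_sum_seq a0 us sP).
Qed.

Lemma translate_sum_le A : precompact A -> exists C : R, 0 <= C /\
  forall a (M : R) x, (forall i, 0 <= a i) -> 0 <= M ->
    (forall i, ltrans (X i) A x -> a i <= M) ->
    (translate_sum X a A x <= (C * M)%:E)%E.
Proof.
move=> pA; have [C CP] := relatively_separated_seq sepX pA.
exists C%:R; split=> // a M x a0 M0 aM.
have [s [us sC sP]] := CP x; rewrite (translate_sum_seq a0 us sP) lee_fin.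
apply: (@le_trans _ _ (\sum_(i <- s) M)).
  rewrite [leLHS]big_seq_cond [leRHS]big_seq_cond; apply: ler_sum => i.
  by rewrite andbT => /sP /aM.
rewrite big_const_seq count_predT iter_addr_0 -[leLHS]mulr_natl ler_wpM2r//.
by rewrite ler_nat.
Qed.

Lemma le_translate_sum a A x i : (forall i, 0 <= a i) -> precompact A ->
  ltrans (X i) A x -> ((a i)%:E <= translate_sum X a A x)%E.
Proof.
move=> a0 pA iA; have [C CP] := relatively_separated_seq sepX pA.
have [s [us _ sP]] := CP x; rewrite (translate_sum_seq a0 us sP) lee_fin.
by rewrite (bigD1_seq i)//=; [rewrite lerDl sumr_ge0|apply/sP].
Qed.

Lemma translate_sum_open_lsc a U : (forall i, 0 <= a i) -> open U ->
  precompact U -> forall t : R, open [set x : G | (t%:E < translate_sum X a U x)%E].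
Proof.
move=> a0 oU pU t; rewrite openE => x /= tx.
have [C CP] := relatively_separated_seq sepX pU.
have [s [us _ sP]] := CP x; rewrite (translate_sum_seq a0 us sP) in tx.
have nb : nbhs x [set y | forall i, i \in s -> ltrans (X i) U y].
  have : forall i, i \in s -> nbhs x (ltrans (X i) U).
    by move=> i /sP iU; apply: open_nbhs_nbhs; split => //; exact: open_ltrans.
  elim: {us sP tx} s => [_|i s IH iH]; first by apply: filterS filterT.
  have nbi := iH i (mem_head i s).
  have nbs : nbhs x [set y | forall i, i \in s -> ltrans (X i) U y].
    by apply: IH => j js; apply: iH; rewrite in_cons js orbT.
  move: nbi nbs; apply: filterS2 => y iy sy j.
  by rewrite in_cons => /orP[/eqP->//|/sy].
apply: filterS nb => y sy /=; apply: lt_le_trans tx _.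
have [s' [us' _ sP']] := CP y; rewrite (translate_sum_seq a0 us' sP') lee_fin.
rewrite [leRHS](bigID (mem s))/= -[X in _ <= X + _]big_filter.
rewrite [X in _ <= X + _](perm_big s) ?lerDl ?sumr_ge0//=.
apply: uniq_perm => //; first exact: filter_uniq.
move=> i; rewrite mem_filter; apply/andP/idP => [[+ _]//|is_].
by split => //; apply/sP'/sy.
Qed.

(** The index set may be uncountable, so the sum cannot be handled term by term. For fixed [x] it
    is, as a function of the set, a finite combination of point masses at [x_i^-1 x]; this reduces
    the claim to open sets, where the sum is lower semicontinuous in [x]. *)
Lemma translate_sum_measurable a Q : (forall i, 0 <= a i) -> borel_set Q ->
  precompact Q -> measurable_fun setT (fun x : borel G => translate_sum X a Q x).
Proof.
move=> a0 mQ pQ.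
have [W [oW pW QW]] := open_precompact_superset hausG lcG pQ.
have pAW A : precompact (A `&` W) by apply: precompact_subset pW => y [].
have ex x : exists m : {measure set (borel G) -> \bar R},
    forall A, m A = translate_sum X a (A `&` W) x.
  have [C CP] := relatively_separated_seq sepX pW.
  have [s [us _ sP]] := CP x.
  pose p i : borel G := ((X i)^-1 * x)%g.
  have sE A : translate_sum X a (A `&` W) x =
      (\sum_(i <- s) (a i)%:E * \d_(p i) A)%E.
    rewrite /translate_sum (esum_seq _ us).
    - rewrite [LHS]big_seq_cond [RHS]big_seq_cond; apply: eq_bigr => i.
      rewrite andbT => /sP /ltransP Wi; rewrite EFinM; congr (_ * _)%E.
      rewrite diracE indicE (_ : (x \in _) = (p i \in A))//.
      apply/idP/idP => /set_mem iA; apply/mem_set.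
        by have /ltransP[] := iA.
      by apply/ltransP.
    - by move=> i; rewrite lee_fin mulr_ge0.
    - move=> i; rewrite indicE => is_; rewrite memNset ?mulr0//.
      by move=> /ltransP[_ /ltransP/sP]; apply/negP.
  have [m mE] := dirac_sum_measure p s a0.
  by exists m => A; rewrite mE sE.
pose m x := sval (cid (ex x)).
have mE x A : m x A = translate_sum X a (A `&` W) x by rewrite /m; case: cid.
rewrite (_ : (fun x => _) = (fun x : borel G => m x Q)); last first.
  by apply/funext => x; rewrite mE setIidl.
apply: borel_kernel_measurable => //.
  by move=> x; rewrite mE ltey_eq translate_sum_fin.
move=> U oU.
rewrite (_ : (fun x => _) = (fun x : borel G => translate_sum X a (U `&` W) x)); last first.
  by apply/funext => x; rewrite mE.
by apply: lsc_measurable; apply: translate_sum_open_lsc => //; exact: openI.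
Qed.

End relatively_separated_families.

(** * Existence of well-spread families *)

Section well_spread_families.
Context {R : realType} {G : topGroupType} (mu : {measure set (borel G) -> \bar R}).
Hypotheses (hausG : hausdorff_space G) (lcG : locally_compact [set: G]).
Hypothesis haar : left_haar_measure mu.
Implicit Types (A B E K Q U W : set G).

Lemma disjoint_translates_bound (I : eqType) (X : I -> G) V (s : seq I) T :
  borel_set V -> borel_set T -> uniq s ->
  (forall i, i \in s -> ltrans (X i) V `<=` T) ->
  (forall i j, i \in s -> j \in s -> ltrans (X i) V `&` ltrans (X j) V !=set0 -> i = j) ->
  ((size s)%:R%:E * mu V <= mu T)%E.
Proof.
move=> mV; elim: s T => [|i s IH] T mT; first by rewrite mul0e.
move=> /= /andP[is_ us] sT sD.
have mX := borel_ltrans (X i) mV.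
have mTX : borel_set (T `\` ltrans (X i) V) by exact: (@measurableD _ (borel G)).
have {}IH : ((size s)%:R%:E * mu V <= mu (T `\` ltrans (X i) V))%E.
  apply: IH => //.
  - move=> j js y jy; split; first by apply: sT jy; rewrite in_cons js orbT.
    move=> iy; move: is_; rewrite (sD i j) ?js ?mem_head ?in_cons ?js ?orbT//.
    by exists y.
  - by move=> j k js ks; apply: sD; rewrite in_cons ?js ?ks orbT.
have iT : ltrans (X i) V `<=` T by apply: sT; exact: mem_head.
have -> : mu T = (mu (ltrans (X i) V) + mu (T `\` ltrans (X i) V))%E.
  rewrite -measureU//; first by congr (mu _); rewrite setDUK.
  by apply/seteqP; split=> // y [? [_]].
rewrite (haar_invariant haar)// -natr1 EFinD ge0_muleDl ?lee_fin// mul1e addeC.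
exact: leeD2l.
Qed.

(* A maximal family of disjoint translates of V = V^-1 is V V-dense, and relatively
   separated by comparison of Haar measures. *)
Lemma well_spread_exists V : unit_nbhd V -> open V -> invset V = V ->
  exists (I : choiceType) (X : I -> G), relatively_separated X /\
    forall x, exists i, ltrans (X i) (mulset V V) x.
Proof.
move=> nV oV iV; have [n1V pV mV] := nV.
have V1 : V 1%g by exact: nbhs_singleton.
(* Zorn's lemma, applied to all translates [x V]; the centres that are kept form the index type. *)
have [E [_ tE maxE]] := ex_maximal_disjoint_subcollection (fun x : G => ltrans x V) setT.
exists E, (fun i : E => val i); split; last first.
  move=> x; have [xE|xE] := pselect (E x).
    exists (exist _ x (mem_set xE)) => /=; apply/ltransP; rewrite mulVg.
    by exists 1%g => //; exists 1%g => //; rewrite mulg1.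
  have [e Ee [y [/ltransP ey /ltransP xy]]] :
      exists2 e, E e & ltrans e V `&` ltrans x V !=set0.
    apply: contrapT => noE; apply: (maxE (E `|` [set x])) => //.
      split; first by move=> y; left.
      by move=> /(_ x) h; apply: xE; apply: h; right.
    move=> i j [Ei|->] [Ej|->] ij //; first exact: tE.
      by exfalso; apply: noE; exists i.
    by exfalso; apply: noE; exists j => //; rewrite setIC.
  exists (exist _ e (mem_set Ee)) => /=; apply/ltransP.
  exists (e^-1 * y)%g => //; exists (y^-1 * x)%g.
    by move: xy; rewrite -{1}iV /invset/= invgM invgK.
  by rewrite mulgA mulgK.
move=> K cK.
have [C0 cC VC] := (precompactP hausG V).1 pV.
(* If [x_i K] meets [x_j K] then [x_i] lies in [x_j K K^-1]. The disjoint sets [x_i V] therefore all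
   fit into [x_j L], and there are at most [mu L / mu V] of them. *)
pose L := mulset (mulset K (invset K)) C0.
have cL : compact L.
  by apply: compact_mulset => //; apply: compact_mulset => //; exact: compact_invset.
have Lfin := haar_compact haar cL.
have V0 := haar_unit_nbhd_gt0 hausG haar nV.
have Vfin := haar_precompact hausG haar mV pV.
have fV : mu V \is a fin_num by rewrite ge0_fin_numE.
have fL : mu L \is a fin_num by rewrite ge0_fin_numE.
have fV0 : 0 < fine (mu V) by rewrite fine_gt0// V0.
exists (Num.bound (fine (mu L) / fine (mu V))) => j; apply: seq_card_le => s us sK.
have mL := borel_compact hausG cL.
have sL i : i \in s -> ltrans (val i) V `<=` ltrans (val j) L.
  move=> /sK [y [/ltransP iy /ltransP jy]] z /ltransP iz; apply/ltransP.
  exists ((val j)^-1 * val i)%g; last first.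
    by exists ((val i)^-1 * z)%g; [exact: VC|rewrite mulgA mulgK].
  exists ((val j)^-1 * y)%g => //; exists (y^-1 * val i)%g.
    by rewrite /invset/= invgM invgK.
  by rewrite mulgA mulgK.
have sD i k : i \in s -> k \in s ->
    ltrans (val i) V `&` ltrans (val k) V !=set0 -> i = k.
  by move=> _ _ ik; apply: val_inj; apply: tE => //; exact: set_mem (valP _).
have := disjoint_translates_bound mV (borel_ltrans (val j) mL) us sL sD.
rewrite (haar_invariant haar)// -(fineK fV) -(fineK fL) -EFinM lee_fin.
rewrite -ler_pdivlMr// => sle.
rewrite -(ler_nat R); apply: (le_trans sle); apply: ltW; apply: archi_boundP.
by rewrite divr_ge0// fine_ge0.
Qed.

End well_spread_families.

(** * Control functions and sequence spaces *)

Section solid_space.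
Context {R : realType} {G : topGroupType} (mu : {measure set (borel G) -> \bar R}).
Context (Y : qspace R G).
Hypothesis hY : quasi_banach_function_space mu Y.

Definition cfun (T : Type) (f : T -> R) : T -> R[i] := fun x => (f x)%:C.

Lemma absC_real (r : R) : absC r%:C = `|r|.
Proof. by rewrite /absC /= expr0n addr0 sqrtr_sqr. Qed.

Lemma absC_ge0 (z : R[i]) : 0 <= absC z.
Proof. by case: z => a b; exact: sqrtr_ge0. Qed.

Lemma absCM (z w : R[i]) : absC (z * w) = absC z * absC w.
Proof. exact: Normc.normcM. Qed.

Lemma absC_le_add (z w : R[i]) : absC (z + w) <= absC z + absC w.
Proof. exact: le_normcD. Qed.

Lemma absC0_eq (z : R[i]) : absC z = 0 -> z = 0.
Proof. exact: Normc.eq0_normc. Qed.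

Lemma measurable_cfun_real (f : G -> R) :
  measurable_fun setT (f : borel G -> R) -> measurable_cfun (cfun f).
Proof. by move=> mf; split; [exact: mf|exact: measurable_cst]. Qed.

(** The form in which solidity serves the comparisons below: pointwise domination by a multiple. Its
    measurability hypothesis is the reason for the work on [x |-> m (x Q)] and on the sums over
    translates. *)
Lemma solid_le (f g : G -> R) (c : R) : qdom Y (cfun f) ->
  measurable_fun setT (g : borel G -> R) -> 0 <= c ->
  (forall x, 0 <= g x <= c * f x) ->
  qdom Y (cfun g) /\ qnorm Y (cfun g) <= c * qnorm Y (cfun f).
Proof.
move=> Yf mg c0 gf; have qn := qbfs_quasinormed hY.
rewrite -[c in c * qnorm _ _]ger0_norm// -absC_real -(qn_homo qn)//.
apply: (qbfs_solid hY); first exact: (qn_domZ qn).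
  exact: measurable_cfun_real.
apply: aeW => x; rewrite absCM !absC_real (ger0_norm c0).
have /andP[g0 gcf] := gf x; rewrite ger0_norm// (le_trans gcf)//.
by rewrite ler_wpM2l// ler_norm.
Qed.

End solid_space.

Section control_norms.
Context {R : realType} {G : topGroupType} (mu : {measure set (borel G) -> \bar R}).
Hypotheses (hausG : hausdorff_space G) (lcG : locally_compact [set: G]).
Hypothesis haar : left_haar_measure mu.
Context (Y : qspace R G).
Hypothesis hY : quasi_banach_function_space mu Y.
Implicit Types (A B E K Q U V W : set G).

(* The properties of A |-> ||chi_A F|B|| which make the argument independent
   of the local component B. *)
Record control_norm (m : set G -> R) : Prop := {
  cn_ge0 : forall A, borel_set A -> precompact A -> 0 <= m A;
  cn_0 : m set0 = 0;
  cn_le : forall A B, borel_set A -> borel_set B -> precompact B -> A `<=` B ->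
    m A <= m B;
  cn_U : forall A B, borel_set A -> borel_set B -> precompact A -> precompact B ->
    m (A `|` B) <= m A + m B;
  cn_measurable : forall Q, borel_set Q -> precompact Q ->
    measurable_fun setT (fun x : borel G => m (ltrans x Q))
}.

Definition control_of (m : set G -> R) Q : G -> R[i] :=
  cfun (fun x => m (ltrans x Q)).

Lemma cn_cover (I : eqType) m (A : set G) (F : I -> set G) (s : seq I) :
  control_norm m -> borel_set A -> precompact A ->
  (forall i, i \in s -> borel_set (F i)) -> (forall i, i \in s -> precompact (F i)) ->
  (forall y, A y -> exists2 i, i \in s & F i y) ->
  m A <= \sum_(i <- s) m (F i).
Proof.
move=> cm; elim: s A => [|i s IH] A mA pA mF pF AF.
  rewrite big_nil (_ : A = set0) ?(cn_0 cm)//.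
  by apply/seteqP; split=> // y /AF[].
have mFi : borel_set (F i) by apply: mF; exact: mem_head.
have pFi : precompact (F i) by apply: pF; exact: mem_head.
have mAF : borel_set (A `\` F i) by exact: (@measurableD _ (borel G)).
have pAF : precompact (A `\` F i) by apply: precompact_subset pA => y [].
have {IH}IHs : m (A `\` F i) <= \sum_(j <- s) m (F j).
  apply: IH => //.
  - by move=> j js; apply: mF; rewrite in_cons js orbT.
  - by move=> j js; apply: pF; rewrite in_cons js orbT.
  move=> y [/AF[j + Fjy] nFi]; rewrite in_cons => /orP[/eqP ji|js]; last by exists j.
  by rewrite ji in Fjy.
rewrite big_cons; apply: le_trans (lerD (lexx _) IHs).
apply: le_trans (cn_U cm _ _ _ _) => //; apply: (cn_le cm) => //.
- exact: (@measurableU _ (borel G)).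
- exact: precompactU.
- by move=> y Ay; have [Fy|nFy] := pselect (F i y); [left|right].
Qed.

Lemma precompact_mulset A B : precompact A -> precompact B -> precompact (mulset A B).
Proof.
move=> /(precompactP hausG)[K cK AK] /(precompactP hausG)[L cL BL].
apply/(precompactP hausG); exists (mulset K L); first exact: compact_mulset.
by move=> _ [a /AK Ka [b /BL Lb <-]]; exists a => //; exists b.
Qed.

Lemma precompact_invset A : precompact A -> precompact (invset A).
Proof.
move=> /(precompactP hausG)[K cK AK]; apply/(precompactP hausG).
by exists (invset K); [exact: compact_invset|move=> y /AK].
Qed.

Definition synth (I : choiceType) (X : I -> G) (a : I -> R) Q : G -> R :=
  fun x => fine (translate_sum X a Q x).

Lemma synthesisE (I : choiceType) (X : I -> G) (a : I -> R) Q :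
  (forall i, 0 <= a i) -> synthesis X Q (cfun a) = cfun (synth X a Q).
Proof.
move=> a0; apply/funext => x; congr (fine _)%:C; apply: eq_esum => i _.
by rewrite absC_real ger0_norm.
Qed.

Section synth.
Context (I : choiceType) (X : I -> G).
Hypothesis sepX : relatively_separated X.

Lemma EFin_synth (a : I -> R) Q x : (forall i, 0 <= a i) -> precompact Q ->
  (synth X a Q x)%:E = translate_sum X a Q x.
Proof. by move=> a0 pQ; rewrite /synth fineK// translate_sum_fin. Qed.

Lemma synth_ge0 (a : I -> R) Q x : (forall i, 0 <= a i) -> 0 <= synth X a Q x.
Proof. by move=> a0; rewrite /synth fine_ge0// translate_sum_ge0. Qed.

Lemma synth_measurable (a : I -> R) Q : (forall i, 0 <= a i) -> borel_set Q ->
  precompact Q -> measurable_fun setT (synth X a Q : borel G -> R).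
Proof.
move=> a0 mQ pQ; apply/measurable_EFinP.
rewrite (_ : _ \o _ = fun x : borel G => translate_sum X a Q x).
  exact: translate_sum_measurable.
by apply/funext => x /=; rewrite EFin_synth.
Qed.

(** [C] bounds the number of translates of [A] through a point. It is chosen before the
    coefficients, so the resulting estimates are uniform in [F]. *)
Lemma synth_le A : precompact A -> exists C : R, 0 <= C /\
  forall (a : I -> R) (M : R) x, (forall i, 0 <= a i) -> 0 <= M ->
    (forall i, ltrans (X i) A x -> a i <= M) -> synth X a A x <= C * M.
Proof.
move=> pA; have [C [C0 CP]] := @translate_sum_le R G hausG I X sepX A pA.
by exists C; split=> // a M x a0 M0 aM; rewrite -lee_fin EFin_synth// CP.
Qed.

End synth.

Section from_sequence_spaces.
Hypothesis seqY : seq_space_independent Y.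

Lemma seq_space_equiv (I : choiceType) (X : I -> G) Q Q' :
  relatively_separated X -> unit_nbhd Q -> unit_nbhd Q' ->
  exists2 C : R, 0 <= C & forall a : I -> R, (forall i, 0 <= a i) ->
    qdom Y (cfun (synth X a Q)) -> qdom Y (cfun (synth X a Q')) /\
    qnorm Y (cfun (synth X a Q')) <= C * qnorm Y (cfun (synth X a Q)).
Proof.
move=> sepX nQ nQ'; have [dom [c [C [c0 C0 cC]]]] := seqY sepX nQ nQ'.
exists C; first exact: ltW.
move=> a a0; rewrite -!synthesisE// => aQ; split; first exact: (dom (cfun a)).1.
by have /andP[] := cC _ aQ.
Qed.

(* m(xQ) is controlled from below by the values of m on the pieces x_i V
   contained in xQ, and m(xQ') from above by those meeting xQ'. *)
Lemma control_of_equiv Q Q' : unit_nbhd Q -> unit_nbhd Q' ->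
  exists2 C : R, 0 <= C & forall m, control_norm m ->
    qdom Y (control_of m Q) -> qdom Y (control_of m Q') /\
    qnorm Y (control_of m Q') <= C * qnorm Y (control_of m Q).
Proof.
move=> nQ nQ'; have [n1Q pQ mQ] := nQ; have [n1Q' pQ' mQ'] := nQ'.
(* With [V = V^-1] and [V V] inside [Q], [x] in [x_i V] forces [x_i V] into [x Q]. *)
have [V [nV oV iV VQ]] := small_unit_nbhd hausG lcG n1Q.
have [n1V pV mV] := nV.
(* [well_spread_exists] covers [G] by translates of a product, so [V0 V0] is taken inside [V]. *)
have [V0 [nV0 oV0 iV0 V0V]] := small_unit_nbhd hausG lcG n1V.
have [I [X [sepX denseX0]]] := well_spread_exists hausG haar nV0 oV0 iV0.
have denseX x : exists i, ltrans (X i) V x.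
  by have [i ip] := denseX0 x; exists i; apply: ltransS ip.
(* [x_i V] meets [x Q'] exactly when [x] lies in [x_i V Q'^-1]; the window [Q2] absorbs this set. *)
have pVQ : precompact (mulset V (invset Q')).
  by apply: precompact_mulset => //; exact: precompact_invset.
have [Q2 [nQ2 cQ2 VQ2 _]] := precompact_unit_nbhd hausG nV pVQ.
have [_ pQ2 mQ2] := nQ2.
have [C1 [C10 C1P]] := synth_le sepX pV.
have [C2 C20 C2P] := seq_space_equiv sepX nV nQ2.
exists (C2 * C1); first exact: mulr_ge0.
move=> m cm mQY.
pose a i := m (ltrans (X i) V).
have mXV i : borel_set (ltrans (X i) V) by exact: borel_ltrans.
have pXV i : precompact (ltrans (X i) V) by exact: precompact_ltrans.
have a0 i : 0 <= a i by apply: (cn_ge0 cm).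
have mxQ x : borel_set (ltrans x Q) by exact: borel_ltrans.
have pxQ x : precompact (ltrans x Q) by exact: precompact_ltrans.
have [aV aVle] : qdom Y (cfun (synth X a V)) /\
    qnorm Y (cfun (synth X a V)) <= C1 * qnorm Y (control_of m Q).
  apply: (solid_le hY) => //; first exact: synth_measurable.
  move=> x; rewrite synth_ge0//=; apply: C1P => //; first exact: (cn_ge0 cm).
  move=> i /ltransP ix; apply: (cn_le cm) => // y /ltransP iy; apply/ltransP.
  apply: VQ; exists (x^-1 * X i)%g; last first.
    by exists ((X i)^-1 * y)%g => //; rewrite mulgA mulgK.
  by rewrite -iV /invset/= invgM invgK.
have [aQ2 aQ2le] := C2P _ a0 aV.
have [mQ'Y mQ'le] : qdom Y (control_of m Q') /\
    qnorm Y (control_of m Q') <= 1 * qnorm Y (cfun (synth X a Q2)).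
  apply: (solid_le hY) => //; first exact: (cn_measurable cm).
  have mxQ' x : borel_set (ltrans x Q') by exact: borel_ltrans.
  have pxQ' x : precompact (ltrans x Q') by exact: precompact_ltrans.
  move=> x; rewrite (cn_ge0 cm)//= mul1r.
  have [C CP] := relatively_separated_seq hausG sepX pQ2.
  have [s [us _ sP]] := CP x.
  rewrite -lee_fin EFin_synth// (translate_sum_seq a0 us sP) lee_fin.
  apply: cn_cover => // y /ltransP xy; have [i iy] := denseX y; exists i => //.
  apply/sP; apply/ltransP; apply: VQ2; exists ((X i)^-1 * y)%g; first exact/ltransP.
  by exists (y^-1 * x)%g; [rewrite /invset/= invgM invgK|rewrite mulgA mulgK].
split => //; rewrite mul1r in mQ'le; apply: (le_trans mQ'le).
by rewrite -mulrA; apply: (le_trans aQ2le); rewrite ler_wpM2l.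
Qed.

(** One half of the BUPU comparison. If [x] lies in [x_i Q'], then [x_i U] is inside [x Q'^-1 U],
    hence inside [x Q2]; so every coefficient seen at [x] is at most [c * m (x Q2)], and boundedly
    many are seen. [control_of_equiv] then exchanges [Q2] for [Q]. *)
Lemma synth_of_control Q Q' U (I : choiceType) (X : I -> G) (c : R) :
  relatively_separated X -> unit_nbhd Q -> unit_nbhd Q' -> borel_set U ->
  precompact U -> 0 <= c ->
  exists2 C : R, 0 <= C & forall m (a : I -> R), control_norm m ->
    (forall i, 0 <= a i <= c * m (ltrans (X i) U)) ->
    qdom Y (control_of m Q) -> qdom Y (cfun (synth X a Q')) /\
    qnorm Y (cfun (synth X a Q')) <= C * qnorm Y (control_of m Q).
Proof.
move=> sepX nQ nQ' mU pU c0; have [_ pQ' mQ'] := nQ'.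
have pQU : precompact (mulset (invset Q') U).
  by apply: precompact_mulset => //; exact: precompact_invset.
have [Q2 [nQ2 cQ2 QUQ2 _]] := precompact_unit_nbhd hausG nQ pQU.
have [_ pQ2 mQ2] := nQ2.
have [C1 [C10 C1P]] := synth_le sepX pQ'.
have [C2 C20 C2P] := control_of_equiv nQ nQ2.
exists (C1 * c * C2); first by rewrite !mulr_ge0.
move=> m a cm am mQY; have [mQ2Y mQ2le] := C2P _ cm mQY.
have a0 i : 0 <= a i by have /andP[] := am i.
have [|||sY sle] := @solid_le R G mu Y hY (fun x => m (ltrans x Q2)) (synth X a Q') (C1 * c) mQ2Y.
- exact: synth_measurable.
- exact: mulr_ge0.
- have mxQ x : borel_set (ltrans x Q2) by exact: borel_ltrans.
  have pxQ x : precompact (ltrans x Q2) by exact: precompact_ltrans.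
  move=> x; rewrite synth_ge0//= -mulrA; apply: C1P => //.
    by rewrite mulr_ge0// (cn_ge0 cm).
  move=> i /ltransP ix; have /andP[_ aic] := am i; apply: (le_trans aic).
  rewrite ler_wpM2l//; apply: (cn_le cm) => //; first exact: borel_ltrans.
  move=> y /ltransP iy; apply/ltransP; apply: QUQ2; exists (x^-1 * X i)%g.
    by rewrite /invset/= invgM invgK.
  by exists ((X i)^-1 * y)%g => //; rewrite mulgA mulgK.
split => //; apply: (le_trans sle); rewrite -[leRHS]mulrA ler_wpM2l//.
exact: mulr_ge0.
Qed.

(** The other half: the pointwise bound holds with a large window [Q2], and independence of the
    sequence space exchanges it for [Q']. *)
Lemma control_of_synth Q Q' Q2 (I : choiceType) (X : I -> G) :
  relatively_separated X -> unit_nbhd Q -> unit_nbhd Q' -> unit_nbhd Q2 ->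
  exists2 C : R, 0 <= C & forall m (a : I -> R), control_norm m ->
    (forall i, 0 <= a i) -> (forall x, m (ltrans x Q) <= synth X a Q2 x) ->
    qdom Y (cfun (synth X a Q')) -> qdom Y (control_of m Q) /\
    qnorm Y (control_of m Q) <= C * qnorm Y (cfun (synth X a Q')).
Proof.
move=> sepX nQ nQ' nQ2; have [_ pQ mQ] := nQ.
have [C C0 CP] := seq_space_equiv sepX nQ' nQ2.
exists C => // m a cm a0 ma aQ'; have [aQ2 aQ2le] := CP _ a0 aQ'.
have [|||cY cle] := @solid_le R G mu Y hY (synth X a Q2) (fun x => m (ltrans x Q)) 1 aQ2.
- exact: (cn_measurable cm).
- exact: ler01.
- move=> x; rewrite mul1r ma andbT (cn_ge0 cm)//; first exact: borel_ltrans.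
  exact: precompact_ltrans.
by split => //; rewrite mul1r in cle; exact: le_trans cle aQ2le.
Qed.

End from_sequence_spaces.

End control_norms.

(** * The local components of function type *)

Section measurable_cfun.
Context {R : realType} {G : topGroupType}.
Implicit Types (F H : G -> R[i]) (A K : set G) (psi : G -> R).

Lemma continuous_borel psi : continuous psi ->
  measurable_fun setT (psi : borel G -> R).
Proof.
move=> cpsi; apply/measurable_EFinP; apply: lsc_measurable => t.
rewrite (_ : [set x | _] = psi @^-1` [set r | t < r]).
  by apply: open_comp => [x _|]; [exact: cpsi|exact: open_gt].
by apply/seteqP; split=> x /=; rewrite lte_fin.
Qed.

Lemma measurable_cfunD F H : measurable_cfun F -> measurable_cfun H ->
  measurable_cfun (fun x => F x + H x).
Proof.
move=> [mF1 mF2] [mH1 mH2]; split.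
  rewrite (_ : (fun x => _) = (fun x : borel G => reC (F x) + reC (H x))).
    exact: measurable_funD.
  by apply/funext => x; rewrite /reC; case: (F x) (H x) => [a b] [c d].
rewrite (_ : (fun x => _) = (fun x : borel G => imC (F x) + imC (H x))).
  exact: measurable_funD.
by apply/funext => x; rewrite /imC; case: (F x) (H x) => [a b] [c d].
Qed.

Lemma measurable_cfunZ c F : measurable_cfun F -> measurable_cfun (fun x => c * F x).
Proof.
case: c => a b [mF1 mF2]; split.
  rewrite (_ : (fun x => _) = (fun x : borel G => a * reC (F x) - b * imC (F x))).
    by apply: measurable_funB; exact: measurable_funM.
  by apply/funext => x; rewrite /reC/imC; case: (F x) => [c d].
rewrite (_ : (fun x => _) = (fun x : borel G => a * imC (F x) + b * reC (F x))).
  by apply: measurable_funD; exact: measurable_funM.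
by apply/funext => x; rewrite /reC/imC; case: (F x) => [c d].
Qed.

Lemma measurable_cfunM psi F : measurable_fun setT (psi : borel G -> R) ->
  measurable_cfun F -> measurable_cfun (fun x => (psi x)%:C * F x).
Proof.
move=> mpsi [mF1 mF2]; split.
  rewrite (_ : (fun x => _) = (fun x : borel G => psi x * reC (F x))).
    exact: measurable_funM.
  by apply/funext => x; rewrite /reC; case: (F x) => [c d] /=; rewrite mul0r subr0.
rewrite (_ : (fun x => _) = (fun x : borel G => psi x * imC (F x))).
  exact: measurable_funM.
by apply/funext => x; rewrite /imC; case: (F x) => [c d] /=; rewrite mul0r addr0.
Qed.

Lemma indicC A (x : G) : (\1_A x : R[i]) = (\1_A x : R)%:C.
Proof. by rewrite !indicE; case: (x \in A). Qed.

Lemma measurable_cfun_indic A F : borel_set A -> measurable_cfun F ->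
  measurable_cfun (fun x => \1_A x * F x).
Proof.
move=> mA mF; rewrite (_ : (fun x => _) = fun x => (\1_A x : R)%:C * F x).
  exact: measurable_cfunM.
by apply/funext => x; rewrite indicC.
Qed.

Lemma measurable_cfun0 : measurable_cfun (fun=> 0 : R[i]) (G := G).
Proof. by split; exact: measurable_cst. Qed.

Lemma measurable_absC F : measurable_cfun F ->
  measurable_fun setT (fun x : borel G => absC (F x)).
Proof.
move=> [mF1 mF2].
rewrite (_ : (fun x => _) =
  Num.sqrt \o (fun x : borel G => reC (F x) ^+ 2 + imC (F x) ^+ 2)).
  apply: measurableT_comp.
    by apply: continuous_measurable_fun; exact: sqrt_continuous.
  by apply: measurable_funD; exact: measurable_funX.
by apply/funext => x /=; rewrite /absC/reC/imC; case: (F x).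
Qed.

Lemma absC_indic A F (x : G) : absC (\1_A x * F x) = \1_A x * absC (F x).
Proof. by rewrite indicC absCM absC_real ger0_norm. Qed.

Lemma measurable_cfun_indicS A K F : borel_set A -> A `<=` K ->
  measurable_cfun (fun x => \1_K x * F x) -> measurable_cfun (fun x => \1_A x * F x).
Proof.
move=> mA AK mF; rewrite (_ : (fun x => _) = fun x => \1_A x * (\1_K x * F x)).
  exact: measurable_cfun_indic.
apply/funext => x; rewrite mulrA -[_ * \1_K x]/((\1_A \* \1_K) x) -indicI.
by rewrite setIidl.
Qed.

End measurable_cfun.

(** * Monotone norms of locally measurable functions *)

Section function_norms.
Context {R : realType} {G : topGroupType}.
Hypotheses (hausG : hausdorff_space G) (lcG : locally_compact [set: G]).
Implicit Types (F H : G -> R[i]) (A K : set G) (psi : G -> R).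

(** What the [L^oo] and [L^1] norms share. Values in [\bar R] keep these laws free of finiteness
    conditions, which enter through [locC] only. *)
Record function_norm (n : (G -> R[i]) -> \bar R) : Prop := {
  fn_ge0 : forall F, (0 <= n F)%E;
  fn_0 : n (fun=> 0) = 0%E;
  fn_le : forall F H, measurable_cfun F -> measurable_cfun H ->
    (forall x, absC (F x) <= absC (H x)) -> (n F <= n H)%E;
  fn_D : forall F H, measurable_cfun F -> measurable_cfun H ->
    (n (fun x => F x + H x)%R <= n F + n H)%E;
  fn_Z : forall c F, measurable_cfun F ->
    (n (fun x => c * F x)%R = (absC c)%:E * n F)%E
}.

Variable n : (G -> R[i]) -> \bar R.
Hypothesis fn : function_norm n.

Definition restrictC A F : G -> R[i] := fun x => \1_A x * F x.
Definition mulC psi F : G -> R[i] := fun x => (psi x)%:C * F x.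

Definition locC F := forall K : set G, compact K ->
  measurable_cfun (restrictC K F) /\ (n (restrictC K F) < +oo)%E.

Definition mC F A : R := fine (n (restrictC A F)).

Lemma absC_restrict_le A B F x : A `<=` B ->
  absC (restrictC A F x) <= absC (restrictC B F x).
Proof.
move=> AB; rewrite !absC_indic ler_wpM2r ?absC_ge0// !indicE.
have [/set_mem/AB xB|_] := boolP (x \in A); last by rewrite ler0n.
by rewrite (mem_set xB).
Qed.

Lemma measurable_restrictC F A : locC F -> borel_set A -> precompact A ->
  measurable_cfun (restrictC A F).
Proof.
move=> lF mA /(precompactP hausG)[K cK AK].
exact: measurable_cfun_indicS AK (lF K cK).1.
Qed.

Lemma restrictC_fin F A : locC F -> borel_set A -> precompact A ->
  n (restrictC A F) \is a fin_num.
Proof.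
move=> lF mA pA; rewrite ge0_fin_numE; last exact: (fn_ge0 fn).
have [K cK AK] := (precompactP hausG A).1 pA.
apply: le_lt_trans (lF K cK).2; apply: (fn_le fn).
- exact: measurable_restrictC.
- exact: (lF K cK).1.
- by move=> x; exact: absC_restrict_le.
Qed.

Lemma mC_ge0 F A : 0 <= mC F A.
Proof. by rewrite fine_ge0// (fn_ge0 fn). Qed.

Lemma mC_0 F : mC F set0 = 0.
Proof.
rewrite /mC (_ : restrictC _ _ = fun=> 0) ?(fn_0 fn)//.
by apply/funext => x; rewrite /restrictC indic0 mul0r.
Qed.

Lemma mC_le F A B : locC F -> borel_set A -> borel_set B -> precompact B ->
  A `<=` B -> mC F A <= mC F B.
Proof.
move=> lF mA mB pB AB; have pA := precompact_subset AB pB.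
apply: fine_le; rewrite ?restrictC_fin//; apply: (fn_le fn).
- exact: measurable_restrictC.
- exact: measurable_restrictC.
- by move=> x; exact: absC_restrict_le.
Qed.

Lemma mC_U F A B : locC F -> borel_set A -> borel_set B -> precompact A ->
  precompact B -> mC F (A `|` B) <= mC F A + mC F B.
Proof.
move=> lF mA mB pA pB.
have mBA : borel_set (B `\` A) by exact: (@measurableD _ (borel G)).
have pBA : precompact (B `\` A) by apply: precompact_subset pB => y [].
have mAB : borel_set (A `|` B) by exact: (@measurableU _ (borel G)).
have pAB := precompactU hausG pA pB.
apply: (@le_trans _ _ (mC F A + mC F (B `\` A))); last first.
  by rewrite lerD2l; apply: mC_le => // y [].
rewrite -lee_fin EFinD !fineK ?restrictC_fin//.
rewrite (_ : restrictC (A `|` B) F =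
  fun x => restrictC A F x + restrictC (B `\` A) F x).
  by apply: (fn_D fn); exact: measurable_restrictC.
apply/funext => x; rewrite /restrictC -mulrDl; congr (_ * _).
rewrite !indicE in_setU in_setD.
by case: (x \in A); case: (x \in B); rewrite /= ?addr0 ?add0r.
Qed.

Section multipliers.
Variables (psi : G -> R) (K : set G).
Hypotheses (cpsi : continuous psi) (psi01 : forall x, 0 <= psi x <= 1).
Hypotheses (cK : compact K) (psiK : forall x, psi x != 0 -> K x).

(** [F] is measurable, with finite norm, only after restriction to compact sets, so statements on
    [psi F] pass to the restriction of [F] to [K]. *)
Lemma mulC_restrict F : mulC psi F = mulC psi (restrictC K F).
Proof.
apply/funext => x; rewrite /mulC /restrictC.
have [->|px] := eqVneq (psi x) 0; first by rewrite !mul0r.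
by rewrite indicE (mem_set (psiK px)) mul1r.
Qed.

Lemma measurable_mulC F : locC F -> measurable_cfun (mulC psi F).
Proof.
move=> lF; rewrite mulC_restrict; apply: measurable_cfunM; last exact: (lF K cK).1.
exact: continuous_borel.
Qed.

Lemma absC_mulC F x : absC (mulC psi F x) <= absC (restrictC K F x).
Proof.
rewrite mulC_restrict /mulC absCM absC_real; have /andP[p0 p1] := psi01 x.
by rewrite ger0_norm// ler_piMl// absC_ge0.
Qed.

Lemma mulC_le F : locC F -> (n (mulC psi F) <= n (restrictC K F))%E.
Proof.
move=> lF; apply: (fn_le fn).
- exact: measurable_mulC.
- exact: (lF K cK).1.
- exact: absC_mulC.
Qed.

Lemma mulC_fin F : locC F -> n (mulC psi F) \is a fin_num.
Proof.
move=> lF; rewrite ge0_fin_numE; last exact: (fn_ge0 fn).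
exact: le_lt_trans (mulC_le lF) (lF K cK).2.
Qed.

Lemma mulC_le_mC F : locC F -> fine (n (mulC psi F)) <= mC F K.
Proof.
move=> lF; apply: fine_le; [exact: mulC_fin| |exact: mulC_le].
apply: restrictC_fin => //; first exact: borel_compact.
by apply/(precompactP hausG); exists K.
Qed.

Lemma mulCD F H : locC F -> locC H ->
  fine (n (mulC psi (fun x => F x + H x))) <=
  fine (n (mulC psi F)) + fine (n (mulC psi H)).
Proof.
move=> lF lH; rewrite -lee_fin EFinD [in leRHS]fineK ?mulC_fin//.
rewrite [in leRHS]fineK ?mulC_fin//.
have le : (n (mulC psi (fun x => (F x + H x)%R)) <=
    n (mulC psi F) + n (mulC psi H))%E.
  rewrite (_ : mulC psi _ = fun x => mulC psi F x + mulC psi H x).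
    by apply: (fn_D fn); exact: measurable_mulC.
  by apply/funext => x; rewrite /mulC mulrDr.
rewrite fineK// ge0_fin_numE; last exact: (fn_ge0 fn).
apply: (le_lt_trans le).
by rewrite lte_add_pinfty// -ge0_fin_numE ?(fn_ge0 fn)// mulC_fin.
Qed.

Lemma mulCZ c F : locC F ->
  fine (n (mulC psi (fun x => c * F x))) = absC c * fine (n (mulC psi F)).
Proof.
move=> lF; rewrite (_ : mulC psi _ = fun x => c * mulC psi F x).
  rewrite (fn_Z fn); last exact: measurable_mulC.
  by rewrite fineM// mulC_fin.
by apply/funext => x; rewrite /mulC mulrCA.
Qed.

End multipliers.

Lemma fn_sum (I : eqType) (s : seq I) (F : I -> G -> R[i]) :
  (forall i, i \in s -> measurable_cfun (F i)) ->
  measurable_cfun (fun x => \sum_(i <- s) F i x) /\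
  (n (fun x => \sum_(i <- s) F i x)%R <= \sum_(i <- s) n (F i))%E.
Proof.
elim: s => [|i s IH] mF.
  rewrite (_ : (fun x => _) = fun=> 0); last by apply/funext => x; rewrite big_nil.
  by rewrite big_nil (fn_0 fn); split => //; exact: measurable_cfun0.
have [|ms nls] := IH; first by move=> j js; apply: mF; rewrite in_cons js orbT.
have mi : measurable_cfun (F i) by apply: mF; exact: mem_head.
rewrite (_ : (fun x => _) = fun x => F i x + \sum_(j <- s) F j x); last first.
  by apply/funext => x; rewrite big_cons.
split; first exact: measurable_cfunD.
by rewrite big_cons; apply: le_trans (fn_D fn mi ms) _; exact: leeD2l.
Qed.

(** Since the finite sum of the [psi i] is 1 on [A], [chi_A F] is the sum of the functions
    [chi_A psi_i F], and dropping [chi_A] only increases their norms. *)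
Lemma mC_le_sum F A (I : eqType) (s : seq I) (psi : I -> G -> R) (K : I -> set G) :
  locC F -> borel_set A -> precompact A ->
  (forall i, continuous (psi i)) -> (forall i x, 0 <= psi i x <= 1) ->
  (forall i, compact (K i)) -> (forall i x, psi i x != 0 -> K i x) ->
  (forall x, A x -> \sum_(i <- s) psi i x = 1) ->
  mC F A <= \sum_(i <- s) fine (n (mulC (psi i) F)).
Proof.
move=> lF mA pA cpsi psi01 cK psiK sum1.
have fin i : n (mulC (psi i) F) \is a fin_num by exact: mulC_fin (psiK i) _ lF.
have mm i : measurable_cfun (mulC (psi i) F) by exact: measurable_mulC (psiK i) _ lF.
rewrite -lee_fin -sumEFin fineK ?restrictC_fin//.
rewrite (eq_bigr (fun i => n (mulC (psi i) F))); last by move=> i _; rewrite fineK.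
rewrite (_ : restrictC A F = fun x => \sum_(i <- s) \1_A x * mulC (psi i) F x).
  have [|_ +] := @fn_sum _ s (fun i x => \1_A x * mulC (psi i) F x).
    by move=> i _; exact: measurable_cfun_indic.
  move=> /le_trans; apply; apply: lee_sum => i _; apply: (fn_le fn) => //.
    exact: measurable_cfun_indic.
  by move=> x; rewrite absC_indic ler_piMl ?absC_ge0// indicE lern1 leq_b1.
apply/funext => x; rewrite -mulr_sumr /restrictC indicE.
have [/set_mem xA|_] := boolP (x \in A); last by rewrite !mul0r.
by rewrite !mul1r -mulr_suml -rmorph_sum/= sum1// mul1r.
Qed.

Lemma locC0 : locC (fun=> 0).
Proof.
move=> K cK; rewrite (_ : restrictC _ _ = fun=> 0).
  by rewrite (fn_0 fn); split => //; exact: measurable_cfun0.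
by apply/funext => x; rewrite /restrictC mulr0.
Qed.

Lemma locCD F H : locC F -> locC H -> locC (fun x => F x + H x).
Proof.
move=> lF lH K cK; have [mF nF] := lF K cK; have [mH nH] := lH K cK.
rewrite (_ : restrictC _ _ = fun x => restrictC K F x + restrictC K H x).
  split; first exact: measurable_cfunD.
  by apply: le_lt_trans (fn_D fn mF mH) _; rewrite lte_add_pinfty.
by apply/funext => x; rewrite /restrictC mulrDr.
Qed.

Lemma locCZ c F : locC F -> locC (fun x => c * F x).
Proof.
move=> lF K cK; have [mF nF] := lF K cK.
rewrite (_ : restrictC _ _ = fun x => c * restrictC K F x).
  split; first exact: measurable_cfunZ.
  by rewrite (fn_Z fn _ mF) lte_mul_pinfty// lee_fin absC_ge0.
by apply/funext => x; rewrite /restrictC mulrCA.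
Qed.

End function_norms.

(** * The essential supremum and integral norms *)

Section Lebesgue_norms.
Context {R : realType} {G : topGroupType} (mu : {measure set (borel G) -> \bar R}).
Hypotheses (hausG : hausdorff_space G) (lcG : locally_compact [set: G]).
Hypothesis haar : left_haar_measure mu.
Implicit Types (F H : G -> R[i]) (A K : set G).

Definition normLoo F : \bar R := Lnorm mu +oo%E (fun x : borel G => (absC (F x))%:E).
Definition normL1 F : \bar R := Lnorm mu 1%:E (fun x : borel G => (absC (F x))%:E).

Lemma haar_setT_gt0 : (0 < mu setT)%E.
Proof. by rewrite measure_gt0; apply/eqP; exact: haar_neq0 haar. Qed.

(** [Lnorm] at [+oo] is the essential supremum for a nonzero measure; this is where [haar_setT_gt0]
    enters. *)
Lemma normLooE F : normLoo F = ess_sup mu (fun x : borel G => (absC (F x))%:E).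
Proof.
rewrite /normLoo unlock haar_setT_gt0; congr ess_sup; apply/funext => x /=.
by rewrite ger0_norm// absC_ge0.
Qed.

Lemma normL1E F : normL1 F = (\int[mu]_x (absC (F x))%:E)%E.
Proof.
rewrite /normL1 Lnorm1; apply: eq_integral => x _ /=.
by rewrite ger0_norm// absC_ge0.
Qed.

Lemma normLoo_function_norm : function_norm normLoo.
Proof.
split.
- by move=> F; exact: Lnorm_ge0.
- rewrite normLooE; apply: ess_sup_ae_cst; first exact: haar_setT_gt0.
  by apply: aeW => x; rewrite /absC /= expr0n /= addr0 sqrtr0.
- move=> F H _ _ FH; rewrite !normLooE; apply: le_ess_sup; apply: aeW => x.
  by rewrite lee_fin.
- move=> F H _ _; rewrite !normLooE; apply: le_trans (ess_supD _ _ _).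
  by apply: le_ess_sup; apply: aeW => x; rewrite lee_fin absC_le_add.
- move=> c F _; rewrite !normLooE -ess_supZl ?absC_ge0//; last exact: haar_setT_gt0.
  by congr ess_sup; apply/funext => x /=; rewrite absCM EFinM.
Qed.

Lemma normL1_function_norm : function_norm normL1.
Proof.
have mE F : measurable_cfun F ->
    measurable_fun setT (fun x : borel G => (absC (F x))%:E).
  by move=> mF; apply/measurable_EFinP; exact: measurable_absC.
have ge0 F : forall x : borel G, setT x -> (0 <= (absC (F x))%:E)%E.
  by move=> x _; rewrite lee_fin absC_ge0.
split.
- by move=> F; exact: Lnorm_ge0.
- rewrite normL1E integral0_eq// => x _.
  by rewrite /absC /= expr0n /= addr0 sqrtr0.
- move=> F H mF mH FH; rewrite !normL1E; apply: ge0_le_integral => //.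
  + exact: ge0.
  + exact: mE.
  + exact: mE.
  + by move=> x _; rewrite lee_fin.
- move=> F H mF mH; rewrite !normL1E -ge0_integralD//.
  + apply: ge0_le_integral => //; first exact: ge0.
    * by apply: mE; exact: measurable_cfunD.
    * by apply: emeasurable_funD; exact: mE.
    * by move=> x _; rewrite -EFinD lee_fin absC_le_add.
  + exact: ge0.
  + exact: mE.
  + exact: ge0.
  + exact: mE.
- move=> c F mF; rewrite !normL1E -ge0_integralZl//; last 3 first.
  + exact: mE.
  + exact: ge0.
  + by rewrite lee_fin absC_ge0.
  by apply: eq_integral => x _; rewrite absCM EFinM.
Qed.

Lemma superlevel_borel F A (t : R) : measurable_cfun (restrictC A F) -> borel_set A ->
  borel_set (A `&` [set x | t < absC (F x)]).
Proof.
move=> mF mA.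
have h : borel_set (A `&` [set x | t < absC (restrictC A F x)]).
  apply: (@measurableI _ (borel G)) => //.
  have := measurable_absC mF.
  move=> /(_ (@measurableT _ (borel G)) `]t, +oo[%classic (measurable_itv _)).
  rewrite setTI; congr (measurable _).
  by apply/seteqP; split => x /=; rewrite in_itv/= andbT.
rewrite (_ : _ `&` _ = A `&` [set x | t < absC (restrictC A F x)])//.
by apply/seteqP; split => x [Ax]; rewrite /= absC_indic indicE (mem_set Ax) mul1r.
Qed.

Local Notation locLoo := (locC normLoo).
Local Notation mLoo := (mC normLoo).

(** For [t >= 0] the value 0 taken off [A] never exceeds [t], so the superlevel set of [chi_A F] is
    the part in [A] of that of [F]. *)
Lemma normLoo_restrict_le F A (t : R) : locLoo F -> borel_set A -> precompact A ->
  0 <= t -> mLoo F A <= t <-> mu (A `&` [set x | t < absC (F x)]) = 0%E.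
Proof.
move=> lF mA pA t0; rewrite -lee_fin fineK; last first.
  exact: (restrictC_fin hausG normLoo_function_norm).
have mF := measurable_restrictC hausG lF mA pA.
have mE : measurable_fun setT (fun x : borel G => (absC (restrictC A F x))%:E).
  by apply/measurable_EFinP; exact: measurable_absC.
have -> : A `&` [set x | t < absC (F x)] =
    (fun x : borel G => (absC (restrictC A F x))%:E) @^-1` `]t%:E, +oo[%classic.
  apply/seteqP; split => x /=; rewrite in_itv/= andbT lte_fin absC_indic indicE.
    by move=> [Ax tx]; rewrite (mem_set Ax) mul1r.
  have [/set_mem Ax|_] := boolP (x \in A); first by rewrite mul1r.
  by rewrite mul0r ltNge t0.
rewrite normLooE; have h := ae_le_measureP mu t%:E mE.
by split => [/ess_supP/h//|/h ?]; exact/ess_supP.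
Qed.

Lemma mLoo_gt F A (t : R) : locLoo F -> borel_set A -> precompact A ->
  0 <= t -> t < mLoo F A <-> (0 < mu (A `&` [set x | (t < absC (F x))%R]))%E.
Proof.
move=> lF mA pA t0; have h := normLoo_restrict_le lF mA pA t0.
rewrite measure_gt0; split => [tm|/eqP E0].
  by apply/eqP => /h; rewrite leNgt tm.
by rewrite ltNge; apply/negP => /h.
Qed.

(** The condition says that [x Q] meets a superlevel set of [F] in positive measure, and
    [haar_gt0_open_ltrans] makes this open in [x]. It works for Borel [Q] at once, without a Dynkin
    argument, for which the essential supremum lacks additivity. *)
Lemma mLoo_translate_lsc F Q (t : R) : locLoo F -> borel_set Q -> precompact Q ->
  open [set x : G | t < mLoo F (ltrans x Q)].
Proof.
move=> lF mQ pQ; have mxQ x : borel_set (ltrans x Q) by exact: borel_ltrans.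
have pxQ x : precompact (ltrans x Q) by exact: precompact_ltrans.
have [t0|t0] := ltP t 0.
  rewrite (_ : [set x | _] = setT); first exact: openT.
  apply/seteqP; split => // x _ /=; apply: lt_le_trans t0 _.
  exact: (mC_ge0 normLoo_function_norm).
rewrite openE => x /= /(mLoo_gt lF (mxQ x) (pxQ x) t0) x0.
have [V [nV oV iV]] := unit_nbhd_exists hausG lcG.
have [n1V pV mV] := nV.
have pVQ : precompact (mulset (rtrans x V) Q).
  apply: precompact_mulset => //; have [K cK VK] := (precompactP hausG V).1 pV.
  apply/(precompactP hausG); exists (rtrans x K); first exact: compact_rtrans.
  by move=> y /VK.
have [C cC VQC] := (precompactP hausG _).1 pVQ.
have mC' := borel_compact hausG cC.
(* [F] is measurable inside compact sets only, so the superlevel set is cut by a compact [C]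
   containing [y Q] for all [y] near [x]. *)
pose E := C `&` [set y | t < absC (F y)].
have mE : borel_set E.
  by apply: superlevel_borel => //; exact: (lF C cC).1.
have pE : precompact E by apply/(precompactP hausG); exists C => // y [].
have nx : nbhs x (rtrans x V).
  apply: open_nbhs_nbhs; split; first exact: open_rtrans.
  by rewrite /rtrans/= mulgV; exact: nbhs_singleton.
have xE y : rtrans x V y -> ltrans y Q `&` [set z | t < absC (F z)] = ltrans y Q `&` E.
  move=> Vy; apply/seteqP; split=> z [yQz Ez]; last by case: Ez.
  split => //; split => //; apply: VQC; exists y => //.
have := haar_gt0_open_ltrans hausG haar mQ mE pE.
move=> /(_ x); rewrite -xE; last exact: nbhs_singleton.
move=> /(_ x0); apply: filterS2 nx => y Vy /=.
by rewrite -xE// => /(mLoo_gt lF (mxQ y) (pxQ y) t0).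
Qed.

Lemma mLoo_control_norm F : locLoo F -> control_norm (mLoo F).
Proof.
move=> lF; have fn := normLoo_function_norm; split.
- by move=> A _ _; exact: (mC_ge0 fn).
- exact: (mC_0 fn).
- by move=> A B mA mB pB AB; exact: (mC_le hausG fn).
- by move=> A B mA mB pA pB; exact: (mC_U hausG fn).
- move=> Q mQ pQ; apply/measurable_EFinP; apply: lsc_measurable => t.
  rewrite (_ : [set x | _] = [set x : G | t < mLoo F (ltrans x Q)]).
    exact: mLoo_translate_lsc.
  by apply/seteqP; split => x /=; rewrite lte_fin.
Qed.

End Lebesgue_norms.

Section local_measure_control.
Context {R : realType} {G : topGroupType}.
Hypotheses (hausG : hausdorff_space G) (lcG : locally_compact [set: G]).

Lemma local_measure_control_norm (N : set G -> \bar R) : local_measure N ->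
  locally_regular N -> control_norm (fun A => fine (N A)).
Proof.
move=> locN regN; split.
- by move=> A mA pA; apply: fine_ge0; exact: local_measure_ge0.
- by rewrite (local_measure0 locN).
- move=> A B mA mB pB AB; apply: fine_le; last exact: local_measure_le.
    by apply: local_measure_fin => //; exact: precompact_subset pB.
  exact: local_measure_fin.
- move=> A B mA mB pA pB.
  have fA := local_measure_fin hausG locN mA pA.
  have fB := local_measure_fin hausG locN mB pB.
  rewrite -lee_fin EFinD !fineK//; first exact: local_measureU.
  apply: local_measure_fin => //; last exact: precompactU.
  exact: (@measurableU _ (borel G)).
- move=> Q mQ pQ; apply/measurable_EFinP.
  rewrite (_ : _ \o _ = fun x : borel G => N (ltrans x Q)).
    exact: local_measure_translate_measurable.
  apply/funext => x /=; rewrite fineK//; apply: local_measure_fin => //.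
    exact: borel_ltrans.
  exact: precompact_ltrans.
Qed.

End local_measure_control.

Section L1_control.
Context {R : realType} {G : topGroupType} (mu : {measure set (borel G) -> \bar R}).
Hypotheses (hausG : hausdorff_space G) (lcG : locally_compact [set: G]).
Hypothesis haar : left_haar_measure mu.
Implicit Types (F H : G -> R[i]) (A K : set G).
Local Notation normL1 := (normL1 mu).

Lemma normL1_restrictI F A K :
  normL1 (restrictC (A `&` K) F) =
  (\int[mu]_(x in (A : set (borel G))) (absC (restrictC K F x))%:E)%E.
Proof.
rewrite normL1E [RHS]integral_mkcond; apply: eq_integral => x _.
rewrite patchE !absC_indic indicI /= -mulrA [\1_A x]indicE.
by case: (x \in A); rewrite ?mul1r// !mul0r.
Qed.

Lemma normL1_local_measure F : locC normL1 F ->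
  local_measure (fun A => normL1 (restrictC A F)).
Proof.
move=> lF K cK; have [mF nF] := lF K cK.
have mE : measurable_fun setT (fun x : borel G => (absC (restrictC K F x))%:E).
  by apply/measurable_EFinP; exact: measurable_absC.
have ge0 (x : borel G) : (0 <= (absC (restrictC K F x))%:E)%E by rewrite lee_fin absC_ge0.
have [||E mE' tE mUE|m mP] := @measure_exists R G
  (fun A => \int[mu]_(x in A) (absC (restrictC K F x))%:E)%E.
- by rewrite integral_set0.
- by move=> A; apply: integral_ge0 => x _; exact: ge0.
- rewrite ge0_integral_bigcup//; last exact: measurable_funTS.
  by apply: is_cvg_ereal_nneg_natsum => n _; exact: integral_ge0.
exists m; first by rewrite mP -normL1_restrictI setTI.
by move=> A mA; rewrite mP -normL1_restrictI.
Qed.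

(** Absolute continuity of the integral of [|F|] reduces the claim to inner regularity of [mu] on
    [U]: a compact [L] in [U] leaving little Haar measure uncovered loses less than [N U - t] of the
    integral. *)
Lemma normL1_regular F : locC normL1 F ->
  locally_regular (fun A => normL1 (restrictC A F)).
Proof.
move=> lF U t oU pU tU.
have [K cK UK] := (precompactP hausG U).1 pU; have [mF nF] := lF K cK.
pose f (x : borel G) : R := absC (restrictC K F x).
have NE A : A `<=` K -> normL1 (restrictC A F) = (\int[mu]_(x in (A : set (borel G))) (f x)%:E)%E.
  by move=> AK; rewrite -normL1_restrictI setIidl.
have mf : measurable_fun setT f by exact: measurable_absC.
have f0 x : 0 <= f x by exact: absC_ge0.
have intf : mu.-integrable setT (EFin \o f).
  apply/integrableP; split; first exact/measurable_EFinP.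
  under eq_integral do rewrite /= ger0_norm//.
  by rewrite -normL1E.
have mU := borel_open oU.
have Ufin := restrictC_fin hausG (normL1_function_norm mu) lF mU pU.
pose e := fine (normL1 (restrictC U F)) - t.
have e0 : 0 < e by rewrite subr_gt0 -lte_fin fineK.
have [d [d0 dP]] := integral_normr_continuous intf e0.
have Umu := haar_precompact hausG haar mU pU.
have Ufm : mu U \is a fin_num by rewrite ge0_fin_numE.
have : (mu U - d%:E < mu U)%E by rewrite lteBlDr// lteDl// lte_fin.
rewrite [in X in (_ < X)%E](haar_inner_regular haar oU) => /ereal_sup_gt[_ [L [cL LU] <-] UL].
have mL := borel_compact hausG cL.
exists L; split => //.
have mUL : borel_set (U `\` L) by exact: (@measurableD _ (borel G)).
have ULd : (mu (U `\` L) < d%:E)%E.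
  have Lfm : mu L \is a fin_num by rewrite ge0_fin_numE// (haar_compact haar).
  rewrite -(@lteD2lE _ (mu L))// -lteBlDr//.
  rewrite (_ : mu L + mu (U `\` L) = mu U)%E// -measureU//.
    by congr (mu _); rewrite setDUK.
  by apply/seteqP; split=> // y [Ly [_]].
have := dP _ mUL ULd; rewrite /Rintegral /=.
under eq_integral do rewrite ger0_norm//.
rewrite -NE; last by move=> y [/UK].
have pUL : precompact (U `\` L) by apply: precompact_subset pU => y [].
have pL : precompact L by apply/(precompactP hausG); exists L.
move=> ULe; have := mC_U hausG (normL1_function_norm mu) lF mL mUL pL pUL.
rewrite setDUK// -(fineK (restrictC_fin hausG (normL1_function_norm mu) lF mL pL)) lte_fin.
rewrite /mC; move: ULe; rewrite /e; lra.
Qed.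

Lemma mL1_control_norm F : locC normL1 F -> control_norm (mC normL1 F).
Proof.
move=> lF; apply: (local_measure_control_norm hausG lcG).
  exact: normL1_local_measure.
exact: normL1_regular.
Qed.

End L1_control.

(** * Equivalence of the three conditions *)

Section equivalences.
Context {R : realType} {G : topGroupType} (mu : {measure set (borel G) -> \bar R}).
Hypotheses (hausG : hausdorff_space G) (lcG : locally_compact [set: G]).
Hypothesis haar : left_haar_measure mu.
Context (Y : qspace R G).
Hypothesis hY : quasi_banach_function_space mu Y.
Implicit Types (F H : G -> R[i]) (A K Q U V W : set G).
Local Notation normLoo := (normLoo mu).
Local Notation locLoo := (locC normLoo).
Local Notation mLoo := (mC normLoo).

Lemma equiv_spacesI (D : Type) (S1 S2 : qspace R D) (C1 C2 : R) :
  0 <= C1 -> 0 <= C2 ->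
  (forall F : D -> R[i], qdom S1 F -> 0 <= qnorm S1 F) ->
  (forall F : D -> R[i], qdom S2 F -> 0 <= qnorm S2 F) ->
  (forall F : D -> R[i], qdom S1 F -> qdom S2 F /\ qnorm S2 F <= C1 * qnorm S1 F) ->
  (forall F : D -> R[i], qdom S2 F -> qdom S1 F /\ qnorm S1 F <= C2 * qnorm S2 F) ->
  equiv_spaces S1 S2.
Proof.
move=> C10 C20 n1 n2 h1 h2; split.
  by move=> F; split=> [/h1[]|/h2[]].
(* [C1] and [C2] may be 0 whereas [equiv_spaces] asks for positive constants, hence [+ 1] in
   both. *)
have C2p : 0 < C2 + 1 by rewrite ltr_wpDl.
exists (C2 + 1)^-1, (C1 + 1); split; rewrite ?invr_gt0 ?ltr_wpDl//.
move=> F F1; have [F2 le2] := h1 F F1; have [_ le1] := h2 F F2.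
rewrite ler_pdivrMl//; apply/andP; split.
  by apply: le_trans le1 _; rewrite ler_wpM2r ?n2// lerDl.
by apply: le_trans le2 _; rewrite ler_wpM2r ?n1// lerDl.
Qed.

Lemma normLoo_le H (t : R) : measurable_cfun H ->
  (normLoo H <= t%:E)%E <-> mu [set x | t < absC (H x)] = 0%E.
Proof.
move=> mH; have mE : measurable_fun setT (fun x : borel G => (absC (H x))%:E).
  by apply/measurable_EFinP; exact: measurable_absC.
have -> : [set x | t < absC (H x)] =
    (fun x : borel G => (absC (H x))%:E) @^-1` `]t%:E, +oo[%classic.
  by apply/seteqP; split => x /=; rewrite in_itv/= andbT lte_fin.
rewrite normLooE//; have h := ae_le_measureP mu t%:E mE.
by split => [/ess_supP/h//|/h ?]; exact/ess_supP.
Qed.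

Lemma rtransK z A : rtrans z^-1%g (rtrans z A) = A.
Proof. by apply/seteqP; split=> y; rewrite /rtrans/= invgK mulgK. Qed.

Lemma ltrans_rtrans x z A : ltrans x (rtrans z A) = rtrans z (ltrans x A).
Proof. by rewrite !ltrans_preimage; apply/seteqP; split=> y; rewrite /rtrans/= mulgA. Qed.

Lemma precompact_rtrans z A : precompact A -> precompact (rtrans z A).
Proof.
move=> /(precompactP hausG)[K cK AK]; apply/(precompactP hausG).
by exists (rtrans z K); [exact: compact_rtrans|move=> y /AK].
Qed.

Lemma restrictC_right_translate z F A :
  restrictC A (right_translate z F) = right_translate z (restrictC (rtrans z A) F).
Proof.
apply/funext => y; rewrite /restrictC /right_translate; congr (_ * _).
rewrite !indicE; congr (nat_of_bool _)%:R.
by apply/idP/idP => /set_mem h; apply/mem_set; move: h; rewrite /rtrans/= mulgK.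
Qed.

Lemma measurable_right_translate z F : measurable_cfun F ->
  measurable_cfun (right_translate z F).
Proof.
have mz : measurable_fun setT ((fun y : G => y * z)%g : borel G -> borel G).
  move=> _ A mA; rewrite setTI; apply: borel_preimage => //.
  exact: continuous_mulgr.
by move=> [mF1 mF2]; split; [exact: (measurableT_comp mF1 mz)|exact: (measurableT_comp mF2 mz)].
Qed.

(** The superlevel set of the translate is a right translate of a superlevel set, so a null set goes
    to a null set by [haar_null_rtrans]. The sign of [t] keeps the superlevel set inside [A z],
    hence relatively compact as that lemma demands. *)
Lemma normLoo_right_translate z F A (t : R) : locLoo F -> borel_set A ->
  precompact A -> 0 <= t -> (normLoo (restrictC (rtrans z A) F) <= t%:E)%E ->
  (normLoo (restrictC A (right_translate z F)) <= t%:E)%E.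
Proof.
move=> lF mA pA t0.
have mzA := borel_rtrans z mA; have pzA := precompact_rtrans z pA.
have mF := measurable_restrictC hausG lF mzA pzA.
move=> /(normLoo_le t mF) E0; rewrite restrictC_right_translate.
apply/normLoo_le; first exact: measurable_right_translate.
have -> : [set x | t < absC (right_translate z (restrictC (rtrans z A) F) x)] =
    rtrans z^-1%g [set x | t < absC (restrictC (rtrans z A) F x)].
  by apply/seteqP; split=> y; rewrite /rtrans/right_translate/= invgK.
apply: (haar_null_rtrans hausG lcG haar) => //.
- rewrite -[X in borel_set X]setTI.
  have h := measurable_absC mF (@measurableT _ (borel G)) (measurable_itv `]t, +oo[).
  move: h; congr (measurable _).
  by apply/seteqP; split => x /= [_]; rewrite in_itv/= andbT.
- apply: precompact_subset pzA => y /=; rewrite absC_indic indicE.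
  by case: (boolP (y \in rtrans z A)) => [/set_mem//|_]; rewrite mul0r ltNge t0.
Qed.

Lemma locLoo_right_translate z F : locLoo F -> locLoo (right_translate z F).
Proof.
move=> lF K cK; have czK := compact_rtrans (z := z) cK.
have [mF nF] := lF _ czK.
split; first by rewrite restrictC_right_translate; exact: measurable_right_translate.
have mK := borel_compact hausG cK.
have pK : precompact K by apply/(precompactP hausG); exists K.
have fin := restrictC_fin hausG (normLoo_function_norm haar) lF (borel_rtrans z mK)
  (precompact_rtrans z pK).
apply: (@le_lt_trans _ _ (mLoo F (rtrans z K))%:E); last exact: ltry.
apply: normLoo_right_translate => //; last by rewrite fineK.
exact: (mC_ge0 (normLoo_function_norm haar)).
Qed.

Lemma mLoo_right_translate z F A : locLoo F -> borel_set A -> precompact A ->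
  mLoo (right_translate z F) A <= mLoo F (rtrans z A).
Proof.
move=> lF mA pA; have fn := normLoo_function_norm haar.
rewrite -lee_fin fineK; last by apply: restrictC_fin => //; exact: locLoo_right_translate.
apply: normLoo_right_translate => //; first exact: (mC_ge0 fn).
rewrite fineK//; apply: restrictC_fin => //; first exact: borel_rtrans.
exact: precompact_rtrans.
Qed.

Lemma mLoo_rtrans z F A : locLoo F -> borel_set A -> precompact A ->
  mLoo F (rtrans z A) <= mLoo (right_translate z F) A.
Proof.
move=> lF mA pA.
have := @mLoo_right_translate z^-1%g (right_translate z F) (rtrans z A)
  (locLoo_right_translate z lF) (borel_rtrans z mA) (precompact_rtrans z pA).
rewrite rtransK (_ : right_translate _ (right_translate _ _) = F)//.
by apply/funext => y; rewrite /right_translate mulgVK.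
Qed.

Lemma Linfty_independent_right_invariant :
  amalgam_independent mu Linfty Y -> amalgam_right_invariant mu Y.
Proof.
move=> indep Q nQ z; have [n1Q pQ mQ] := nQ.
have [Q' [nQ' cQ' zQQ' _]] := precompact_unit_nbhd hausG nQ (precompact_rtrans z pQ).
have [n1Q' pQ' mQ'] := nQ'.
have [dom [c [C [c0 C0 cC]]]] := indep Q Q' nQ nQ'.
exists C => F FQ; have [lF FQ'] := (dom F).1 FQ.
have lzF := locLoo_right_translate z lF.
have [|||YzF lezF] := @solid_le R G mu Y hY (fun x => mLoo F (ltrans x Q'))
    (fun x => mLoo (right_translate z F) (ltrans x Q)) 1 FQ'.
- exact: (cn_measurable (mLoo_control_norm hausG lcG haar lzF)).
- exact: ler01.
- move=> x; rewrite mul1r (mC_ge0 (normLoo_function_norm haar))/=.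
  have mxQ := borel_ltrans x mQ; have pxQ := precompact_ltrans hausG x pQ.
  apply: le_trans (mLoo_right_translate z lF mxQ pxQ) _.
  rewrite -ltrans_rtrans.
  apply: (mC_le hausG (normLoo_function_norm haar) lF).
  + by apply: borel_ltrans; exact: borel_rtrans.
  + exact: borel_ltrans.
  + exact: precompact_ltrans.
  + exact: ltransS.
split; first by split.
rewrite mul1r in lezF; apply: le_trans lezF _.
by have /andP[] := cC F FQ.
Qed.

Lemma cfunD (T : Type) (f g : T -> R) :
  cfun (fun x => f x + g x) = (fun x => cfun f x + cfun g x).
Proof. by apply/funext => x; rewrite /cfun rmorphD. Qed.

Lemma qnorm0 : qnorm Y (fun=> 0) = 0.
Proof.
have qn := qbfs_quasinormed hY.
by apply/(qn_eq0 qn); [exact: (qn_dom0 qn)|exact: aeW].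
Qed.

(** The quasi-triangle inequality is used once per element of [s], so the constant depends on the
    list and the window but not on [F]. *)
Lemma right_invariant_sum Q (s : seq G) : right_invariant (amalgam mu Linfty Y Q) ->
  exists2 C : R, 0 <= C & forall F, qdom (amalgam mu Linfty Y Q) F ->
    let f x := \sum_(z <- s) mLoo (right_translate z F) (ltrans x Q) in
    qdom Y (cfun f) /\ qnorm Y (cfun f) <= C * qnorm (amalgam mu Linfty Y Q) F.
Proof.
move=> rinv; have qn := qbfs_quasinormed hY; elim: s => [|z s [C C0 IH]].
  exists 0 => // F FQ f; rewrite (_ : cfun f = fun=> 0).
    by rewrite qnorm0 mul0r; split => //; exact: (qn_dom0 qn).
  by apply/funext => x; rewrite /cfun /f big_nil.
have [Cz Czh] := rinv z; have [T Th] := qn_triangle qn.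
(* The constants of the quasi-triangle inequality and of right invariance come without a sign, hence
   the absolute values. *)
exists (`|T| * (`|Cz| + C)); first by rewrite mulr_ge0// addr_ge0.
move=> F FQ f; have [fsY fsle] := IH F FQ; have [[lzF zFY] zFle] := Czh F FQ.
rewrite (_ : f = fun x => mLoo (right_translate z F) (ltrans x Q) +
  \sum_(z <- s) mLoo (right_translate z F) (ltrans x Q)); last first.
  by apply/funext => x; rewrite /f big_cons.
rewrite cfunD; split; first exact: (qn_domD qn).
have n0 : 0 <= qnorm (amalgam mu Linfty Y Q) F by apply: (qn_ge0 qn); case: FQ.
apply: le_trans (Th _ _ zFY fsY) _.
set a := qnorm Y _ in zFle *; set b := qnorm Y _ in fsle *.
have a0 : 0 <= a by exact: (qn_ge0 qn).
have b0 : 0 <= b by exact: (qn_ge0 qn).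
apply: (@le_trans _ _ (`|T| * (a + b))).
  by rewrite ler_wpM2r ?addr_ge0// ler_norm.
rewrite -mulrA ler_wpM2l// mulrDl lerD//.
by apply: le_trans zFle _; rewrite ler_wpM2r// ler_norm.
Qed.

Lemma right_invariant_Linfty_independent :
  amalgam_right_invariant mu Y -> amalgam_independent mu Linfty Y.
Proof.
move=> rinv; have qn := qbfs_quasinormed hY.
suff main Q Q' : unit_nbhd Q -> unit_nbhd Q' -> exists2 C : R, 0 <= C &
    forall F, qdom (amalgam mu Linfty Y Q) F -> qdom (amalgam mu Linfty Y Q') F /\
      qnorm (amalgam mu Linfty Y Q') F <= C * qnorm (amalgam mu Linfty Y Q) F.
  move=> Q Q' nQ nQ'.
  have [C1 C10 h1] := main Q Q' nQ nQ'; have [C2 C20 h2] := main Q' Q nQ' nQ.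
  apply: equiv_spacesI h1 h2 => //.
    by move=> F [_ FQ]; exact: (qn_ge0 qn).
  by move=> F [_ FQ]; exact: (qn_ge0 qn).
move=> nQ nQ'; have [n1Q pQ mQ] := nQ; have [n1Q' pQ' mQ'] := nQ'.
have := n1Q; rewrite nbhsE => -[V [oV V1] VQ].
have [K cK QK] := (precompactP hausG Q').1 pQ'.
have [s sP] := compact_cover_rtrans cK oV V1.
have [C C0 Ch] := right_invariant_sum s (rinv Q nQ).
exists C => // F FQ; have [fY fle] := Ch F FQ; have [lF _] := FQ.
have mxQ x : borel_set (ltrans x Q) by exact: borel_ltrans.
have pxQ x : precompact (ltrans x Q) by exact: precompact_ltrans.
have cn := mLoo_control_norm hausG lcG haar lF.
have [|||FQ'Y leF] := @solid_le R G mu Y hY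
    (fun x => \sum_(z <- s) mLoo (right_translate z F) (ltrans x Q))
    (fun x => mLoo F (ltrans x Q')) 1 fY.
- exact: (cn_measurable cn).
- exact: ler01.
- move=> x; rewrite mul1r (mC_ge0 (normLoo_function_norm haar))/=.
  apply: (@le_trans _ _ (\sum_(z <- s) mLoo F (rtrans z (ltrans x Q)))); last first.
    by apply: ler_sum => z _; exact: mLoo_rtrans.
  apply: (cn_cover hausG cn) => //.
  + exact: borel_ltrans.
  + exact: precompact_ltrans.
  + by move=> z _; exact: borel_rtrans.
  + by move=> z _; exact: precompact_rtrans.
  + move=> y /ltransP/QK/sP[z zs Vz]; exists z => //.
    by rewrite -ltrans_rtrans; apply/ltransP; exact: VQ.
split; first by split.
by rewrite mul1r in leF; exact: le_trans leF fle.
Qed.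

(** * Step functions over a relatively separated family *)

Section step_function.
Context (I : choiceType) (X : I -> G).
Hypothesis sepX : relatively_separated X.
Variables (a : I -> R) (V : set G).
Hypotheses (a0 : forall i, 0 <= a i) (nV : unit_nbhd V).

Lemma synth_step_le A B x y : precompact A -> precompact B ->
  (forall i, ltrans (X i) A x -> ltrans (X i) B y) -> synth X a A x <= synth X a B y.
Proof.
move=> pA pB AB; rewrite -lee_fin !EFin_synth//.
apply: le_esum => i _; rewrite lee_fin ler_wpM2l// !indicE.
have [/set_mem/AB xB|_] := boolP (x \in _); last by rewrite ler0n.
by rewrite (mem_set xB).
Qed.

Lemma absC_restrict_synth A x : absC (restrictC A (cfun (synth X a V)) x) =
  \1_A x * synth X a V x.
Proof. by rewrite absC_indic absC_real ger0_norm// synth_ge0. Qed.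

Lemma normLoo_synth_le A (t : R) : borel_set A -> 0 <= t ->
  (forall x, A x -> synth X a V x <= t) ->
  (normLoo (restrictC A (cfun (synth X a V))) <= t%:E)%E.
Proof.
have [_ pV mV] := nV.
move=> mA t0 At; apply/normLoo_le.
  apply: measurable_cfun_indic => //; apply: measurable_cfun_real.
  exact: synth_measurable.
rewrite (_ : [set x | _] = set0) ?measure0//.
apply/seteqP; split=> // x /=; rewrite absC_restrict_synth indicE.
have [/set_mem/At|_] := boolP (x \in A); last by rewrite mul0r ltNge t0.
by rewrite mul1r leNgt => /negbTE ->.
Qed.

(** For [x] in [K], [x] in [x_i V] implies [1] in [x_i V K^-1]. So the value at the identity of the
    sum with window [V K^-1] bounds the step function on all of [K]. *)
Lemma locLoo_synth : locLoo (cfun (synth X a V)).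
Proof.
have [_ pV mV] := nV.
move=> K cK; have mK := borel_compact hausG cK; split.
  apply: measurable_cfun_indic => //; apply: measurable_cfun_real.
  exact: synth_measurable.
have pVK : precompact (mulset V (invset K)).
  apply: precompact_mulset => //; apply: precompact_invset => //.
  by apply/(precompactP hausG); exists K.
apply: (@le_lt_trans _ _ (synth X a (mulset V (invset K)) 1%g)%:E); last exact: ltry.
apply: normLoo_synth_le => //; first exact: synth_ge0.
move=> x Kx; apply: synth_step_le => // i /ltransP Vx; apply/ltransP.
exists ((X i)^-1 * x)%g => //; exists x^-1%g; first by rewrite /invset/= invgK.
by rewrite mulgK mulg1.
Qed.

Lemma mLoo_synth_le Q Q1 x : borel_set Q1 -> precompact Q1 -> precompact Q ->
  mulset V (invset Q1) `<=` Q ->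
  mLoo (cfun (synth X a V)) (ltrans x Q1) <= synth X a Q x.
Proof.
have [_ pV mV] := nV.
move=> mQ1 pQ1 pQ VQ; have mxQ := borel_ltrans x mQ1.
have pxQ := precompact_ltrans hausG x pQ1.
rewrite -lee_fin fineK; last first.
  by apply: (restrictC_fin hausG (normLoo_function_norm haar)) => //; exact: locLoo_synth.
apply: normLoo_synth_le => //; first exact: synth_ge0.
move=> y /ltransP xy; apply: synth_step_le => // i /ltransP iy; apply/ltransP; apply: VQ.
exists ((X i)^-1 * y)%g => //; exists (y^-1 * x)%g.
  by rewrite /invset/= invgM invgK.
by rewrite mulgA mulgK.
Qed.

(** The step function is at least [a i] on [x_i V], a set of positive Haar measure inside [x Q2], so
    the essential supremum there cannot be smaller. *)
Lemma le_mLoo_synth Q2 x i : borel_set Q2 -> precompact Q2 ->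
  ltrans (X i) V `<=` ltrans x Q2 ->
  a i <= mLoo (cfun (synth X a V)) (ltrans x Q2).
Proof.
have [_ pV mV] := nV.
move=> mQ2 pQ2 VQ; rewrite leNgt; apply/negP => lt_ai.
have mxQ := borel_ltrans x mQ2; have pxQ := precompact_ltrans hausG x pQ2.
have m0 := mC_ge0 (normLoo_function_norm haar) (cfun (synth X a V)) (ltrans x Q2).
have := (normLoo_restrict_le hausG haar locLoo_synth mxQ pxQ m0).1 (lexx _).
apply/eqP; rewrite -measure_gt0; apply: (@lt_le_trans _ _ (mu (ltrans (X i) V))).
  by rewrite (haar_invariant haar)//; exact: haar_unit_nbhd_gt0.
apply: le_borel_measure.
- exact: borel_ltrans.
- apply: superlevel_borel => //.
  exact: (measurable_restrictC hausG locLoo_synth).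
move=> y iy; split; first exact: VQ.
apply: (lt_le_trans lt_ai); rewrite /cfun absC_real ger0_norm ?synth_ge0//.
by rewrite -lee_fin EFin_synth//; exact: le_translate_sum.
Qed.

End step_function.

(** For the step function [F] with steps on [x_i V], the inclusion of [V V^-1] in [Q] bounds the
    [V]-amalgam norm of [F] by the norm in [Y_d(X, Q)]. Passing to [Q2], which contains [Q'^-1 V],
    makes every [x_i V] with [x] in [x_i Q'] part of [x Q2], and the coefficients are read off from
    the essential suprema. *)
Lemma Linfty_independent_seq_space :
  amalgam_independent mu Linfty Y -> seq_space_independent Y.
Proof.
move=> indep I X sepX; have qn := qbfs_quasinormed hY.
have absE (l : I -> R[i]) Q :
    synthesis X Q l = cfun (synth X (fun i => absC (l i)) Q) by [].
suff main Q Q' : unit_nbhd Q -> unit_nbhd Q' -> exists2 C : R, 0 <= C &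
    forall l, qdom (seq_space Y X Q) l -> qdom (seq_space Y X Q') l /\
      qnorm (seq_space Y X Q') l <= C * qnorm (seq_space Y X Q) l.
  move=> Q Q' nQ nQ'.
  have [C1 C10 h1] := main Q Q' nQ nQ'; have [C2 C20 h2] := main Q' Q nQ' nQ.
  apply: equiv_spacesI h1 h2 => //.
    by move=> l lQ; exact: (qn_ge0 qn).
  by move=> l lQ; exact: (qn_ge0 qn).
move=> nQ nQ'; have [n1Q pQ mQ] := nQ; have [n1Q' pQ' mQ'] := nQ'.
have [V [nV oV iV VQ]] := small_unit_nbhd hausG lcG n1Q.
have [_ pV mV] := nV.
have pQV : precompact (mulset (invset Q') V).
  by apply: precompact_mulset => //; exact: precompact_invset.
have [Q2 [nQ2 cQ2 QVQ2 _]] := precompact_unit_nbhd hausG nV pQV.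
have [_ pQ2 mQ2] := nQ2.
have [dom [c [C [c0 C0 cC]]]] := indep V Q2 nV nQ2.
have [C1 [C10 C1P]] := @synth_le R G hausG I X sepX _ pQ'.
exists (C1 * C); first by rewrite mulr_ge0// ltW.
move=> l lQ; pose a i := absC (l i); have a0 i : 0 <= a i by exact: absC_ge0.
pose F := cfun (synth X a V).
have lF : locLoo F by exact: locLoo_synth.
have cn := mLoo_control_norm hausG lcG haar lF.
have [|||FVY leFV] := @solid_le R G mu Y hY (synth X a Q)
    (fun x => mLoo F (ltrans x V)) 1 lQ.
- exact: (cn_measurable cn).
- exact: ler01.
- move=> x; rewrite mul1r (mC_ge0 (normLoo_function_norm haar))/=.
  by apply: mLoo_synth_le => //; rewrite iV.
have FV : qdom (amalgam mu Linfty Y V) F by split.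
have [_ FQ2] := (dom F).1 FV.
have /andP[_ leFQ2] := cC F FV.
have [|||sY les] := @solid_le R G mu Y hY (fun x => mLoo F (ltrans x Q2))
    (synth X a Q') C1 FQ2.
- exact: synth_measurable.
- exact: C10.
- move=> x; rewrite synth_ge0//=; apply: C1P => //.
    exact: (mC_ge0 (normLoo_function_norm haar)).
  move=> i /ltransP ix; apply: le_mLoo_synth => // y /ltransP iy; apply/ltransP.
  apply: QVQ2; exists (x^-1 * X i)%g; first by rewrite /invset/= invgM invgK.
  by exists ((X i)^-1 * y)%g => //; rewrite mulgA mulgK.
split => //; apply: le_trans les _; rewrite -mulrA ler_wpM2l//.
apply: le_trans leFQ2 _; rewrite ler_wpM2l ?(ltW C0)//.
by rewrite mul1r in leFV; exact: leFV.
Qed.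

End equivalences.

(** The suprema are taken one variable at a time, by subtraction, so infinite values have to be
    excluded beforehand. *)
Lemma ereal_supD_le {R : realType} (S1 S2 : set \bar R) (b : \bar R) :
  (forall x, S1 x -> -oo < x)%E -> (forall y, S2 y -> -oo < y)%E ->
  S1 !=set0 -> S2 !=set0 ->
  (forall x y, S1 x -> S2 y -> (x + y <= b)%E) -> (ereal_sup S1 + ereal_sup S2 <= b)%E.
Proof.
move=> S10 S20 [x0 S1x0] [y0 S2y0] S12.
have [->|b_fin] := eqVneq b +oo%E; first by rewrite leey.
have bNoo : (-oo < b)%E.
  apply: lt_le_trans (S12 _ _ S1x0 S2y0).
  by rewrite ltNye adde_eq_ninfty negb_or -!ltNye S10// S20.
have {bNoo}b_fin : b \is a fin_num by case: b b_fin bNoo {S12}.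
have fin1 x : S1 x -> x \is a fin_num.
  move=> S1x; have := S12 _ _ S1x S2y0; have := S10 _ S1x; have := S20 _ S2y0.
  by case: b {S12} b_fin => // b _; case: x {S1x} => // ; case: y0 {S2y0}.
have s2 x : S1 x -> (x + ereal_sup S2 <= b)%E.
  move=> S1x; rewrite addeC -leeBrDr ?fin1//; apply: ge_ereal_sup => y S2y.
  by rewrite leeBrDr ?fin1// addeC S12.
have fin2 : ereal_sup S2 \is a fin_num.
  have lb : (-oo < ereal_sup S2)%E.
    exact: lt_le_trans (S20 _ S2y0) (ereal_sup_ubound S2y0).
  have := s2 _ S1x0; have := fin1 _ S1x0; move: lb.
  by case: b {S12 s2} b_fin => // b _; case: x0 {S1x0} => // x0; case: (ereal_sup S2).
rewrite -leeBrDr//; apply: ge_ereal_sup => x S1x.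
by rewrite leeBrDr// s2.
Qed.

(** * Complex measures *)

Section superadditive.
Context {R : realType} {G : topGroupType}.
Local Open Scope ereal_scope.
Implicit Types (f : set (borel G) -> \bar R) (A B : set (borel G)).

Lemma superadditive_le f A B : (forall A, 0 <= f A) ->
  (forall A B, measurable A -> measurable B -> A `&` B = set0 ->
    f A + f B <= f (A `|` B)) ->
  measurable A -> measurable B -> A `<=` B -> f A <= f B.
Proof.
move=> f0 fU mA mB AB; rewrite -(setDUK AB).
apply: le_trans (fU A (B `\` A) _ _ _) => //.
- by rewrite leeDl.
- exact: measurableD.
- by apply/seteqP; split=> // y [Ay [_]].
Qed.

Lemma measure_of_superadditive f : (forall A, 0 <= f A) -> f set0 = 0 ->
  (forall A B, measurable A -> measurable B -> A `&` B = set0 ->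
    f A + f B <= f (A `|` B)) ->
  (forall F : nat -> set (borel G), (forall n, measurable (F n)) ->
    trivIset setT F -> f (\bigcup_n F n) <= \sum_(0 <= n <oo) f (F n)) ->
  exists m : {measure set (borel G) -> \bar R}, forall A, m A = f A.
Proof.
move=> f0 f00 fU fsub; apply: measure_exists => // F mF tF mUF.
have fin n : \sum_(0 <= k < n) f (F k) <= f (\big[setU/set0]_(k < n) F k).
  elim: n => [|n IH]; first by rewrite big_nil big_ord0 f00.
  rewrite big_nat_recr//= big_ord_recr/=; apply: le_trans (leeD2r _ IH) _.
  apply: fU => //; first exact: bigsetU_measurable.
  apply/seteqP; split=> // y []; rewrite -(bigcup_mkord n F) => -[k /= kn Fk] Fn.
  by move: (tF k n I I (ex_intro _ y (conj Fk Fn))) kn => ->; rewrite ltnn.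
have -> : f (\bigcup_n F n) = \sum_(0 <= n <oo) f (F n).
  apply/eqP; rewrite eq_le fsub//=.
  apply: lime_le; first exact: is_cvg_nneseries.
  apply: nearW => n; apply: le_trans (fin n) _; apply: superadditive_le => //.
    exact: bigsetU_measurable.
  by rewrite -(bigcup_mkord n F) => y [k _ Fk]; exists k.
exact: is_cvg_ereal_nneg_natsum.
Qed.

End superadditive.

(** * Total variation of set functions *)

Section variation.
Context {R : realType} {G : topGroupType}.
Local Open Scope ereal_scope.
Implicit Types (nu : set G -> R[i]) (A B S : set G).

Lemma le_variation nu S (F : nat -> set G) : borel_set S ->
  (forall n, borel_set (F n)) -> trivIset setT F -> (forall n, F n `<=` S) ->
  \sum_(n <oo) (absC (nu (F n)))%:E <= measure_variation nu S.
Proof.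
move=> mS mF tF FS.
have g0 A : 0 <= (absC (nu A))%:E by rewrite lee_fin absC_ge0.
(* What the [F k] leave uncovered is put in front as piece 0, which turns a disjoint family in [S]
   into a partition of [S]. *)
pose B n := if n is k.+1 then F k else S `\` \bigcup_k F k.
have mUF : borel_set (\bigcup_k F k) by apply: bigcup_measurable => k _; exact: mF.
have PB : [/\ forall n, borel_set (B n), trivIset setT B & \bigcup_n B n = S].
  split.
  - by case=> [|n]; [exact: (@measurableD _ (borel G))|exact: mF].
  - move=> [|i] [|j] _ _ [y [/= Bi Bj]] //.
    + by case: Bi => _; case; exists j.
    + by case: Bj => _; case; exists i.
    + by congr _.+1; apply: tF => //; exists y.
  - apply/seteqP; split=> [y [[|n] _ /=]|y Sy]; first by case.
      exact: FS.
    have [[k _ Fk]|nF] := pselect ((\bigcup_k F k) y); first by exists k.+1.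
    by exists 0%N.
apply: le_trans (ereal_sup_ubound _); last by exists B.
apply: lime_le; first exact: is_cvg_nneseries.
apply: nearW => n; apply: le_trans (nneseries_lim_ge n.+1 _) => //.
by rewrite big_nat_recl//= leeDr.
Qed.

Lemma absC_le_variation nu A S : borel_set S -> borel_set A -> A `<=` S ->
  nu set0 = 0%R -> (absC (nu A))%:E <= measure_variation nu S.
Proof.
move=> mS mA AS nu0.
have := @le_variation nu S (fun n => if n is 0%N then A else set0) mS.
move=> /(_ _ _ _)/le_trans h; apply: (le_trans _ (h _ _ _ _ (lexx _))).
- apply: le_trans (nneseries_lim_ge 1%N _) => //; first by rewrite big_nat1.
  by move=> n _ _; rewrite lee_fin absC_ge0.
- by case=> [|n]; [|exact: (@measurable0 _ (borel G))].
- by move=> [|i] [|j] _ _ [y []].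
- by case=> [|n].
Qed.

Lemma variation_le_bound nu S (b : \bar R) :
  (forall F : nat -> set G, (forall n, borel_set (F n)) -> trivIset setT F ->
    \bigcup_n F n = S -> \sum_(n <oo) (absC (nu (F n)))%:E <= b) ->
  measure_variation nu S <= b.
Proof. by move=> h; apply: ge_ereal_sup => _ [F [mF tF FS] <-]; exact: h. Qed.

Lemma variation_ge0 nu S : borel_set S -> 0 <= measure_variation nu S.
Proof.
move=> mS; apply: le_trans (@le_variation nu S (fun=> set0) mS _ _ _).
- by apply: nneseries_ge0 => n _ _; rewrite lee_fin absC_ge0.
- by move=> n; exact: (@measurable0 _ (borel G)).
- by move=> i j _ _ [y []].
- by move=> n; exact: sub0set.
Qed.

Lemma le_variationS nu A S : borel_set A -> borel_set S -> A `<=` S ->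
  measure_variation nu A <= measure_variation nu S.
Proof.
move=> mA mS AS; apply: variation_le_bound => F mF tF FA; apply: le_variation => //.
by move=> n; apply: subset_trans AS; rewrite -FA; exact: bigcup_sup.
Qed.

Lemma variation_superadditive nu A B : borel_set A -> borel_set B -> A `&` B = set0 ->
  measure_variation nu A + measure_variation nu B <= measure_variation nu (A `|` B).
Proof.
move=> mA mB AB.
have g0 E : 0 <= (absC (nu E))%:E by rewrite lee_fin absC_ge0.
have mAB : borel_set (A `|` B) by exact: (@measurableU _ (borel G)).
have key (P Q : nat -> set G) : (forall n, borel_set (P n)) -> trivIset setT P ->
    (forall n, P n `<=` A) ->
    (forall n, borel_set (Q n)) -> trivIset setT Q -> (forall n, Q n `<=` B) ->
    \sum_(n <oo) (absC (nu (P n)))%:E + \sum_(n <oo) (absC (nu (Q n)))%:E <=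
    measure_variation nu (A `|` B).
  move=> mP tP PA mQ tQ QB; rewrite -nneseriesD//.
  (* The two families are interleaved by parity, so that the first [2n] terms of the new series are
     the first [n] terms of each. *)
  pose C n := if odd n then Q n./2 else P n./2.
  have : \sum_(n <oo) (absC (nu (C n)))%:E <= measure_variation nu (A `|` B).
    apply: le_variation => //.
    - by move=> n; rewrite /C; case: ifP.
    - move=> i j _ _ [y []]; rewrite /C.
      case: ifP => oi; case: ifP => oj Ci Cj.
      + by rewrite -(odd_double_half i) -(odd_double_half j) oi oj (tQ i./2 j./2 I I)//; exists y.
      + have : (A `&` B) y by split; [exact: PA Cj|exact: QB Ci].
        by rewrite AB.
      + have : (A `&` B) y by split; [exact: PA Ci|exact: QB Cj].
        by rewrite AB.
      + by rewrite -(odd_double_half i) -(odd_double_half j) oi oj (tP i./2 j./2 I I)//; exists y.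
    - by move=> n; rewrite /C; case: ifP => _; [apply: subset_trans (QB _) _; exact: subsetUr
        |apply: subset_trans (PA _) _; exact: subsetUl].
  apply: le_trans; apply: lime_le; first by apply: is_cvg_nneseries => *; exact: adde_ge0.
  apply: nearW => n; apply: le_trans (nneseries_lim_ge n.*2 _) => //.
  rewrite le_eqVlt; apply/orP; left; apply/eqP.
  elim: n => [|n IH]; first by rewrite !big_nil.
  rewrite doubleS !big_nat_recr//= IH -addeA; congr (_ + _).
  by rewrite /C/= odd_double/= uphalf_double doubleK.
have triv (E : set G) : borel_set E -> [set A : nat -> set G |
    [/\ forall n, borel_set (A n), trivIset setT A & \bigcup_n A n = E]] !=set0.
  move=> mE; exists (fun n => if n is 0%N then E else set0); split.
  - by case=> [|n] //; exact: (@measurable0 _ (borel G)).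
  - by move=> [|i] [|j] _ _ [y []].
  - apply/seteqP; split=> [y [[|n] _ //]|y Ey]; by exists 0%N.
apply: ereal_supD_le.
- by move=> _ [P _ <-]; apply: lt_le_trans (ltNyr 0) _; exact: nneseries_ge0.
- by move=> _ [Q _ <-]; apply: lt_le_trans (ltNyr 0) _; exact: nneseries_ge0.
- by have [P PA] := triv A mA; eexists; exists P.
- by have [P PA] := triv B mB; eexists; exists P.
move=> _ _ [P [mP tP PA] <-] [Q [mQ tQ QB] <-]; apply: key => //.
  by move=> n; rewrite -PA; exact: bigcup_sup.
by move=> n; rewrite -QB; exact: bigcup_sup.
Qed.

End variation.

Section complex_measures.
Context {R : realType} {G : topGroupType}.
Local Open Scope ereal_scope.
Implicit Types (nu : set G -> R[i]) (r : set G -> R) (A B S : set G).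

Lemma real_measure0 r : is_real_measure r -> r set0 = 0%R.
Proof.
move=> [c cE]; have := cE set0 (@measurable0 _ (borel G)).
by rewrite charge0 => -[].
Qed.

Lemma real_measureU r A B : is_real_measure r -> borel_set A -> borel_set B ->
  A `&` B = set0 -> r (A `|` B) = (r A + r B)%R.
Proof.
move=> [c cE] mA mB AB; have mAB : borel_set (A `|` B) by exact: (@measurableU _ (borel G)).
by have := chargeU c mA mB AB; rewrite !cE// -EFinD => -[].
Qed.

Lemma real_measure_cvg r (F : nat -> set G) : is_real_measure r ->
  (forall n, borel_set (F n)) -> trivIset setT F ->
  ((fun n => \sum_(0 <= k < n) r (F k))%R @ \oo --> r (\bigcup_n F n)).
Proof.
move=> [c cE] mF tF.
have mU : borel_set (\bigcup_n F n) by apply: bigcup_measurable => k _; exact: mF.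
have := @charge_semi_sigma_additive _ _ _ c F mF tF mU.
rewrite cE//; under eq_fun do under eq_bigr do rewrite cE//.
under eq_fun do rewrite sumEFin.
by move=> /fine_cvgP[].
Qed.

Lemma real_measureD r1 r2 : is_real_measure r1 -> is_real_measure r2 ->
  is_real_measure (fun A => r1 A + r2 A)%R.
Proof.
move=> [c1 c1E] [c2 c2E]; exists (cadd c1 c2) => A mA.
by rewrite -[LHS]/(c1 A + c2 A) c1E// c2E.
Qed.

Lemma real_measureZ (a : R) r : is_real_measure r ->
  is_real_measure (fun A => a * r A)%R.
Proof.
move=> [c cE]; exists (cscale a c) => A mA.
by rewrite -[LHS]/(a%:E * c A) cE.
Qed.

Lemma real_measure_cst0 : is_real_measure (fun _ : set G => 0%R : R).
Proof. by exists czero => A mA. Qed.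

Definition complex_measure nu : Prop :=
  is_real_measure (fun A => reC (nu A)) /\ is_real_measure (fun A => imC (nu A)).

Lemma absC_sqrt (z : R[i]) : absC z = Num.sqrt (reC z ^+ 2 + imC z ^+ 2)%R.
Proof. by case: z. Qed.

Lemma absC_le_ReIm (z : R[i]) : (absC z <= `|reC z| + `|imC z|)%R.
Proof.
rewrite absC_sqrt -[leRHS]ger0_norm ?addr_ge0// -sqrtr_sqr ler_wsqrtr//.
by rewrite sqrrD !real_normK ?num_real// lerD2r lerDl mulrn_wge0// mulr_ge0.
Qed.

Lemma normr_reC_le (z : R[i]) : (`|reC z| <= absC z)%R.
Proof. by rewrite absC_sqrt -sqrtr_sqr ler_wsqrtr// lerDl sqr_ge0. Qed.

Lemma normr_imC_le (z : R[i]) : (`|imC z| <= absC z)%R.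
Proof. by rewrite absC_sqrt -sqrtr_sqr ler_wsqrtr// lerDr sqr_ge0. Qed.

Lemma complex_eq (z w : R[i]) : reC z = reC w -> imC z = imC w -> z = w.
Proof. by case: z w => [a b] [c d] /= -> ->. Qed.

Lemma reCD (z w : R[i]) : reC (z + w)%R = (reC z + reC w)%R.
Proof. by case: z w => [a b] [c d]. Qed.

Lemma imCD (z w : R[i]) : imC (z + w)%R = (imC z + imC w)%R.
Proof. by case: z w => [a b] [c d]. Qed.

Lemma reCM (z w : R[i]) : reC (z * w)%R = (reC z * reC w - imC z * imC w)%R.
Proof. by case: z w => [a b] [c d]. Qed.

Lemma imCM (z w : R[i]) : imC (z * w)%R = (reC z * imC w + imC z * reC w)%R.
Proof. by case: z w => [a b] [c d]. Qed.

Lemma complex_measure0 nu : complex_measure nu -> nu set0 = 0%R.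
Proof.
by move=> [mre mim]; apply: complex_eq; [exact: (real_measure0 mre)|exact: (real_measure0 mim)].
Qed.

Lemma complex_measureD nu1 nu2 : complex_measure nu1 -> complex_measure nu2 ->
  complex_measure (fun A => nu1 A + nu2 A)%R.
Proof.
move=> [re1 im1] [re2 im2]; split.
  have -> : (fun A => reC (nu1 A + nu2 A)%R) = (fun A => reC (nu1 A) + reC (nu2 A))%R.
    by apply/funext => A; exact: reCD.
  exact: real_measureD.
have -> : (fun A => imC (nu1 A + nu2 A)%R) = (fun A => imC (nu1 A) + imC (nu2 A))%R.
  by apply/funext => A; exact: imCD.
exact: real_measureD.
Qed.

Lemma complex_measureZ (c : R[i]) nu : complex_measure nu ->
  complex_measure (fun A => c * nu A)%R.
Proof.
move=> [mre mim]; split.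
  have -> : (fun A => reC (c * nu A)%R) =
      (fun A => reC c * reC (nu A) + (- imC c) * imC (nu A))%R.
    by apply/funext => A; rewrite reCM mulNr.
  by apply: real_measureD; exact: real_measureZ.
have -> : (fun A => imC (c * nu A)%R) =
    (fun A => reC c * imC (nu A) + imC c * reC (nu A))%R.
  by apply/funext => A; exact: imCM.
by apply: real_measureD; exact: real_measureZ.
Qed.

(** Real and imaginary parts converge separately; the inequality holds for the partial sums and
    passes to the limit by continuity of the modulus. *)
Lemma complex_measure_bigcup_le nu (F : nat -> set G) : complex_measure nu ->
  (forall n, borel_set (F n)) -> trivIset setT F ->
  (absC (nu (\bigcup_n F n)))%:E <= \sum_(n <oo) (absC (nu (F n)))%:E.
Proof.
move=> [mre mim] mF tF; set s := \sum_(n <oo) _.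
have s0 : 0 <= s by apply: nneseries_ge0 => n _ _; rewrite lee_fin absC_ge0.
have [->|sfin] := eqVneq s +oo; first by rewrite leey.
have {}sfin : s \is a fin_num by rewrite ge0_fin_numE// lt_neqAle sfin leey.
have cre := real_measure_cvg mre mF tF; have cim := real_measure_cvg mim mF tF.
set a := (fun n => _) in cre; set b := (fun n => _) in cim.
have ab n : (absC (a n +i* b n) <= \sum_(0 <= k < n) absC (nu (F k)))%R.
  elim: n => [|n IH].
    by rewrite /a /b !big_nil /absC /= expr0n/= addr0 sqrtr0.
  have -> : a n.+1 +i* b n.+1 = ((a n +i* b n) + nu (F n))%R.
    by apply: complex_eq; rewrite ?reCD ?imCD /a /b /= big_nat_recr.
  rewrite big_nat_recr//=; apply: le_trans (absC_le_add _ _) _.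
  by rewrite lerD2r.
have abs n : (absC (a n +i* b n) <= fine s)%R.
  apply: le_trans (ab n) _; rewrite -lee_fin fineK// -sumEFin.
  by apply: nneseries_lim_ge => k _ _; rewrite lee_fin absC_ge0.
rewrite -(fineK sfin) lee_fin.
have cabs : (fun n => absC (a n +i* b n)) @ \oo --> absC (nu (\bigcup_n F n)).
  rewrite absC_sqrt (_ : (fun n => _) = Num.sqrt \o (fun n => a n ^+ 2 + b n ^+ 2)%R).
    apply: cvg_comp; last exact: sqrt_continuous.
    by apply: cvgD; rewrite !expr2; apply: cvgM.
  by apply/funext => n; rewrite absC_sqrt.
rewrite -(cvg_lim _ cabs)//; apply: limr_le; first by apply/cvg_ex; eexists; exact: cabs.
exact: nearW.
Qed.

(** A partition of the union is refined by the sets [A k], and the resulting non-negative double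
    series is summed in the other order. *)
Lemma variation_bigcup_le nu (A : nat -> set G) : complex_measure nu ->
  (forall n, borel_set (A n)) -> trivIset setT A ->
  measure_variation nu (\bigcup_n A n) <= \sum_(n <oo) measure_variation nu (A n).
Proof.
move=> cm mA tA; apply: variation_le_bound => F mF tF FA.
have g0 B : 0 <= (absC (nu B))%:E by rewrite lee_fin absC_ge0.
have mFA i j : borel_set (F i `&` A j).
  exact: (@measurableI _ (borel G) _ _ (mF i) (mA j)).
apply: (@le_trans _ _ (\sum_(n <oo) \sum_(k <oo) (absC (nu (F n `&` A k)))%:E)).
  apply: lee_nneseries => // n _.
  rewrite {1}(_ : F n = \bigcup_k (F n `&` A k)); last first.
    rewrite -setI_bigcupr setIidl// -FA; exact: bigcup_sup.
  apply: complex_measure_bigcup_le => //.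
  by move=> i j _ _ [y [[_ Ai] [_ Aj]]]; apply: tA => //; exists y.
rewrite nneseries_interchange//; apply: lee_nneseries => [n _ _|k _].
  exact: nneseries_ge0.
apply: le_variation => //.
by move=> i j _ _ [y [[Fi _] [Fj _]]]; apply: tF => //; exists y.
Qed.

Lemma variation_measure nu : complex_measure nu ->
  exists m : {measure set (borel G) -> \bar R},
    forall A, borel_set A -> m A = measure_variation nu A.
Proof.
(* A set that is not Borel has no Borel partition, so its variation is the supremum of the empty
   set, [-oo]. The maximum with 0 repairs these values and changes nothing on Borel sets. *)
move=> cm; pose f (A : set (borel G)) : \bar R := maxe (measure_variation nu A) 0.
have fE A : borel_set A -> f A = measure_variation nu A.
  by move=> mA; rewrite /f; apply/max_idPl; exact: variation_ge0.
have [||A B mA mB AB|F mF tF|m mE] := @measure_of_superadditive R G f.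
- by move=> A; rewrite /f le_max lexx orbT.
- rewrite fE; last exact: (@measurable0 _ (borel G)).
  apply/eqP; rewrite eq_le variation_ge0 ?andbT; last exact: (@measurable0 _ (borel G)).
  apply: variation_le_bound => F mF tF F0; rewrite eseries0// => n _ _.
  have -> : F n = set0 by apply/seteqP; split=> // y Fy; rewrite -F0; exists n.
  by rewrite (complex_measure0 cm) /absC/= expr0n/= addr0 sqrtr0.
- rewrite !fE//; last exact: (@measurableU _ (borel G)).
  exact: variation_superadditive.
- rewrite fE; last exact: bigcup_measurable.
  apply: le_trans (variation_bigcup_le cm mF tF) _.
  apply: lee_nneseries => [n _ _|n _]; first by apply: variation_ge0; exact: mF.
  by rewrite fE//; exact: mF.
by exists m => A mA; rewrite mE fE.
Qed.

(** The Jordan variations of the real and imaginary parts are finite measures, and their sum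
    dominates [|nu|] on each piece of a partition. *)
Lemma variation_lty nu : complex_measure nu -> measure_variation nu setT < +oo.
Proof.
move=> [[c1 c1E] [c2 c2E]].
have [P1 [N1 PN1]] := Hahn_decomposition c1.
have [P2 [N2 PN2]] := Hahn_decomposition c2.
have mT : measurable [set: borel G] by [].
have fin1 : charge_variation PN1 setT \is a fin_num by exact: fin_num_measure.
have fin2 : charge_variation PN2 setT \is a fin_num by exact: fin_num_measure.
apply: (@le_lt_trans _ _ (charge_variation PN1 setT + charge_variation PN2 setT)); last first.
  by rewrite ltey_eq fin_numD fin1 fin2.
apply: variation_le_bound => F mF tF FT.
rewrite -FT !measure_semi_bigcup//; try by rewrite FT.
rewrite -nneseriesD//; apply: lee_nneseries => [n _ _|n _].
  by rewrite lee_fin absC_ge0.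
apply: (@le_trans _ _ (`|c1 (F n)| + `|c2 (F n)|)); last first.
  by apply: leeD; apply: abse_charge_variation; exact: mF.
rewrite c1E// c2E//= -EFinD lee_fin; exact: absC_le_ReIm.
Qed.

End complex_measures.

(** * Complex Radon measures and their local versions *)

Section Radon_measures.
Context {R : realType} {G : topGroupType}.
Hypotheses (hausG : hausdorff_space G) (lcG : locally_compact [set: G]).
Local Open Scope ereal_scope.
Implicit Types (nu F H : set G -> R[i]) (A B S K : set G).

Let absC0 : absC (0%R : R[i]) = 0%R.
Proof. by rewrite /absC/= expr0n/= addr0 sqrtr0. Qed.

Lemma borelT : borel_set [set: G]. Proof. exact: (@measurableT _ (borel G)). Qed.

Lemma variation_restrict nu A : borel_set A ->
  measure_variation (fun B => nu (B `&` A)) setT = measure_variation nu A.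
Proof.
move=> mA; apply/eqP; rewrite eq_le; apply/andP; split.
  apply: variation_le_bound => F mF tF FT; apply: le_variation => // [n|].
    exact: (@measurableI _ (borel G) _ _ (mF n) mA).
  by move=> i j _ _ [y [[Fi _] [Fj _]]]; apply: tF => //; exists y.
apply: variation_le_bound => F mF tF FA.
have FnA n : F n `&` A = F n by rewrite setIidl// -FA; exact: bigcup_sup.
under eq_eseriesr do rewrite -FnA.
by apply: (@le_variation _ _ (fun B => nu (B `&` A)) setT F) => //; exact: borelT.
Qed.

Lemma eq_variation nu1 nu2 S : (forall A, borel_set A -> A `<=` S -> nu1 A = nu2 A) ->
  measure_variation nu1 S = measure_variation nu2 S.
Proof.
move=> E; rewrite /measure_variation; congr ereal_sup; apply/seteqP.
by split=> _ [F [mF tF FS] <-]; exists F => //; apply: eq_eseriesr => n _;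
  rewrite E//; rewrite -FS; exact: bigcup_sup.
Qed.

Lemma variationD_le nu1 nu2 S : borel_set S ->
  measure_variation (fun A => (nu1 A + nu2 A)%R) S <=
  measure_variation nu1 S + measure_variation nu2 S.
Proof.
move=> mS; have g0 nu A : 0 <= (absC (nu A))%:E by rewrite lee_fin absC_ge0.
apply: variation_le_bound => F mF tF FS.
have FnS n : F n `<=` S by rewrite -FS; exact: bigcup_sup.
apply: (@le_trans _ _ (\sum_(n <oo) ((absC (nu1 (F n)))%:E + (absC (nu2 (F n)))%:E))).
  apply: lee_nneseries => n _; first by move=> _; rewrite lee_fin absC_ge0.
  by rewrite -EFinD lee_fin absC_le_add.
by rewrite nneseriesD//; apply: leeD; exact: le_variation.
Qed.

Lemma variationZ_le (c : R[i]) nu S : borel_set S ->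
  measure_variation (fun A => (c * nu A)%R) S <= (absC c)%:E * measure_variation nu S.
Proof.
move=> mS; apply: variation_le_bound => F mF tF FS.
have FnS n : F n `<=` S by rewrite -FS; exact: bigcup_sup.
rewrite (eq_eseriesr (g := fun n => (absC c)%:E * (absC (nu (F n)))%:E)); last first.
  by move=> n _; rewrite absCM EFinM.
rewrite nneseriesZl; last by move=> n _; rewrite lee_fin absC_ge0.
by rewrite lee_wpmul2l ?lee_fin ?absC_ge0//; exact: le_variation.
Qed.

Lemma variationZ (c : R[i]) nu S : borel_set S ->
  measure_variation (fun A => (c * nu A)%R) S = (absC c)%:E * measure_variation nu S.
Proof.
move=> mS; apply/eqP; rewrite eq_le variationZ_le//=.
have [->|c0] := eqVneq c 0%R; first by rewrite absC0 mul0e variation_ge0.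
(* The inequality for [c^-1] and the measure [c nu] is the reverse inequality for [c] and [nu]. *)
have h := @variationZ_le (c^-1)%R (fun A => (c * nu A)%R) S mS.
have cK : (fun A => c^-1 * (c * nu A))%R = nu.
  by apply/funext => A; rewrite mulKf.
rewrite cK in h.
have c00 : 0 <= (absC c)%:E by rewrite lee_fin absC_ge0.
apply: (le_trans (lee_wpmul2l c00 h)).
by rewrite muleA -EFinM -absCM mulfV// /absC/= expr1n expr0n/= addr0 sqrtr1 mul1e.
Qed.

Lemma complex_radon_complex_measure nu : complex_radon_measure nu -> complex_measure nu.
Proof. by case=> r i _; split. Qed.

Lemma complex_radonZ (c : R[i]) nu : complex_radon_measure nu ->
  complex_radon_measure (fun A => (c * nu A)%R).
Proof.
move=> rnu; have [r i] := complex_measureZ c (complex_radon_complex_measure rnu).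
split => // A mA; apply/eqP; rewrite eq_le; apply/andP; split; last first.
  apply: ge_ereal_sup => _ [K [cK KA] <-]; apply: le_variationS => //.
  exact: borel_compact.
rewrite variationZ// (crm_regular rnu mA).
rewrite -ereal_supZl ?absC_ge0//; last first.
  apply/set0P; exists (measure_variation nu set0); exists set0 => //.
  by split => //; exact: compact0.
apply: ge_ereal_sup => _ [_ [K [cK KA] <-] <-].
apply: ereal_sup_ubound; exists K => //; rewrite variationZ//.
exact: borel_compact.
Qed.

Lemma radon_inner nu A (e : R) : complex_radon_measure nu -> borel_set A ->
  (0 < e)%R -> exists K, [/\ compact K, K `<=` A &
    measure_variation nu A - e%:E < measure_variation nu K].
Proof.
move=> rnu mA e0.
have fin : measure_variation nu A \is a fin_num.
  rewrite ge0_fin_numE ?variation_ge0//.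
  apply: le_lt_trans (variation_lty (complex_radon_complex_measure rnu)).
  by apply: le_variationS => //; exact: borelT.
rewrite (crm_regular rnu mA) in fin *.
have [_ [K [cK KA] <-] h] := ub_ereal_sup_adherent e0 fin.
by exists K.
Qed.

Lemma variation_setD nu A B : complex_measure nu -> borel_set A -> borel_set B ->
  B `<=` A -> measure_variation nu A =
    measure_variation nu B + measure_variation nu (A `\` B).
Proof.
move=> cm mA mB BA; have [m mE] := variation_measure cm.
have mAB : borel_set (A `\` B) by exact: (@measurableD _ (borel G)).
rewrite -!mE// -measureU//; first by rewrite setDUK.
by apply/seteqP; split=> // y [? [_]].
Qed.

(** For the union [K] of two compact sets chosen for [nu1] and [nu2], each variation of [A] minus
    [K] is at most [e / 2]; the variation of the sum is additive over [K] and [A] minus [K]. *)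
Lemma complex_radonD nu1 nu2 : complex_radon_measure nu1 -> complex_radon_measure nu2 ->
  complex_radon_measure (fun A => (nu1 A + nu2 A)%R).
Proof.
move=> r1 r2; have c1 := complex_radon_complex_measure r1.
have c2 := complex_radon_complex_measure r2.
have c12 := complex_measureD c1 c2; have [re12 im12] := c12.
split => // A mA; apply/eqP; rewrite eq_le; apply/andP; split; last first.
  apply: ge_ereal_sup => _ [K [cK KA] <-]; apply: le_variationS => //.
  exact: borel_compact.
apply/lee_addgt0Pr => e e0; have e20 : (0 < e / 2)%R by rewrite divr_gt0.
have [K1 [cK1 K1A h1]] := radon_inner r1 mA e20.
have [K2 [cK2 K2A h2]] := radon_inner r2 mA e20.
pose K := K1 `|` K2; have cK : compact K by exact: compactU.
have mK := borel_compact hausG cK.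
have KA : K `<=` A by move=> y [/K1A|/K2A].
have mAK : borel_set (A `\` K) by exact: (@measurableD _ (borel G)).
have fin nu B : complex_measure nu -> borel_set B -> measure_variation nu B \is a fin_num.
  move=> cm mB; rewrite ge0_fin_numE ?variation_ge0//.
  apply: le_lt_trans (variation_lty cm); apply: le_variationS => //; exact: borelT.
have small nu L : complex_measure nu -> compact L -> L `<=` K ->
    measure_variation nu A - (e / 2)%:E < measure_variation nu L ->
    measure_variation nu (A `\` K) <= (e / 2)%:E.
  move=> cm cL LK h; have mL := borel_compact hausG cL.
  have fL := fin _ _ cm mL; have fA := fin _ _ cm mA.
  have fAK := fin _ _ cm mAK.
  have mLAK : borel_set (L `|` (A `\` K)) by exact: (@measurableU _ (borel G)).
  have sup : measure_variation nu L + measure_variation nu (A `\` K) <=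
      measure_variation nu A.
    apply: le_trans (variation_superadditive _ mL mAK _) _.
      by apply/seteqP; split=> // y [/LK ? [_]].
    by apply: le_variationS => // y [/LK/KA//|[]].
  move: h sup; rewrite -(fineK fL) -(fineK fA) -(fineK fAK) -!EFinD lte_fin !lee_fin.
  lra.
rewrite (variation_setD c12 mA mK KA); apply: leeD.
  by apply: ereal_sup_ubound; exists K.
apply: le_trans (variationD_le _ _ mAK) _.
rewrite [e in leRHS](splitr e) EFinD; apply: leeD.
  by apply: small h1 => // y; left.
by apply: small h2 => // y; right.
Qed.

Lemma complex_radon0 : complex_radon_measure (fun _ : set G => 0%R : R[i]).
Proof.
split; [exact: real_measure_cst0|exact: real_measure_cst0|].
have v0 S : borel_set S -> measure_variation (fun _ : set G => 0%R : R[i]) S = 0.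
  move=> mS; apply/eqP; rewrite eq_le variation_ge0// andbT.
  by apply: variation_le_bound => F mF tF FS; rewrite eseries0// => n _ _; rewrite absC0.
move=> A mA; rewrite v0//; apply/eqP; rewrite eq_le; apply/andP; split.
  apply: ereal_sup_ubound; exists set0; first by split => //; exact: compact0.
  by rewrite v0//; exact: (@measurable0 _ (borel G)).
apply: ge_ereal_sup => _ [K [cK KA] <-]; rewrite v0//; exact: borel_compact.
Qed.

(* locM, normM are B_loc and the norm of the restriction to A, for B = M(G). *)
Definition locM F := forall K, compact K -> complex_radon_measure (fun A => F (A `&` K)).
Definition normM F A : \bar R := measure_variation (fun B => F (B `&` A)) setT.

Lemma locM0 : locM (fun=> 0%R).
Proof. by move=> K cK; exact: complex_radon0. Qed.

Lemma locMD F H : locM F -> locM H -> locM (fun A => (F A + H A)%R).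
Proof. by move=> lF lH K cK; apply: complex_radonD; [exact: lF|exact: lH]. Qed.

Lemma locMZ c F : locM F -> locM (fun A => (c * F A)%R).
Proof. by move=> lF K cK; apply: complex_radonZ; exact: lF. Qed.

Lemma normMI F A K : borel_set A ->
  normM F (A `&` K) = measure_variation (fun B => F (B `&` K)) A.
Proof.
move=> mA; rewrite -variation_restrict//; congr measure_variation.
by apply/funext => B; rewrite setIA.
Qed.

Lemma normM_local_measure F : locM F -> local_measure (normM F).
Proof.
move=> lF K cK; have cm := complex_radon_complex_measure (lF K cK).
have [m mE] := variation_measure cm; exists m.
  by rewrite mE ?variation_lty//; exact: borelT.
by move=> A mA; rewrite mE// normMI.
Qed.

Lemma normM_regular F : locM F -> locally_regular (normM F).
Proof.
move=> lF U t oU /(precompactP hausG)[K cK UK] tU.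
have mU := borel_open oU; have rK := lF K cK.
move: tU; rewrite -[U in normM F U](setIidl UK) normMI// (crm_regular rK mU).
move=> /ereal_sup_gt[_ [L [cL LU] <-] tL]; exists L; split => //.
have LK : L `<=` K by apply: subset_trans UK.
rewrite -[L in normM F L](setIidl LK) normMI//; exact: borel_compact.
Qed.

Lemma normM_control_norm F : locM F -> control_norm (fun A => fine (normM F A)).
Proof.
move=> lF; apply: (local_measure_control_norm hausG lcG).
  exact: normM_local_measure.
exact: normM_regular.
Qed.

End Radon_measures.

(** * Positive variation and Jordan decomposition *)

Section positive_variation.
Context {R : realType} {G : topGroupType}.
Hypotheses (hausG : hausdorff_space G) (lcG : locally_compact [set: G]).
Local Open Scope ereal_scope.
Implicit Types (r : set G -> R) (A B S K : set G) (g : G -> R).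

Definition local_real_measure r :=
  forall K, compact K -> is_real_measure (fun A => r (A `&` K)).

Lemma local_real0 r : local_real_measure r -> r set0 = 0%R.
Proof. by move=> lr; have := real_measure0 (lr _ (@compact0 G)); rewrite set0I. Qed.

Lemma local_realN r : local_real_measure r -> local_real_measure (fun A => - r A)%R.
Proof.
move=> lr K cK; have := real_measureZ (-1) (lr K cK).
by congr is_real_measure; apply/funext => A; rewrite mulN1r.
Qed.

Lemma local_realD r1 r2 : local_real_measure r1 -> local_real_measure r2 ->
  local_real_measure (fun A => r1 A + r2 A)%R.
Proof. by move=> l1 l2 K cK; apply: real_measureD; [exact: l1|exact: l2]. Qed.

Lemma local_realZ (a : R) r : local_real_measure r ->
  local_real_measure (fun A => a * r A)%R.
Proof. by move=> lr K cK; apply: real_measureZ; exact: lr. Qed.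

Lemma le_positive_variation r A B : borel_set B -> precompact B -> B `<=` A ->
  (r B)%:E <= positive_variation r A.
Proof. by move=> mB pB BA; apply: ereal_sup_ubound; exists B. Qed.

Lemma precompact0 : precompact (@set0 G).
Proof. by apply/(precompactP hausG); exists set0 => //; exact: compact0. Qed.

Lemma borel0 : borel_set (@set0 G). Proof. exact: (@measurable0 _ (borel G)). Qed.

(** Each competitor in the supremum is relatively compact, hence inside a compact set where [r] is a
    charge, so additivity of [r] is available although [r] is only locally a measure. The conclusion
    is an equality of functions because [integral_real_measure] integrates against
    [positive_variation r] itself. *)
Lemma positive_variation_measure r : local_real_measure r ->
  exists m : {measure set (borel G) -> \bar R},
    (m : set (borel G) -> \bar R) = positive_variation r.
Proof.
move=> lr; have r0 := local_real0 lr.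
have p0 A : 0 <= positive_variation r A.
  by rewrite -[0]/(0%R%:E) -r0; apply: le_positive_variation;
    [exact: borel0|exact: precompact0|exact: sub0set].
have [||A B mA mB AB|F mF tF|m mE] := @measure_of_superadditive R G (positive_variation r).
- exact: p0.
- apply/eqP; rewrite eq_le p0 andbT; apply: ge_ereal_sup => _ [B [mB pB B0] <-].
  by rewrite (_ : B = set0) ?r0//; apply/seteqP; split=> // y /B0.
- apply: ereal_supD_le.
  + by move=> _ [E _ <-]; exact: ltNyr.
  + by move=> _ [E _ <-]; exact: ltNyr.
  + exists (r set0)%:E, set0 => //; split; [exact: borel0|exact: precompact0|exact: sub0set].
  + exists (r set0)%:E, set0 => //; split; [exact: borel0|exact: precompact0|exact: sub0set].
  move=> _ _ [C [mC pC CA] <-] [D [mD pD DB] <-].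
  have CD : C `&` D = set0 by apply/seteqP; split=> // y [/CA Ay /DB By]; rewrite -AB.
  have pCD := precompactU hausG pC pD.
  have [K cK CDK] := (precompactP hausG _).1 pCD.
  have := real_measureU (lr K cK) mC mD CD.
  rewrite !setIidl//; last 2 first.
  + by move=> y Dy; apply: CDK; right.
  + by move=> y Cy; apply: CDK; left.
  move=> rCD; rewrite -EFinD -rCD; apply: le_positive_variation => //.
    exact: (@measurableU _ (borel G)).
  by move=> y [/CA|/DB]; [left|right].
- apply: ge_ereal_sup => _ [B [mB pB BF] <-].
  set s := \sum_(0 <= n <oo) _.
  have s0 : 0 <= s by apply: nneseries_ge0 => n _ _; exact: p0.
  have [->|sfin] := eqVneq s +oo; first by rewrite leey.
  have {}sfin : s \is a fin_num by rewrite ge0_fin_numE// lt_neqAle sfin leey.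
  have [K cK BK] := (precompactP hausG _).1 pB.
  have mBF n : borel_set (B `&` F n) by exact: (@measurableI _ (borel G) _ _ mB (mF n)).
  have pBF n : precompact (B `&` F n) by apply: precompact_subset pB => y [].
  have tBF : trivIset setT (fun n => B `&` F n).
    by move=> i j _ _ [y [[_ Fi] [_ Fj]]]; apply: tF => //; exists y.
  have := real_measure_cvg (lr K cK) mBF tBF.
  rewrite -setI_bigcupr (setIidl BF) (setIidl BK) => cv.
  rewrite -(fineK sfin) lee_fin -(cvg_lim _ cv)//.
  apply: limr_le; first by apply/cvg_ex; eexists; exact: cv.
  apply: nearW => n; rewrite -lee_fin fineK// -sumEFin.
  apply: le_trans (nneseries_lim_ge n _) => [|k _ _]; last exact: p0.
  apply: lee_sum => k _; rewrite setIidl; last by move=> y [/BK].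
  by apply: le_positive_variation => // y [].
by exists m; apply/funext.
Qed.

(** Inside [K] a Hahn decomposition exists, and the supremum over subsets of [A] is attained at the
    part of [A] in the positive set. So both variations agree there with the Jordan parts, which are
    finite. *)
Lemma positive_variation_jordan r K A : local_real_measure r -> compact K ->
  borel_set A -> A `<=` K ->
  positive_variation r A \is a fin_num /\
  positive_variation r A = positive_variation (fun B => - r B)%R A + (r A)%:E.
Proof.
move=> lr cK mA AK; have [c cE] := lr K cK.
have [P [N PN]] := Hahn_decomposition c.
have mP : borel_set P by case: PN => -[].
have mN : borel_set N by case: PN => _ [].
have pA : precompact A by apply/(precompactP hausG); exists K.
have cBE B : borel_set B -> B `<=` A -> c B = (r B)%:E.
  by move=> mB BA; rewrite cE// setIidl// => y /BA/AK.
have jE B : borel_set B -> c B = jordan_pos PN B - jordan_neg PN B.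
  move=> mB; rewrite (jordan_decomp PN mB).
  by rewrite -[LHS]/(jordan_pos PN B + (-1)%:E * jordan_neg PN B) mulN1e.
have fp B : borel_set B -> jordan_pos PN B \is a fin_num by move=> mB; exact: fin_num_measure.
have fn B : borel_set B -> jordan_neg PN B \is a fin_num by move=> mB; exact: fin_num_measure.
have posE : positive_variation r A = jordan_pos PN A.
  apply/eqP; rewrite eq_le; apply/andP; split.
    apply: ge_ereal_sup => _ [B [mB pB BA] <-].
    rewrite -(cBE B mB BA) jE//; apply: (@le_trans _ _ (jordan_pos PN B)).
      by rewrite leeBlDr ?fn// leeDl.
    exact: le_borel_measure.
  rewrite jordan_posE cjordan_posE /crestr0 mem_set// /crestr.
  have mAP : borel_set (A `&` P) by exact: (@measurableI _ (borel G)).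
  rewrite cBE//.
  apply: le_positive_variation => //.
  by apply: precompact_subset pA => y [].
have negE : positive_variation (fun B => - r B)%R A = jordan_neg PN A.
  apply/eqP; rewrite eq_le; apply/andP; split.
    apply: ge_ereal_sup => _ [B [mB pB BA] <-].
    rewrite EFinN -(cBE B mB BA) jE//; apply: (@le_trans _ _ (jordan_neg PN B)).
      by rewrite fin_num_oppeB ?fp ?fn// addeC leeBlDr ?fp// leeDl.
    exact: le_borel_measure.
  rewrite jordan_negE cjordan_negE /crestr0 mem_set// /crestr.
  have mAN : borel_set (A `&` N) by exact: (@measurableI _ (borel G)).
  rewrite cBE//.
  rewrite -EFinN; apply: (@le_positive_variation (fun B => - r B)%R) => //.
  by apply: precompact_subset pA => y [].
rewrite posE negE; split; first exact: fp.
by rewrite -(cBE A mA (@subset_refl _ A)) jE// addeC subeK// fn.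
Qed.

End positive_variation.

(** * Integration against local real measures *)

Section integral_real_measure.
Context {R : realType} {G : topGroupType}.
Hypotheses (hausG : hausdorff_space G) (lcG : locally_compact [set: G]).
Local Open Scope ereal_scope.
Implicit Types (r : set G -> R) (A B S K : set G).

Section integrand.
Variables (g : G -> R) (K : set G).
Hypotheses (mg : measurable_fun setT (g : borel G -> R)).
Hypotheses (g01 : forall x, (0 <= g x <= 1)%R).
Hypotheses (cK : compact K) (gK : forall x, (g x != 0)%R -> K x).

Let mK : borel_set K. Proof. exact: borel_compact. Qed.

Let g0 x : 0 <= (g x)%:E.
Proof. by rewrite lee_fin; have /andP[] := g01 x. Qed.

Let mgE (D : set (borel G)) : measurable_fun D (fun x : borel G => (g x)%:E).
Proof. by apply: measurable_funTS; exact/measurable_EFinP. Qed.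

(** The integrand vanishes off [K], so the cut leaves the integral unchanged; it makes visible that
    only the values of [m] inside [K] matter. *)
Definition kint (m : set (borel G) -> \bar R) A : \bar R :=
  \int[m]_(x in (A `&` K : set (borel G))) (g x)%:E.

Lemma integral_support (m : {measure set (borel G) -> \bar R}) A :
  \int[m]_(x in (A : set (borel G))) (g x)%:E = kint m A.
Proof.
rewrite /kint integral_mkcond [RHS]integral_mkcond; apply: eq_integral => x _.
rewrite !patchE in_setI; case: (x \in A) => //=.
case: (boolP (x \in K)) => // /negP xK.
have [->//|gx] := eqVneq (g x) 0%R.
by exfalso; apply: xK; apply/mem_set; exact: gK.
Qed.

Lemma kint_ge0 (m : {measure set (borel G) -> \bar R}) A : 0 <= kint m A.
Proof. by apply: integral_ge0 => x _; exact: g0. Qed.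

Lemma kint_le (m : {measure set (borel G) -> \bar R}) A : borel_set A ->
  kint m A <= m (A `&` K).
Proof.
move=> mA; have mAK : borel_set (A `&` K) by exact: (@measurableI _ (borel G)).
rewrite -[leRHS]mul1e -integral_cst//; apply: ge0_le_integral => //.
by move=> x _; rewrite lee_fin; have /andP[] := g01 x.
Qed.

Lemma kint_fin (m : {measure set (borel G) -> \bar R}) A : borel_set A ->
  m K < +oo -> kint m A \is a fin_num.
Proof.
move=> mA mKfin; rewrite ge0_fin_numE ?kint_ge0//.
apply: le_lt_trans (kint_le m mA) _; apply: le_lt_trans mKfin.
by apply: le_borel_measure => //; exact: (@measurableI _ (borel G)).
Qed.

Lemma eq_kint (m1 m2 : {measure set (borel G) -> \bar R}) A :
  (forall B, borel_set B -> B `<=` K -> m1 B = m2 B) -> kint m1 A = kint m2 A.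
Proof.
move=> mE; apply: eq_measure_integral => B mB BAK; apply: mE => //.
by move=> y /BAK[].
Qed.

(** The Jordan parts may be replaced by any two measures that are finite on [K] and differ by [r]
    inside it: [p - n = m1 - m2] is rearranged to [p + m2 = n + m1], an equality of measures inside
    [K] that can be integrated. Linearity in [r] depends on this freedom, because positive
    variations of sums are not sums. *)
Lemma integral_real_measureE r (m1 m2 : {measure set (borel G) -> \bar R}) A :
  local_real_measure r -> borel_set A -> m1 K < +oo -> m2 K < +oo ->
  (forall B, borel_set B -> B `<=` K -> m1 B = m2 B + (r B)%:E) ->
  integral_real_measure r A g = (fine (kint m1 A) - fine (kint m2 A))%R.
Proof.
move=> lr mA m1K m2K mE.
have [p pE] := positive_variation_measure hausG lr.
have [n nE] := positive_variation_measure hausG (local_realN lr).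
rewrite /integral_real_measure -pE -nE !integral_support.
have jE B : borel_set B -> B `<=` K -> p B \is a fin_num /\ p B = n B + (r B)%:E.
  by move=> mB BK; rewrite pE nE; exact: positive_variation_jordan BK.
have [pK pKE] := jE K mK (@subset_refl _ K).
have nK : n K \is a fin_num.
  by move: pK; rewrite pKE fin_numD => /andP[].
have fpA : kint p A \is a fin_num by apply: kint_fin => //; rewrite ltey_eq pK.
have fnA : kint n A \is a fin_num by apply: kint_fin => //; rewrite ltey_eq nK.
have f1A := kint_fin mA m1K; have f2A := kint_fin mA m2K.
have mAK : borel_set (A `&` K) by exact: (@measurableI _ (borel G)).
have : kint p A + kint m2 A = kint n A + kint m1 A.
  rewrite /kint -!ge0_integral_measure_add//.
  rewrite -[LHS]/(kint (measure_add p m2) A) -[RHS]/(kint (measure_add n m1) A).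
  apply: eq_kint => B mB BK.
  have [_ pB] := jE B mB BK.
  by rewrite -[LHS]/(measure_add p m2 B) -[RHS]/(measure_add n m1 B) !measure_addE
    pB mE// addeAC addeA.
rewrite -(fineK fpA) -(fineK fnA) -(fineK f1A) -(fineK f2A) -!EFinD /= => -[].
lra.
Qed.

Lemma local_real_parts r : local_real_measure r ->
  exists m1 m2 : {measure set (borel G) -> \bar R}, [/\ m1 K < +oo, m2 K < +oo,
    (forall B, borel_set B -> B `<=` K -> m1 B = m2 B + (r B)%:E),
    (forall B, m1 B = positive_variation r B) &
    (forall B, m2 B = positive_variation (fun B => - r B)%R B)].
Proof.
move=> lr; have [p pE] := positive_variation_measure hausG lr.
have [n nE] := positive_variation_measure hausG (local_realN lr).
exists p, n; have [pK pKE] := positive_variation_jordan hausG lr cK mK (@subset_refl _ K).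
have [nK _] := positive_variation_jordan hausG (local_realN lr) cK mK (@subset_refl _ K).
split.
- by rewrite pE ltey_eq pK.
- by rewrite nE ltey_eq nK.
- by move=> B mB BK; rewrite pE nE; have [] := positive_variation_jordan hausG lr cK mB BK.
- by move=> B; rewrite pE.
- by move=> B; rewrite nE.
Qed.

Lemma integral_real_measureD r1 r2 A : local_real_measure r1 -> local_real_measure r2 ->
  borel_set A -> integral_real_measure (fun B => r1 B + r2 B)%R A g =
  (integral_real_measure r1 A g + integral_real_measure r2 A g)%R.
Proof.
move=> l1 l2 mA.
have [p1 [n1 [p1K n1K E1 _ _]]] := local_real_parts l1.
have [p2 [n2 [p2K n2K E2 _ _]]] := local_real_parts l2.
have mAK : borel_set (A `&` K) by exact: (@measurableI _ (borel G)).
have addE (m m' : {measure set (borel G) -> \bar R}) (B : set (borel G)) :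
    (measure_add m m' : {measure set (borel G) -> \bar R}) B = m B + m' B.
  exact: measure_addE.
have kD (m m' : {measure set (borel G) -> \bar R}) : m K < +oo -> m' K < +oo ->
    fine (kint (measure_add m m') A) = (fine (kint m A) + fine (kint m' A))%R.
  move=> mKoo m'Koo; have f := kint_fin mA mKoo; have f' := kint_fin mA m'Koo.
  by rewrite -fineD// /kint ge0_integral_measure_add.
rewrite (integral_real_measureE l1 mA p1K n1K E1) (integral_real_measureE l2 mA p2K n2K E2).
rewrite (@integral_real_measureE _ (measure_add p1 p2) (measure_add n1 n2) A) //.
- rewrite (kD _ _ p1K p2K) (kD _ _ n1K n2K); ring.
- exact: local_realD.
- by rewrite addE lte_add_pinfty.
- by rewrite addE lte_add_pinfty.
- by move=> B mB BK; rewrite !addE E1// E2// EFinD addeACA.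
Qed.

Lemma integral_real_measureZ (a : R) r A : local_real_measure r ->
  borel_set A -> integral_real_measure (fun B => a * r B)%R A g =
  (a * integral_real_measure r A g)%R.
Proof.
move=> lr mA; have [p [n [pK nK E _ _]]] := local_real_parts lr.
have mAK : borel_set (A `&` K) by exact: (@measurableI _ (borel G)).
have fp := kint_fin mA pK; have fn := kint_fin mA nK.
rewrite (integral_real_measureE lr mA pK nK E).
have scale (k : R) (m : {measure set (borel G) -> \bar R}) : (0 <= k)%R -> m K < +oo ->
    exists m' : {measure set (borel G) -> \bar R}, [/\ m' K < +oo,
      forall B, m' B = k%:E * m B & fine (kint m' A) = (k * fine (kint m A))%R].
  move=> k0 mKoo; exists (mscale (NngNum k0) m); split => //.
    by rewrite -[X in X < _]/(k%:E * m K) lte_mul_pinfty.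
  have fm := kint_fin mA mKoo.
  by rewrite /kint ge0_integral_mscale// fineM.
have finB (m : {measure set (borel G) -> \bar R}) B : m K < +oo -> borel_set B ->
    B `<=` K -> m B \is a fin_num.
  move=> mKoo mB BK; rewrite ge0_fin_numE//; apply: le_lt_trans mKoo.
  exact: le_borel_measure.
have [a0|a0] := leP 0%R a.
  have [p' [p'K p'E kp']] := scale a p a0 pK.
  have [n' [n'K n'E kn']] := scale a n a0 nK.
  rewrite (integral_real_measureE (local_realZ a lr) mA p'K n'K).
    by rewrite kp' kn' -mulrBr.
  move=> B mB BK; rewrite p'E n'E E// muleDr// ?EFinM//.
  by rewrite fin_num_adde_defl.
(* A negative factor exchanges the two parts, each scaled by [- a]. *)
have na0 : (0 <= - a)%R by rewrite oppr_ge0 ltW.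
have [p' [p'K p'E kp']] := scale (- a)%R p na0 pK.
have [n' [n'K n'E kn']] := scale (- a)%R n na0 nK.
rewrite (integral_real_measureE (local_realZ a lr) mA n'K p'K).
  by rewrite kp' kn' !mulNr opprK mulrBr addrC.
move=> B mB BK; rewrite p'E n'E E//.
have fB := finB n B nK mB BK.
rewrite -(fineK fB) -[_ + (r B)%:E]EFinD -!EFinM. rewrite -[RHS]EFinD; congr EFin; ring.
Qed.

Lemma normr_integral_real_measure r A : local_real_measure r -> borel_set A ->
  (`|integral_real_measure r A g|%:E <=
    positive_variation r (A `&` K) + positive_variation (fun B => - r B)%R (A `&` K)).
Proof.
move=> lr mA; have [p [n [pK nK E pE nE]]] := local_real_parts lr.
rewrite (integral_real_measureE lr mA pK nK E).
have fp := kint_fin mA pK; have fn := kint_fin mA nK.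
rewrite -pE -nE; apply: le_trans (leeD (kint_le p mA) (kint_le n mA)).
rewrite -[in leRHS](fineK fp) -[in leRHS](fineK fn) -EFinD lee_fin.
have p0 : (0 <= fine (kint p A))%R by apply: fine_ge0; exact: kint_ge0.
have n0 : (0 <= fine (kint n A))%R by apply: fine_ge0; exact: kint_ge0.
by apply: le_trans (ler_normB _ _) _; rewrite !ger0_norm.
Qed.

End integrand.

Lemma integral_real_measure_sum (I : eqType) (s : seq I) (g : I -> G -> R)
    (K : I -> set G) r A :
  (forall i, measurable_fun setT (g i : borel G -> R)) ->
  (forall i x, (0 <= g i x <= 1)%R) -> (forall i, compact (K i)) ->
  (forall i x, (g i x != 0)%R -> K i x) -> local_real_measure r ->
  borel_set A -> precompact A -> (forall x, A x -> \sum_(i <- s) g i x = 1)%R ->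
  (\sum_(i <- s) integral_real_measure r A (g i) = r A)%R.
Proof.
move=> mg g01 cK gK lr mA /(precompactP hausG)[L cL AL] g1.
have [p pE] := positive_variation_measure hausG lr.
have [n nE] := positive_variation_measure hausG (local_realN lr).
have mgE i : measurable_fun (A : set (borel G)) (fun x : borel G => (g i x)%:E).
  by apply: measurable_funTS; exact/measurable_EFinP.
have g0 i x : A x -> 0 <= (g i x)%:E.
  by move=> _; rewrite lee_fin; have /andP[] := g01 i x.
have [pA pAE] := positive_variation_jordan hausG lr cL mA AL.
have [nA _] := positive_variation_jordan hausG (local_realN lr) cL mA AL.
have tot (m : {measure set (borel G) -> \bar R}) :
    \sum_(i <- s) \int[m]_(x in (A : set (borel G))) (g i x)%:E = m A.
  rewrite -ge0_integral_sum// -[RHS]mul1e -integral_cst//.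
  apply: eq_integral => x /set_mem Ax; rewrite sumEFin g1//.
have fin (m : {measure set (borel G) -> \bar R}) i : m A \is a fin_num ->
    \int[m]_(x in (A : set (borel G))) (g i x)%:E \is a fin_num.
  move=> mAfin; rewrite ge0_fin_numE; last by apply: integral_ge0 => x; exact: g0.
  apply: (@le_lt_trans _ _ (m A)); last by rewrite -ge0_fin_numE.
  rewrite -[leRHS]mul1e -integral_cst//; apply: ge0_le_integral => //.
    exact: g0.
  by move=> x _; rewrite lee_fin; have /andP[] := g01 i x.
have pAfin : p A \is a fin_num by rewrite pE.
have nAfin : n A \is a fin_num by rewrite nE.
rewrite /integral_real_measure -pE -nE sumrB.
have sumfine (m : {measure set (borel G) -> \bar R}) : m A \is a fin_num ->
    (\sum_(i <- s) fine (\int[m]_(x in (A : set (borel G))) (g i x)%:E) = fine (m A))%R.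
  move=> mAfin; rewrite -(tot m) sum_fine// => i _; exact: fin.
rewrite !sumfine//.
have : p A = n A + (r A)%:E by rewrite pE nE.
by rewrite -(fineK pAfin) -(fineK nAfin) -EFinD => -[->]; rewrite addrAC subrr add0r.
Qed.

End integral_real_measure.

(** * Bounded densities of local measures *)

Section density.
Context {R : realType} {G : topGroupType}.
Hypotheses (hausG : hausdorff_space G) (lcG : locally_compact [set: G]).
Local Open Scope ereal_scope.
Implicit Types (F H : set G -> R[i]) (A B S K : set G).

Lemma locM_re F : locM F -> local_real_measure (fun A => reC (F A)).
Proof. by move=> lF K cK; exact: (crm_re (lF K cK)). Qed.

Lemma locM_im F : locM F -> local_real_measure (fun A => imC (F A)).
Proof. by move=> lF K cK; exact: (crm_im (lF K cK)). Qed.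

Lemma locM_set0 F : locM F -> F set0 = 0%R.
Proof.
move=> lF; have := complex_measure0 (complex_radon_complex_measure (lF _ (@compact0 G))).
by rewrite setI0.
Qed.

Lemma absC_le_normM F A B : locM F -> borel_set B -> B `<=` A -> (absC (F B))%:E <= normM F A.
Proof.
move=> lF mB BA; rewrite -{1}(setIidl BA).
by apply: (absC_le_variation (nu := fun B => F (B `&` A)) (borelT (G := G))) => //;
  rewrite set0I locM_set0.
Qed.

Lemma locM_null_normM F : locM F ->
  (forall A, borel_set A -> precompact A -> F A = 0%R) <->
  (forall K, compact K -> normM F K = 0).
Proof.
move=> lF; split=> [F0 K cK|N0 A mA /(precompactP hausG)[K cK AK]].
  have mK := borel_compact hausG cK.
  rewrite /normM (@eq_variation _ _ _ (fun=> 0%R)).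
    apply/eqP; rewrite eq_le variation_ge0 ?andbT; last exact: borelT.
    apply: variation_le_bound => B mB tB BT.
    by rewrite eseries0// => n _ _; rewrite /absC/= expr0n/= addr0 sqrtr0.
  move=> A mA _; apply: F0; first exact: (@measurableI _ (borel G)).
  by apply/(precompactP hausG); exists K => // y [].
apply: absC0_eq; apply/eqP; rewrite eq_le absC_ge0 andbT -lee_fin.
by apply: le_trans (absC_le_normM lF mA AK) _; rewrite N0.
Qed.

Section bounded_density.
Variables (g : G -> R) (K : set G).
Hypotheses (mg : measurable_fun setT (g : borel G -> R)).
Hypotheses (g01 : forall x, (0 <= g x <= 1)%R).
Hypotheses (cK : compact K) (gK : forall x, (g x != 0)%R -> K x).

Lemma density_measureD F H A : locM F -> locM H -> borel_set A ->
  density_measure g (fun B => F B + H B)%R A =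
  (density_measure g F A + density_measure g H A)%R.
Proof.
move=> lF lH mA; apply: complex_eq.
  rewrite reCD /density_measure /= -(integral_real_measureD hausG mg g01 cK gK)//;
    [|exact: locM_re|exact: locM_re].
  by congr integral_real_measure; apply/funext => B; exact: reCD.
rewrite imCD /density_measure /= -(integral_real_measureD hausG mg g01 cK gK)//;
  [|exact: locM_im|exact: locM_im].
by congr integral_real_measure; apply/funext => B; exact: imCD.
Qed.

Lemma density_measureZ (c : R[i]) F A : locM F -> borel_set A ->
  density_measure g (fun B => c * F B)%R A = (c * density_measure g F A)%R.
Proof.
move=> lF mA; have lre := locM_re lF; have lim := locM_im lF.
apply: complex_eq.
  rewrite reCM /density_measure /= -mulNr.
  rewrite -!(integral_real_measureZ hausG mg g01 cK gK)//.
  rewrite -(integral_real_measureD hausG mg g01 cK gK)//; try exact: local_realZ.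
  by congr integral_real_measure; apply/funext => B; rewrite reCM mulNr.
rewrite imCM /density_measure /=.
rewrite -!(integral_real_measureZ hausG mg g01 cK gK)//.
rewrite -(integral_real_measureD hausG mg g01 cK gK)//; try exact: local_realZ.
by congr integral_real_measure; apply/funext => B; rewrite imCM.
Qed.

(* The factor 4 counts the positive and negative variations of the real and
   imaginary parts. *)
Lemma density_measure_variation_le F : locM F ->
  measure_variation (density_measure g F) setT <= 4%:E * normM F K.
Proof.
move=> lF; have mK := borel_compact hausG cK.
have lre := locM_re lF; have lim := locM_im lF.
have [p1 p1E] := positive_variation_measure hausG lre.
have [n1 n1E] := positive_variation_measure hausG (local_realN lre).
have [p2 p2E] := positive_variation_measure hausG lim.
have [n2 n2E] := positive_variation_measure hausG (local_realN lim).
have bound r : (forall A, `|r A| <= absC (F A))%R -> positive_variation r K <= normM F K.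
  move=> rF; apply: ge_ereal_sup => _ [B [mB pB BK] <-].
  apply: le_trans (absC_le_normM lF mB BK); rewrite lee_fin.
  exact: le_trans (ler_norm _) (rF B).
have [m mE] : exists m : {measure set (borel G) -> \bar R},
    forall A, m A = (p1 A + n1 A) + (p2 A + n2 A).
  exists (measure_add (measure_add p1 n1) (measure_add p2 n2)) => A.
  by transitivity (measure_add p1 n1 A + measure_add p2 n2 A); [exact: measure_addE|
    congr (_ + _); exact: measure_addE].
have mKle : m K <= 4%:E * normM F K.
  have -> : 4%:E * normM F K = (normM F K + normM F K) + (normM F K + normM F K).
    have [->|nT] := eqVneq (normM F K) +oo; first by rewrite gt0_muley// ?lte_fin.
    have fN : normM F K \is a fin_num.
      by rewrite ge0_fin_numE ?lt_neqAle ?nT ?leey//; apply: variation_ge0; exact: borelT.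
    by rewrite -(fineK fN) -!EFinD -EFinM; congr EFin; ring.
  rewrite mE p1E n1E p2E n2E.
  apply: leeD; apply: leeD; apply: bound => A; rewrite ?normrN.
  - exact: normr_reC_le.
  - exact: normr_reC_le.
  - exact: normr_imC_le.
  - exact: normr_imC_le.
apply: le_trans mKle; apply: variation_le_bound => A mA tA AT.
have mAK n : borel_set (A n `&` K) by exact: (@measurableI _ (borel G) _ _ (mA n) mK).
have tAK : trivIset setT (fun n => A n `&` K).
  by move=> i j _ _ [y [[Ai _] [Aj _]]]; apply: tA => //; exists y.
apply: (@le_trans _ _ (\sum_(n <oo) m (A n `&` K))).
  apply: lee_nneseries => [n _ _|n _]; first by rewrite lee_fin absC_ge0.
  apply: (@le_trans _ _ (`|integral_real_measure (fun B => reC (F B)) (A n) g|%:E +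
    `|integral_real_measure (fun B => imC (F B)) (A n) g|%:E)).
    by rewrite -EFinD lee_fin; exact: absC_le_ReIm.
  rewrite mE p1E n1E p2E n2E.
  by apply: leeD; exact: (normr_integral_real_measure hausG mg g01 cK gK).
rewrite -measure_semi_bigcup//; last by apply: bigcup_measurable => n _; exact: mAK.
apply: le_borel_measure => //; first by apply: bigcup_measurable => n _; exact: mAK.
by move=> y [n _ []].
Qed.

Lemma density_measure_variation_fin F : locM F ->
  measure_variation (density_measure g F) setT \is a fin_num.
Proof.
move=> lF; rewrite ge0_fin_numE; last by apply: variation_ge0; exact: borelT.
apply: le_lt_trans (density_measure_variation_le lF) _.
by rewrite lte_mul_pinfty//; exact: (variation_lty (complex_radon_complex_measure (lF K cK))).
Qed.

End bounded_density.

Lemma normM_fin F A : locM F -> borel_set A -> precompact A -> normM F A \is a fin_num.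
Proof. by move=> lF mA pA; exact: (local_measure_fin hausG (normM_local_measure lF)). Qed.

(** Because the densities sum to 1 on [A], [F] of each piece of a partition, cut by [A], is the sum
    of the measures [psi_i F] of that cut piece; exchanging the finite sum with the series leaves
    one variation for each [i]. *)
Lemma normM_le_sum (I : eqType) (s : seq I) (psi : I -> G -> R)
    (K : I -> set G) F A :
  (forall i, measurable_fun setT (psi i : borel G -> R)) ->
  (forall i x, (0 <= psi i x <= 1)%R) -> (forall i, compact (K i)) ->
  (forall i x, (psi i x != 0)%R -> K i x) -> locM F ->
  borel_set A -> precompact A -> (forall x, A x -> \sum_(i <- s) psi i x = 1)%R ->
  normM F A <= \sum_(i <- s) measure_variation (density_measure (psi i) F) setT.
Proof.
move=> mg g01 cK gK lF mA pA g1; apply: variation_le_bound => B mB tB BT.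
have lre := locM_re lF; have lim := locM_im lF.
have mBA n : borel_set (B n `&` A) by exact: (@measurableI _ (borel G) _ _ (mB n) mA).
have tBA : trivIset setT (fun n => B n `&` A).
  by move=> i j _ _ [y [[Bi _] [Bj _]]]; apply: tB => //; exists y.
have FE n : F (B n `&` A) = (\sum_(i <- s) density_measure (psi i) F (B n `&` A))%R.
  have pBA : precompact (B n `&` A) by apply: precompact_subset pA => y [].
  have g1' x : (B n `&` A) x -> (\sum_(i <- s) psi i x = 1)%R by case=> _; exact: g1.
  apply: complex_eq.
    rewrite (big_morph (@reC R) (@reCD R) (erefl : reC (0%R : R[i]) = 0%R)).
    by rewrite -(integral_real_measure_sum hausG mg g01 cK gK lre (mBA n) pBA g1').
  rewrite (big_morph (@imC R) (@imCD R) (erefl : imC (0%R : R[i]) = 0%R)).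
  by rewrite -(integral_real_measure_sum hausG mg g01 cK gK lim (mBA n) pBA g1').
have absC_sum (t : seq I) (z : I -> R[i]) :
    (absC (\sum_(i <- t) z i) <= \sum_(i <- t) absC (z i))%R.
  elim: t => [|i t IH]; first by rewrite !big_nil /absC/= expr0n/= addr0 sqrtr0.
  by rewrite !big_cons; apply: le_trans (absC_le_add _ _) _; rewrite lerD2l.
apply: (@le_trans _ _ (\sum_(n <oo) \sum_(i <- s)
    (absC (density_measure (psi i) F (B n `&` A)))%:E)).
  apply: lee_nneseries => [n _ _|n _]; first by rewrite lee_fin absC_ge0.
  by rewrite FE sumEFin lee_fin.
rewrite nneseries_sum; last by move=> i n _; rewrite lee_fin absC_ge0.
apply: lee_sum => i _; apply: le_variation => //; exact: borelT.
Qed.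

End density.

(** * Partitions of unity *)

Section local_components.
Context {R : realType} {G : topGroupType} (mu : {measure set (borel G) -> \bar R}).
Hypotheses (hausG : hausdorff_space G) (lcG : locally_compact [set: G]).
Hypothesis haar : left_haar_measure mu.
Implicit Types (B : local_component) (A K Q : set G) (psi : G -> R).

Definition local_norm B (F : B_arg G B -> R[i]) A : R :=
  fine (B_norm mu (B_restrict A F)).

Definition local_coef B psi (F : B_arg G B -> R[i]) : R :=
  fine (B_norm mu (B_mul psi F)).

Let fnoo := normLoo_function_norm haar.
Let fn1 := @normL1_function_norm R G mu.

Lemma local_norm_control_norm B (F : B_arg G B -> R[i]) : B_loc mu F ->
  control_norm (local_norm F).
Proof.
case: B F => F lF.
- exact: mLoo_control_norm.
- exact: mL1_control_norm.
- exact: normM_control_norm.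
Qed.

Lemma B_loc0 B : B_loc mu (fun=> 0 : R[i]) (B := B).
Proof. by case: B; [exact: (locC0 fnoo)|exact: (locC0 fn1)|exact: locM0]. Qed.

Lemma B_locD B (F H : B_arg G B -> R[i]) : B_loc mu F -> B_loc mu H ->
  B_loc mu (fun t => F t + H t).
Proof.
by case: B F H => F H lF lH; [exact: (locCD fnoo)|exact: (locCD fn1)|exact: locMD].
Qed.

Lemma B_locZ B c (F : B_arg G B -> R[i]) : B_loc mu F -> B_loc mu (fun t => c * F t).
Proof.
by case: B F => F lF; [exact: (locCZ fnoo)|exact: (locCZ fn1)|exact: locMZ].
Qed.

Lemma local_coef_ge0 B psi (F : B_arg G B -> R[i]) : 0 <= local_coef psi F.
Proof.
apply: fine_ge0; case: B F => F.
- exact: (fn_ge0 fnoo).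
- exact: (fn_ge0 fn1).
- exact: (variation_ge0 _ (@borelT G)).
Qed.

Section multiplier.
Variables (psi : G -> R) (K : set G).
Hypotheses (cpsi : continuous psi) (psi01 : forall x, 0 <= psi x <= 1).
Hypotheses (cK : compact K) (psiK : forall x, psi x != 0 -> K x).
Let mpsi := continuous_borel cpsi.

(** The constant is that of [density_measure_variation_le]. The function components satisfy the
    bound with 1, enlarged here to a common value. *)
Lemma local_coef_le B (F : B_arg G B -> R[i]) : B_loc mu F ->
  local_coef psi F <= 4 * local_norm F K.
Proof.
have pK : precompact K by apply/(precompactP hausG); exists K.
move=> lF; have m0 := cn_ge0 (local_norm_control_norm lF) (borel_compact hausG cK) pK.
have le4 : local_norm F K <= 4 * local_norm F K by rewrite ler_peMl// ler1n.
case: B F lF m0 le4 => F lF m0 le4.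
- exact: le_trans (mulC_le_mC hausG fnoo cpsi psi01 cK psiK lF) le4.
- exact: le_trans (mulC_le_mC hausG fn1 cpsi psi01 cK psiK lF) le4.
- have fN := normM_fin hausG lF (borel_compact hausG cK) pK.
  have := density_measure_variation_le hausG mpsi psi01 cK psiK lF.
  rewrite -lee_fin EFinM -[EFin (local_norm F K)]/((fine (normM F K))%:E) (fineK fN).
  rewrite -[EFin (local_coef psi F)]/((fine (measure_variation (density_measure psi F) setT))%:E).
  rewrite fineK//.
  exact: (density_measure_variation_fin hausG mpsi psi01 cK psiK lF).
Qed.

Lemma local_coefD B (F H : B_arg G B -> R[i]) : B_loc mu F -> B_loc mu H ->
  local_coef psi (fun t => F t + H t) <= local_coef psi F + local_coef psi H.
Proof.
case: B F H => F H lF lH.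
- exact: (mulCD fnoo cpsi psi01 cK psiK lF lH).
- exact: (mulCD fn1 cpsi psi01 cK psiK lF lH).
- have fin := density_measure_variation_fin hausG mpsi psi01 cK psiK.
  rewrite -lee_fin EFinD /local_coef /= [in leLHS]fineK; last exact: (fin _ (locMD hausG lF lH)).
  rewrite [in leRHS]fineK ?fin// [in leRHS]fineK ?fin//.
  rewrite (@eq_variation _ _ _
    (fun A => density_measure psi F A + density_measure psi H A)).
    exact: (variationD_le _ _ (@borelT G)).
  by move=> A mA _; exact: (density_measureD hausG mpsi psi01 cK psiK).
Qed.

Lemma local_coefZ B c (F : B_arg G B -> R[i]) : B_loc mu F ->
  local_coef psi (fun t => c * F t) = absC c * local_coef psi F.
Proof.
case: B F => F lF.
- exact: (mulCZ fnoo cpsi psi01 cK psiK c lF).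
- exact: (mulCZ fn1 cpsi psi01 cK psiK c lF).
- have fin := density_measure_variation_fin hausG mpsi psi01 cK psiK.
  rewrite /local_coef /= (@eq_variation _ _ _ (fun A => c * density_measure psi F A)).
    by rewrite (variationZ _ _ (@borelT G)) fineM// fin.
  by move=> A mA _; exact: (density_measureZ hausG mpsi psi01 cK psiK).
Qed.

End multiplier.

Lemma local_norm_le_sum B (F : B_arg G B -> R[i]) A (I : eqType) (s : seq I)
    (psi : I -> G -> R) (K : I -> set G) :
  B_loc mu F -> borel_set A -> precompact A ->
  (forall i, continuous (psi i)) -> (forall i x, 0 <= psi i x <= 1) ->
  (forall i, compact (K i)) -> (forall i x, psi i x != 0 -> K i x) ->
  (forall x, A x -> \sum_(i <- s) psi i x = 1) ->
  local_norm F A <= \sum_(i <- s) local_coef (psi i) F.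
Proof.
case: B F => F lF mA pA cpsi psi01 cK psiK psi1.
- exact: (mC_le_sum hausG fnoo lF mA pA cpsi psi01 cK psiK psi1).
- exact: (mC_le_sum hausG fn1 lF mA pA cpsi psi01 cK psiK psi1).
- have mpsi i := continuous_borel (cpsi i).
  have fin i := density_measure_variation_fin hausG (mpsi i) (psi01 i) (cK i) (psiK i) lF.
  rewrite -lee_fin /local_norm fineK; last exact: (normM_fin hausG lF mA pA).
  rewrite /local_coef sum_fine; last by move=> i _; exact: fin.
  rewrite fineK; first exact: (normM_le_sum hausG mpsi psi01 cK psiK lF mA pA psi1).
  by rewrite sum_fin_num; apply/allP => _ /mapP[i _ ->]; exact: fin.
Qed.

(** Needed for definiteness of the BUPU quasi-norm: coefficients can be compared with local norms on
    compact sets, and for each component the vanishing of these characterises the null element. *)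
Lemma null_local_norm B (F : B_arg G B -> R[i]) : B_loc mu F ->
  B_loc_null mu F <-> forall K, compact K -> local_norm F K = 0.
Proof.
have restr_null (H : G -> R[i]) K :
    {ae mu, forall x : borel G, K x -> H x = 0} <->
    {ae mu, forall x : borel G, absC (restrictC K H x) = 0}.
  split; apply: filterS => x.
    move=> h; rewrite absC_indic indicE; have [/set_mem/h->|_] := boolP (x \in K).
      by rewrite /absC/= expr0n/= addr0 sqrtr0 mulr0.
    by rewrite mul0r.
  by move=> h Kx; move: h; rewrite absC_indic indicE (mem_set Kx) mul1r => /absC0_eq.
have fine0 (x : \bar R) : (0 <= x)%E -> (x < +oo)%E -> fine x = 0 <-> x = 0%E.
  move=> x0 xoo; have fx : x \is a fin_num by rewrite ge0_fin_numE.
  by split=> [h|->//]; rewrite -(fineK fx) h.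
have funP n (H : G -> R[i]) : function_norm n -> locC n H ->
    (forall K, compact K -> measurable_cfun (restrictC K H) -> n (restrictC K H) = 0%E <->
      {ae mu, forall x : borel G, absC (restrictC K H x) = 0}) ->
    (forall K, compact K -> {ae mu, forall x : borel G, K x -> H x = 0}) <->
    (forall K, compact K -> mC n H K = 0).
  move=> fn lH nP; split=> h K cK; have [mH nH] := lH K cK.
    by apply/(fine0 _ (fn_ge0 fn _) nH)/(nP K cK mH)/restr_null; exact: h.
  by apply/restr_null/(nP K cK mH)/(fine0 _ (fn_ge0 fn _) nH); exact: h.
case: B F => F lF.
- apply: (funP _ F fnoo lF) => K cK mF.
  have -> : normLoo mu (restrictC K F) = 0%E <-> (normLoo mu (restrictC K F) <= 0)%E.
    by split=> [->//|h]; apply/eqP; rewrite eq_le h (fn_ge0 fnoo).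
  rewrite normLooE//; split=> [/ess_supP|h]; last first.
    by apply/ess_supP; apply: filterS h => x ->.
  by apply: filterS => x; rewrite lee_fin => h; apply/eqP; rewrite eq_le h absC_ge0.
- apply: (funP _ F fn1 lF) => K cK mF.
  have mE : measurable_fun setT (fun x : borel G => (absC (restrictC K F x))%:E).
    by apply/measurable_EFinP; exact: measurable_absC.
  have := ae_eq_integral_abs mu measurableT mE.
  rewrite normL1E (eq_integral (fun x : borel G => (absC (restrictC K F x))%:E)); last first.
    by move=> x _; rewrite /= ger0_norm// absC_ge0.
  move=> ->; split; apply: filterS => x; first by move=> /(_ I) [].
  by move=> -> _.
- have := locM_null_normM hausG lF; rewrite /B_loc_null => ->.
  split=> h K cK; have := h K cK.
    by move=> h0; exact: (congr1 fine h0).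
  have pK : precompact K by apply/(precompactP hausG); exists K.
  have fN := normM_fin hausG lF (borel_compact hausG cK) pK.
  by move=> h0; rewrite -(fineK fN) -[fine _]/(local_norm F K) h0.
Qed.

End local_components.

(** * Quasi-norms of coefficient families *)

Section synth_norm.
Context {R : realType} {G : topGroupType} (mu : {measure set (borel G) -> \bar R}).
Hypotheses (hausG : hausdorff_space G) (lcG : locally_compact [set: G]).
Hypothesis haar : left_haar_measure mu.
Variables (I : choiceType) (X : I -> G) (Q : set G).
Hypotheses (sepX : relatively_separated X) (nQ : unit_nbhd Q).
Implicit Types (a b : I -> R).

(** The list [s x] is independent of the coefficients, so sums, multiples and inequalities between
    coefficient families pass through a plain finite sum. *)
Lemma synth_seq : exists s : G -> seq I, (forall x i, i \in s x <-> ltrans (X i) Q x) /\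
  forall a, (forall i, 0 <= a i) -> synth X a Q = fun x => \sum_(i <- s x) a i.
Proof.
have [_ pQ _] := nQ; have [C CP] := relatively_separated_seq hausG sepX pQ.
have [s sP] := choice CP; exists s; split=> [x|a a0]; first by have [] := sP x.
by apply/funext => x; have [us _ xs] := sP x; rewrite /synth (translate_sum_seq a0 us xs).
Qed.

Lemma synth_null a : (forall i, 0 <= a i) ->
  {ae mu, forall x : borel G, cfun (synth X a Q) x = 0} <-> forall i, a i = 0.
Proof.
have [s [sP sE]] := synth_seq; have [_ pQ mQ] := nQ.
move=> a0; rewrite sE//; split=> [[N [mN N0 XN]] i|a_0]; last first.
  by apply: aeW => x; rewrite /cfun big1.
apply/eqP; rewrite eq_le a0 andbT leNgt; apply/negP => ai.
have : (mu (ltrans (X i) Q) <= mu N)%E.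
  apply: le_borel_measure => //; first exact: borel_ltrans.
  move=> x ix; apply: XN => /= -[sx]; have : 0 < \sum_(j <- s x) a j.
    have is_x : i \in s x by apply/sP.
    rewrite (big_rem i)//=; apply: ltr_pwDl => //; exact: sumr_ge0.
  by rewrite sx ltxx.
rewrite (haar_invariant haar)// N0 leNgt.
by rewrite (haar_unit_nbhd_gt0 hausG haar nQ).
Qed.

Context (Y : qspace R G).
Hypothesis hY : quasi_banach_function_space mu Y.

Lemma synth_dom0 : qdom Y (cfun (synth X (fun=> 0) Q)).
Proof.
have [s [_ ->//]] := synth_seq; have := qn_dom0 (qbfs_quasinormed hY).
by congr qdom; apply/funext => x; rewrite /cfun big1.
Qed.

Lemma synth_domZ a (c : R) : (forall i, 0 <= a i) -> 0 <= c ->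
  qdom Y (cfun (synth X a Q)) ->
  qdom Y (cfun (synth X (fun i => c * a i) Q)) /\
  qnorm Y (cfun (synth X (fun i => c * a i) Q)) = c * qnorm Y (cfun (synth X a Q)).
Proof.
move=> a0 c0; have [s [_ sE]] := synth_seq; have qn := qbfs_quasinormed hY.
have -> : cfun (synth X (fun i => c * a i) Q) = fun x => c%:C * cfun (synth X a Q) x.
  rewrite !sE// => [|i]; last exact: mulr_ge0.
  by apply/funext => x; rewrite /cfun -mulr_sumr rmorphM.
move=> aY; split; first exact: (qn_domZ qn).
by rewrite (qn_homo qn)// absC_real ger0_norm.
Qed.

(** A third family [d] below [a + b] appears because the coefficients [||F psi_i|B||] are only
    subadditive in [F]; solidity brings [d] into the domain. *)
Lemma synth_domD : exists2 C : R, 0 <= C & forall a b d,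
  (forall i, 0 <= a i) -> (forall i, 0 <= b i) -> (forall i, 0 <= d i <= a i + b i) ->
  qdom Y (cfun (synth X a Q)) -> qdom Y (cfun (synth X b Q)) ->
  qdom Y (cfun (synth X d Q)) /\
  qnorm Y (cfun (synth X d Q)) <= C * (qnorm Y (cfun (synth X a Q)) + qnorm Y (cfun (synth X b Q))).
Proof.
have [s [_ sE]] := synth_seq; have qn := qbfs_quasinormed hY; have [_ pQ mQ] := nQ.
have [C CP] := qn_triangle qn; exists (Num.max C 0); first by rewrite le_max lexx orbT.
move=> a b d a0 b0 dab aY bY.
have d0 i : 0 <= d i by have /andP[] := dab i.
pose f x := synth X a Q x + synth X b Q x.
have fE : cfun f = fun x => cfun (synth X a Q) x + cfun (synth X b Q) x by exact: cfunD.
have fY : qdom Y (cfun f) by rewrite fE; exact: (qn_domD qn).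
have [|||dY dle] := @solid_le R G mu Y hY f (synth X d Q) 1 fY.
- exact: synth_measurable.
- exact: ler01.
- move=> x; rewrite synth_ge0// mul1r /f !sE// -big_split/=.
  by apply: ler_sum => i _; have /andP[] := dab i.
split=> //; rewrite mul1r fE in dle; apply: le_trans dle _.
apply: le_trans (CP _ _ aY bY) _.
by rewrite ler_wpM2r ?le_max ?lexx// addr_ge0// (qn_ge0 qn).
Qed.

End synth_norm.

(** * Amalgam spaces and the BUPU quasi-norm *)

Section amalgams.
Context {R : realType} {G : topGroupType} (mu : {measure set (borel G) -> \bar R}).
Hypotheses (hausG : hausdorff_space G) (lcG : locally_compact [set: G]).
Hypothesis haar : left_haar_measure mu.
Context (Y : qspace R G).
Hypothesis hY : quasi_banach_function_space mu Y.
Hypothesis indep : seq_space_independent Y.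
Variable B : local_component.
Implicit Types (F H : B_arg G B -> R[i]) (K Q U V : set G).

Lemma amalgam_independent_of_seq : amalgam_independent mu B Y.
Proof.
have qn := qbfs_quasinormed hY.
move=> Q Q' nQ nQ'.
have [C1 C10 h1] := control_of_equiv hausG lcG haar hY indep nQ nQ'.
have [C2 C20 h2] := control_of_equiv hausG lcG haar hY indep nQ' nQ.
have lift Q1 Q2 C (h : forall m, control_norm m -> qdom Y (control_of m Q1) ->
      qdom Y (control_of m Q2) /\
      qnorm Y (control_of m Q2) <= C * qnorm Y (control_of m Q1)) F :
    qdom (amalgam mu B Y Q1) F -> qdom (amalgam mu B Y Q2) F /\
    qnorm (amalgam mu B Y Q2) F <= C * qnorm (amalgam mu B Y Q1) F.
  move=> [lF FQ1]; have cn := local_norm_control_norm hausG lcG haar lF.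
  by have [FQ2 le] := h _ cn FQ1.
apply: (equiv_spacesI C10 C20) => //.
- by move=> F [_ FQ]; exact: (qn_ge0 qn).
- by move=> F [_ FQ]; exact: (qn_ge0 qn).
- exact: lift h1.
- exact: lift h2.
Qed.

Variables (I : choiceType) (X : I -> G) (U : set G) (psi : I -> G -> R).
Hypotheses (sepX : relatively_separated X) (nU : unit_nbhd U) (upsi : bupu X U psi).

Lemma bupu_compact_support : exists V,
  [/\ unit_nbhd V, compact V & forall i x, psi i x != 0 -> ltrans (X i) V x].
Proof.
have [_ pU _] := nU; have [V [nV cV UV _]] := precompact_unit_nbhd hausG nU pU.
exists V; split=> // i x px; apply: (ltransS UV); apply: (bupu_support upsi).
exact: subset_closure.
Qed.

Let a F (i : I) := local_coef mu (psi i) F.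
Let a0 F i : 0 <= a F i. Proof. exact: local_coef_ge0. Qed.
Let cpsi := bupu_continuous upsi.
Let psi01 := bupu_range upsi.

Let discreteE Q F : synthesis X Q (fun i => (a F i)%:C) = cfun (synth X (a F) Q).
Proof. exact: (synthesisE X Q (a0 F)). Qed.

(** If [y] lies in [x Q] and [psi i y] is nonzero, then [y] lies in [x_i V] and so [x] in
    [x_i V Q^-1]. The finitely many indices with [x] in [x_i Q2] therefore carry the whole partition
    of unity on [x Q]. *)
Lemma local_norm_le_synth V Q Q2 F x : unit_nbhd V -> compact V ->
  (forall i x, psi i x != 0 -> ltrans (X i) V x) -> borel_set Q -> precompact Q ->
  precompact Q2 -> mulset V (invset Q) `<=` Q2 -> B_loc mu F ->
  local_norm mu F (ltrans x Q) <= synth X (a F) Q2 x.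
Proof.
move=> nV cV psiV mQ pQ pQ2 VQ2 lF.
have [C CP] := relatively_separated_seq hausG sepX pQ2.
have [s [us _ sP]] := CP x.
rewrite /synth (translate_sum_seq (a0 F) us sP) /=.
apply: (local_norm_le_sum hausG haar lF _ _ cpsi psi01 _ psiV).
- exact: borel_ltrans.
- exact: precompact_ltrans.
- by move=> i; exact: compact_ltrans.
move=> y /ltransP xy; have := bupu_sum upsi y.
rewrite (esum_seq _ us); first by rewrite sumEFin => -[].
  by move=> i; rewrite lee_fin; have /andP[] := psi01 i y.
move=> i /negP is_; congr EFin; apply/eqP/negPn/negP => /psiV /ltransP iy.
apply: is_; apply/sP; apply/ltransP; apply: VQ2.
exists ((X i)^-1 * y)%g => //; exists (y^-1 * x)%g; first by rewrite /invset/= invgM invgK.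
by rewrite mulgA mulgK.
Qed.

Lemma local_coef_le_norm V F i : unit_nbhd V -> compact V ->
  (forall i x, psi i x != 0 -> ltrans (X i) V x) -> B_loc mu F ->
  a F i <= 4 * local_norm mu F (ltrans (X i) V).
Proof.
move=> nV cV psiV lF.
exact: (local_coef_le hausG lcG haar (@cpsi i) (psi01 i) (compact_ltrans (x:=X i) cV) (psiV i) lF).
Qed.

Lemma discrete_amalgam_quasinormed Q : unit_nbhd Q ->
  is_quasinormed (B_loc_null mu (B := B)) (discrete_amalgam mu B Y X Q psi).
Proof.
move=> nQ; have qn := qbfs_quasinormed hY.
have [V [nV cV psiV]] := bupu_compact_support; have [_ pV _] := nV.
have cXV i : compact (ltrans (X i) V) by exact: compact_ltrans.
have aD F H i : B_loc mu F -> B_loc mu H -> a (fun t => F t + H t) i <= a F i + a H i.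
  move=> lF lH; exact: (local_coefD hausG haar (@cpsi i) (psi01 i) (cXV i) (psiV i)).
have aZ c F i : B_loc mu F -> a (fun t => c * F t) i = absC c * a F i.
  move=> lF; exact: (local_coefZ hausG haar (@cpsi i) (psi01 i) (cXV i) (psiV i)).
have aZE c F : B_loc mu F -> a (fun t => c * F t) = (fun i => absC c * a F i).
  by move=> lF; apply/funext => i; exact: aZ.
have [C C0 CP] := synth_domD hausG lcG sepX nQ hY.
split.
- split; first exact: (B_loc0 hausG haar B).
  rewrite /= discreteE; have := synth_dom0 hausG sepX nQ hY.
  suff -> : a (fun=> 0) = fun=> 0 by [].
  apply/funext => i; have := aZ 0 (fun=> 0) i (B_loc0 hausG haar _).
  rewrite (_ : (fun t => 0 * _) = fun=> 0); last by apply/funext => t; rewrite mul0r.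
  by move=> ->; rewrite (_ : absC 0 = 0) ?mul0r// (absC_real 0) normr0.
- move=> F H [lF FY] [lH HY]; split; first exact: (B_locD hausG haar).
  rewrite /= discreteE in FY; rewrite /= discreteE in HY; rewrite /= discreteE.
  by have [] := CP _ _ (a (fun t => F t + H t)) (a0 F) (a0 H)
    (fun i => introT andP (conj (a0 _ i) (aD F H i lF lH))) FY HY.
- move=> c F [lF FY]; split; first exact: (B_locZ hausG haar).
  rewrite /= discreteE in FY; rewrite /= discreteE aZE//.
  by have [] := synth_domZ hausG sepX nQ hY (a0 F) (absC_ge0 c) FY.
- by move=> F [_ FY]; exact: (qn_ge0 qn).
- move=> F [lF FY]; rewrite /= discreteE in FY; rewrite /= discreteE.
  rewrite (qn_eq0 qn)// (synth_null hausG haar sepX nQ (a0 F)).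
  rewrite (null_local_norm hausG haar lF); split=> h.
    move=> K cK; apply/eqP; rewrite eq_le.
    have mK := borel_compact hausG cK.
    have pK : precompact K by apply/(precompactP hausG); exists K.
    have [Q2 [[_ pQ2 _] _ VQ2 _]] := precompact_unit_nbhd hausG nV
      (precompact_mulset hausG pV (precompact_invset hausG pK)).
    rewrite (cn_ge0 (local_norm_control_norm hausG lcG haar lF))// andbT.
    (* The compact set [K] serves as window at the identity, where it is not moved; with all
       coefficients 0 the bound is 0. *)
    have := local_norm_le_synth 1%g nV cV psiV mK pK pQ2 VQ2 lF.
    rewrite (_ : ltrans 1%g K = K); last by apply/seteqP; split=> y; rewrite ltransP invg1 mul1g.
    move=> /le_trans; apply; rewrite (_ : a F = fun=> 0); last exact/funext.
    by rewrite /synth /translate_sum esum1// => i _; rewrite mul0r.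
  move=> i; apply/eqP; rewrite eq_le a0 andbT.
  by apply: le_trans (local_coef_le_norm i nV cV psiV lF) _; rewrite h// mulr0.
- move=> c F [lF FY]; rewrite /= discreteE in FY; rewrite /= !discreteE aZE//.
  by have [] := synth_domZ hausG sepX nQ hY (a0 F) (absC_ge0 c) FY.
- exists C => F H [lF FY] [lH HY].
  rewrite /= discreteE in FY; rewrite /= discreteE in HY; rewrite /= !discreteE.
  by have [] := CP _ _ (a (fun t => F t + H t)) (a0 F) (a0 H)
    (fun i => introT andP (conj (a0 _ i) (aD F H i lF lH))) FY HY.
Qed.

Lemma discrete_amalgam_equiv Q Q' : unit_nbhd Q -> unit_nbhd Q' ->
  equiv_spaces (amalgam mu B Y Q) (discrete_amalgam mu B Y X Q' psi).
Proof.
move=> nQ nQ'; have qn := qbfs_quasinormed hY; have [_ pQ mQ] := nQ.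
have [V [nV cV psiV]] := bupu_compact_support; have [_ pV mV] := nV.
have [Q2 [nQ2 _ VQ2 _]] := precompact_unit_nbhd hausG nV
  (precompact_mulset hausG pV (precompact_invset hausG pQ)).
have [_ pQ2 _] := nQ2.
(* The 4 is the constant of [local_coef_le_norm], valid for all three components. *)
have [C1 C10 h1] := synth_of_control hausG lcG haar hY indep sepX nQ nQ' mV pV (ler0n R 4).
have [C2 C20 h2] := control_of_synth hausG hY indep sepX nQ nQ' nQ2.
apply: (equiv_spacesI C10 C20).
- by move=> F [_ FQ]; exact: (qn_ge0 qn).
- by move=> F [_ FQ]; exact: (qn_ge0 qn).
- move=> F [lF FQ]; have cn := local_norm_control_norm hausG lcG haar lF.
  have [|aY le] := h1 _ (a F) cn _ FQ.
    by move=> i; rewrite a0; exact: local_coef_le_norm.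
  by rewrite /= discreteE; split.
- move=> F [lF]; rewrite /= discreteE => FY.
  have cn := local_norm_control_norm hausG lcG haar lF.
  have [|cY le] := h2 _ (a F) cn (a0 F) _ FY; last by split.
  by move=> x; exact: local_norm_le_synth VQ2 lF.
Qed.

End amalgams.

Theorem theorem2p3 (R : realType) (G : topGroupType)
    (mu : {measure set (borel G) -> \bar R}) (Y : qspace R G)
    (hausG : hausdorff_space G) (lcG : locally_compact [set: G])
    (haar : left_haar_measure mu) (hY : quasi_banach_function_space mu Y) :
  (amalgam_independent mu Linfty Y <-> seq_space_independent Y) /\
  (seq_space_independent Y <-> amalgam_right_invariant mu Y) /\
  (amalgam_independent mu Linfty Y \/ seq_space_independent Y \/
     amalgam_right_invariant mu Y ->
   forall B : local_component,
     amalgam_independent mu B Y /\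
     (forall (I : choiceType) (X : I -> G), well_spread X ->
      forall (U : set G) (psi : I -> G -> R), unit_nbhd U -> bupu X U psi ->
      forall Q Q' : set G, unit_nbhd Q -> unit_nbhd Q' ->
        is_quasinormed (B_loc_null mu (B := B))
          (discrete_amalgam mu B Y X Q' psi) /\
        equiv_spaces (amalgam mu B Y Q) (discrete_amalgam mu B Y X Q' psi))).
Proof.
have LooS : amalgam_independent mu Linfty Y -> seq_space_independent Y.
  exact: (Linfty_independent_seq_space hausG lcG haar hY).
(* For [B := Linfty] this is also the way back to the first condition. *)
have SB B : seq_space_independent Y -> amalgam_independent mu B Y.
  by move=> seqY; exact: (amalgam_independent_of_seq hausG lcG haar hY seqY).
have LooI : amalgam_independent mu Linfty Y -> amalgam_right_invariant mu Y.
  exact: (Linfty_independent_right_invariant hausG lcG haar hY).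
have ILoo : amalgam_right_invariant mu Y -> amalgam_independent mu Linfty Y.
  exact: (right_invariant_Linfty_independent hausG lcG haar hY).
split; first by split; [exact: LooS|exact: SB].
split; first by split=> [/SB/LooI|/ILoo/LooS].
move=> any B; have seqY : seq_space_independent Y.
  by case: any => [/LooS|[|/ILoo/LooS]].
split; first exact: SB.
move=> I X [sepX _] U psi nU upsi Q Q' nQ nQ'; split.
  exact: (discrete_amalgam_quasinormed hausG lcG haar hY B sepX nU upsi nQ').
exact: (discrete_amalgam_equiv hausG lcG haar hY seqY B sepX nU upsi nQ nQ').
Qed.
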